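(* Let $T$ be a power-bounded operator on a complex Banach space $X$. If $T$ satisfies the (dGSF) condition, then $f\mapsto f(T)$, where $f(T)$ is defined for $f\in\mathcal{B}(\mathbb{D})$ by $$\langle f(T)x,x^*\rangle := f(0)\langle x,x^*\rangle+\frac{2}{\pi}\langle g_{x,x^*},f\rangle_{\mathcal{B}},\qquad x\in X,\ x^*\in X^*,$$ is a $\mathcal{B}$-calculus for the operator $T$. Moreover, $$\|f(T)\|\le\max\left\{1,\frac{2\gamma_T}{\pi}\right\}\|f\|_{\mathcal{B}},\qquad f\in\mathcal{B}(\mathbb{D}).$$
   Context: $\mathbb{D}$ is the open unit disc in $\mathbb{C}$. $L(X)$ is the Banach algebra of bounded linear operators on $X$; $T\in L(X)$ is power-bounded if $\sup_{n\ge0}\|T^n\|<\infty$. $\mathcal{B}(\mathbb{D})$ is the Banach algebra (pointwise operations) of all holomorphic functions $f$ on $\mathbb{D}$ such that $\|f\|_{\mathcal{B}_0}:=\int_0^1\sup_{|\theta|\le\pi}|f'(re^{i\theta})|\,dr<\infty$, with the norm $\|f\|_{\mathcal{B}}:=\|f\|_\infty+\|f\|_{\mathcal{B}_0}$, where $\|f\|_\infty:=\sup_{z\in\mathbb{D}}|f(z)|<\infty$. $\mathcal{E}(\mathbb{D})$ is the space of all holomorphic functions $g$ on $\mathbb{D}$ such that $\|g\|_{\mathcal{E}_0}:=\sup_{0<r<1}(1-r)\int_{-\pi}^\pi|g'(re^{i\theta})|\,d\theta<\infty$. For $f\in\mathcal{B}(\mathbb{D})$ and $g\in\mathcal{E}(\mathbb{D})$,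 $$\langle g,f\rangle_{\mathcal{B}}:=\int_0^1 r\log\frac1r\int_{-\pi}^\pi f'(re^{i\theta})\,g'(re^{-i\theta})\,d\theta\,dr,$$ and this integral is absolutely convergent. For $T\in L(X)$ with spectral radius at most $1$, and $x\in X$, $x^*\in X^*$, put $g_{x,x^*}(z):=\langle (I-zT)^{-1}x,x^*\rangle$, $z\in\mathbb{D}$. $T$ satisfies the (dGSF) (discrete Gomilko–Shi–Feng) condition if $g_{x,x^*}\in\mathcal{E}(\mathbb{D})$ for all $x\in X$, $x^*\in X^*$, that is, $$\sup_{0<r<1}(1-r)\int_{-\pi}^\pi\big|\langle T(I-re^{i\theta}T)^{-2}x,x^*\rangle\big|\,d\theta<\infty .$$ In that case (by the Closed Graph Theorem) there is a finite constant $\gamma_T$ such that this supremum is at most $\gamma_T\|x\|\,\|x^*\|$ for all $x\in X$, $x^*\in X^*$; $\gamma_T$ denotes such a constant. The formula in the claim a priori defines $f(T)$ as an operator from $X$ to $X^{**}$. A $\mathcal{B}$-calculus for $T$ is a bounded algebra homomorphism $\mathcal{B}(\mathbb{D})\to L(X)$ mapping the constant function $1$ to the identity operator $I$ and the identity function $z$ to $T$ (so the claim includes that $f(T)$ maps $X$ into $X$). *)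

(* Defs.v *)
From HB Require Import structures.
From mathcomp Require Import all_boot all_order all_algebra.
From mathcomp Require Import all_classical all_reals all_analysis.
From mathcomp Require Import complex.

Set Implicit Arguments.
Unset Strict Implicit.
Unset Printing Implicit Defensive.
Import Order.TTheory GRing.Theory Num.Theory.
Import numFieldNormedType.Exports.

Local Open Scope classical_set_scope.
Local Open Scope ring_scope.
Local Open Scope complex_scope.

(* Norms of normed modules over [R[i]] are [R[i]]-valued (with zero imaginary
   part); [nrm] is the same norm with values in [R]. *)
Definition nrm (R : realType) (V : normedModType R[i]) (x : V) : R :=
  complex.Re `|x|.

Definition cmod (R : realType) (z : R[i]) : R := nrm (z : R[i]^o).

Definition disc (R : realType) : set R[i] := [set z | cmod z < 1].

Definition polar (R : realType) (r t : R) : R[i] :=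
  (r * cos t) +i* (r * sin t).

Definition radii (R : realType) : set R := `]0, 1[.

Definition angles (R : realType) : set R := `[- pi, pi].

(* Derivative with respect to the complex variable. *)
Definition cderive (R : realType) (f : R[i] -> R[i]) (z : R[i]) : R[i] :=
  'D_(1 : R[i]^o) (f : R[i]^o -> R[i]^o) z.

Definition holomorphic (R : realType) (f : R[i] -> R[i]) : Prop :=
  forall z, disc z -> derivable (f : R[i]^o -> R[i]^o) z 1.

Definition cintegral (R : realType) (D : set R) (F : R -> R[i]) : R[i] :=
  (\int[lebesgue_measure]_(t in D) complex.Re (F t)) +i*
  (\int[lebesgue_measure]_(t in D) complex.Im (F t)).

(* An element of a space of functions on the open disc is represented by a
   total function [R[i] -> R[i]]; nothing below depends on its values outside
   the disc. *)

Local Open Scope ereal_scope.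

Definition B0norm (R : realType) (f : R[i] -> R[i]) : \bar R :=
  \int[lebesgue_measure]_(r in @radii R)
    ereal_sup [set (cmod (cderive f (polar r t)))%:E | t in @angles R].

Definition supnorm (R : realType) (f : R[i] -> R[i]) : \bar R :=
  ereal_sup [set (cmod (f z))%:E | z in @disc R].

Definition Bnorm (R : realType) (f : R[i] -> R[i]) : \bar R :=
  supnorm f + B0norm f.

Definition Bspace (R : realType) : set (R[i] -> R[i]) :=
  [set f | [/\ holomorphic f, B0norm f < +oo & supnorm f < +oo]].

Definition E0norm (R : realType) (g : R[i] -> R[i]) : \bar R :=
  ereal_sup [set (1 - r)%R%:E *
      \int[lebesgue_measure]_(t in @angles R)
        (cmod (cderive g (polar r t)))%:E
    | r in @radii R].

Definition Espace (R : realType) : set (R[i] -> R[i]) :=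
  [set g | holomorphic g /\ E0norm g < +oo].

Local Close Scope ereal_scope.

Definition Bpairing (R : realType) (g f : R[i] -> R[i]) : R[i] :=
  cintegral (@radii R) (fun r => (r * ln (1 / r))%:C *
    cintegral (@angles R)
      (fun t => cderive f (polar r t) * cderive g (polar r (- t)))).

Definition opnorm (R : realType) (V W : normedModType R[i]) (S : V -> W)
    : \bar R :=
  ereal_sup [set (nrm (S x))%:E | x in [set x | nrm x <= 1]].

Definition bounded_op (R : realType) (V W : normedModType R[i])
    : set {linear V -> W} :=
  [set S | (opnorm S < +oo)%E].
Arguments bounded_op {R} V W.

Definition dual (R : realType) (X : normedModType R[i])
    : set {linear X -> R[i]^o} := bounded_op X (R[i]^o : normedModType R[i]).
Arguments dual {R} X.

Definition power_bounded (R : realType) (X : normedModType R[i])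
    (T : {linear X -> X}) : Prop :=
  (ereal_sup (range (fun n => opnorm (iter n T))) < +oo)%E.

(* [resolvent T z] is $(I - zT)^{-1}$ in $L(X)$; it is the junk value [point]
   when $I - zT$ is not invertible. *)
Definition resolvent (R : realType) (X : normedModType R[i])
    (T : {linear X -> X}) (z : R[i]) : {linear X -> X} :=
  get [set S : {linear X -> X} | [/\ bounded_op X X S,
    forall x, S (x - z *: T x) = x & forall x, S x - z *: T (S x) = x]].

Definition gfun (R : realType) (X : normedModType R[i])
    (T : {linear X -> X}) (x : X) (xs : {linear X -> R[i]^o}) (z : R[i])
    : R[i] :=
  xs (resolvent T z x).

Definition dGSF (R : realType) (X : normedModType R[i])
    (T : {linear X -> X}) : Prop :=
  forall x xs, dual X xs -> Espace (gfun T x xs).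

Definition dGSF_constant (R : realType) (X : normedModType R[i])
    (T : {linear X -> X}) (gamma : R) : Prop :=
  forall x xs, dual X xs ->
  (ereal_sup [set (1 - r)%R%:E *
      \int[lebesgue_measure]_(t in @angles R)
        (cmod (xs (T (resolvent T (polar r t)
                     (resolvent T (polar r t) x)))))%:E
    | r in @radii R]
  <= gamma%:E * (nrm x)%:E * opnorm xs)%E.

(* [weak_calculus T f x] is $f(T)x$ as an element of $X^{**}$. *)
Definition weak_calculus (R : realType) (X : normedModType R[i])
    (T : {linear X -> X}) (f : R[i] -> R[i]) (x : X)
    (xs : {linear X -> R[i]^o}) : R[i] :=
  f 0 * xs x + (2 / pi)%:C * Bpairing (gfun T x xs) f.

(* $S\in L(X)$ represents $f(T)$ under the canonical embedding of $X$ into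
   $X^{**}$; such an $S$ is unique because $X^*$ separates points. *)
Definition represents (R : realType) (X : normedModType R[i])
    (T : {linear X -> X}) (f : R[i] -> R[i]) : set {linear X -> X} :=
  [set S | bounded_op X X S /\
    forall x xs, dual X xs -> xs (S x) = weak_calculus T f x xs].

Definition fcalc (R : realType) (X : normedModType R[i])
    (T : {linear X -> X}) (f : R[i] -> R[i]) : {linear X -> X} :=
  get (represents T f).

Record B_calculus (R : realType) (X : normedModType R[i])
    (T : {linear X -> X}) (Phi : (R[i] -> R[i]) -> {linear X -> X}) : Prop := {
  calc_bounded_op : forall f, Bspace f -> bounded_op X X (Phi f);
  (* equality in the space is equality on the disc *)
  calc_wd : forall f g, Bspace f -> Bspace g ->
    (forall z, disc z -> f z = g z) -> Phi f =1 Phi g;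
  calcD : forall f g, Bspace f -> Bspace g ->
    forall x, Phi (fun z => f z + g z) x = Phi f x + Phi g x;
  calcZ : forall (a : R[i]) f, Bspace f ->
    forall x, Phi (fun z => a * f z) x = a *: Phi f x;
  calcM : forall f g, Bspace f -> Bspace g ->
    forall x, Phi (fun z => f z * g z) x = Phi f (Phi g x);
  calc1 : forall x, Phi (fun=> 1) x = x;
  calcX : forall x, Phi (fun z => z) x = T x;
  calc_bounded : exists M : R, forall f, Bspace f ->
    (opnorm (Phi f) <= M%:E * Bnorm f)%E
}.

(* Main.v *)
Require Import Defs.
From HB Require Import structures.
From mathcomp Require Import all_boot all_order all_algebra.
From mathcomp Require Import all_classical all_reals all_analysis.
From mathcomp Require Import measurable_realfun.
From mathcomp Require Import complex ring lra.
Set Implicit Arguments.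
Unset Strict Implicit.
Unset Printing Implicit Defensive.
Import Order.TTheory GRing.Theory Num.Theory.
Import numFieldNormedType.Exports.
Local Open Scope classical_set_scope.
Local Open Scope ring_scope.
Local Open Scope complex_scope.

(** For a power series [h = sum a_n z^n] whose coefficients decay geometrically,
   the operator [h(T)] is the norm convergent sum of the [a_n T^n], and the weak
   formula computes it. Indeed [x^*(T^n x)] is the [n]-th Taylor coefficient of
   [g = g_{x,x^*}]; on circles the monomials are orthogonal, and
   [int_0^1 r^(2n-1) log(1/r) dr = 1/(4n^2)] turns the pairing of [g] with [z^n]
   into [pi/2] times that coefficient ([Bpairing_monomial]). Summing over [n]
   gives [sum_represents].

   A general [f] is reached from its dilations [f_rho(z) = f(rho z)], [rho < 1].
   By Cauchy's formula they are power series of the previous kind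
   ([dilate_expands]). They converge to [f] in the seminorm of [B]: by the
   maximum principle the supremum of [|f'|] over a circle increases with the
   radius, so that twice this supremum dominates, and convergence holds on each
   circle ([b0_dilate_cvg]). As [0 <= r log(1/r) <= 1 - r], the duality estimate
   [|<g, f>| <= |g|_E |f|_B] is immediate ([Bpairing_bound]). Through the uniform
   boundedness principle it becomes an estimate in operator norm
   ([represents_bound]): if [S] represents [f] then
   [|S| <= K1 * (|f(0)| + |f|_B)] with a constant that depends on [T] only. The
   operators [f_rho(T)] therefore form a Cauchy sequence, and their limit is an
   operator on [X], not only into the bidual, which represents [f]
   ([calculus_ex]).

   Linearity is built into the weak formula. For the product,
   [(f g)_rho = f_rho g_rho] reduces the claim to the Cauchy product of two
   series ([sums_to_conv]), and the operator norm estimate carries it to the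
   limit ([fcalcM]). The explicit constant comes from the duality estimate
   tested on norming functionals ([fcalc_opnorm]), since [g'] is the coefficient
   [x^*(T (I - zT)^(-2) x)] that appears in the definition of [gamma]
   ([gfun_cderiv]). *)

(** * Moduli and norms *)

Lemma normE (R : realType) (V : normedModType R[i]) (x : V) :
  `|x| = (nrm x)%:C.
Proof.
rewrite /nrm; have := normr_ge0 x.
by case: `|x| => a b; rewrite lecE /= => /andP[/eqP -> _].
Qed.

Lemma cmodE (R : realType) (z : R[i]) : `|z| = (cmod z)%:C.
Proof. exact: (normE (z : R[i]^o)). Qed.

Lemma real_complex_inj (R : realType) : injective (@real_complex_def R (Phant R)).
Proof. by move=> x y []. Qed.

Lemma nrm_ge0 (R : realType) (V : normedModType R[i]) (x : V) : 0 <= nrm x.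
Proof. by rewrite -lecR -normE normr_ge0. Qed.

Lemma nrmD (R : realType) (V : normedModType R[i]) (x y : V) :
  nrm (x + y) <= nrm x + nrm y.
Proof. by rewrite -lecR -normE rmorphD /= -!normE ler_normD. Qed.

Lemma nrm0 (R : realType) (V : normedModType R[i]) : nrm (0 : V) = 0.
Proof. by apply: real_complex_inj; rewrite -normE normr0. Qed.

Lemma nrm_eq0 (R : realType) (V : normedModType R[i]) (x : V) :
  nrm x = 0 -> x = 0.
Proof. by move=> h; apply/eqP; rewrite -normr_eq0 normE h. Qed.

Lemma nrmN (R : realType) (V : normedModType R[i]) (x : V) : nrm (- x) = nrm x.
Proof. by apply: real_complex_inj; rewrite -!normE normrN. Qed.

Lemma nrmB (R : realType) (V : normedModType R[i]) (x y : V) :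
  nrm (x - y) = nrm (y - x).
Proof. by rewrite -nrmN opprB. Qed.

Lemma nrmBD (R : realType) (V : normedModType R[i]) (y x z : V) :
  nrm (x - z) <= nrm (x - y) + nrm (y - z).
Proof. by apply: le_trans (nrmD _ _); rewrite addrA subrK. Qed.

Lemma nrmD_le (R : realType) (V : normedModType R[i]) (x y : V) (a b : R) :
  nrm x <= a -> nrm y <= b -> nrm (x + y) <= a + b.
Proof. by move=> xa yb; apply: (le_trans (nrmD _ _)); apply: lerD. Qed.

Lemma nrmZ (R : realType) (V : normedModType R[i]) (a : R[i]) (x : V) :
  nrm (a *: x) = cmod a * nrm x.
Proof.
by apply: real_complex_inj; rewrite -normE normrZ cmodE normE -rmorphM.
Qed.

Lemma nrm_sum (R : realType) (V : normedModType R[i]) (I : Type) (s : seq I)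
    (P : pred I) (F : I -> V) :
  nrm (\sum_(i <- s | P i) F i) <= \sum_(i <- s | P i) nrm (F i).
Proof.
elim/big_ind2 : _ => [|x1 x2 y1 y2 h1 h2|//]; first by rewrite nrm0.
exact: nrmD_le.
Qed.

Lemma cmod_ge0 (R : realType) (z : R[i]) : 0 <= cmod z.
Proof. exact: nrm_ge0. Qed.

Lemma cmodD (R : realType) (x y : R[i]) : cmod (x + y) <= cmod x + cmod y.
Proof. exact: (nrmD (x : R[i]^o) y). Qed.

Lemma cmod0 (R : realType) : cmod (0 : R[i]) = 0.
Proof. exact: (nrm0 (R[i]^o : normedModType R[i])). Qed.

Lemma cmod_eq0 (R : realType) (x : R[i]) : cmod x = 0 -> x = 0.
Proof. exact: (@nrm_eq0 _ (R[i]^o : normedModType R[i]) x). Qed.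

Lemma cmod_gt0 (R : realType) (x : R[i]) : (0 < cmod x) = (x != 0).
Proof.
rewrite lt_neqAle cmod_ge0 andbT eq_sym.
by apply/idP/idP; apply: contra => /eqP; [move->; rewrite cmod0|move/cmod_eq0 ->].
Qed.

Lemma cmodN (R : realType) (x : R[i]) : cmod (- x) = cmod x.
Proof. exact: (nrmN (x : R[i]^o)). Qed.

Lemma cmodB (R : realType) (x y : R[i]) : cmod (x - y) = cmod (y - x).
Proof. exact: (nrmB (x : R[i]^o) y). Qed.

Lemma cmodBD (R : realType) (y x z : R[i]) :
  cmod (x - z) <= cmod (x - y) + cmod (y - z).
Proof. exact: (nrmBD (y : R[i]^o) x z). Qed.

Lemma cmodD_le (R : realType) (x y : R[i]) (a b : R) :
  cmod x <= a -> cmod y <= b -> cmod (x + y) <= a + b.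
Proof. exact: (@nrmD_le _ (R[i]^o : normedModType R[i])). Qed.

Lemma cmod_sum (R : realType) (I : Type) (s : seq I)
    (P : pred I) (F : I -> R[i]) :
  cmod (\sum_(i <- s | P i) F i) <= \sum_(i <- s | P i) cmod (F i).
Proof. exact: (@nrm_sum _ (R[i]^o : normedModType R[i])). Qed.

Lemma cmodM (R : realType) (x y : R[i]) : cmod (x * y) = cmod x * cmod y.
Proof. exact: (nrmZ x (y : R[i]^o)). Qed.

Lemma cmodR (R : realType) (a : R) : cmod a%:C = `|a|.
Proof.
apply: real_complex_inj; rewrite -cmodE normc_def /=.
by rewrite expr0n addr0 sqrtr_sqr.
Qed.

Lemma cmod1 (R : realType) : cmod (1 : R[i]) = 1.
Proof. by have := @cmodR R 1; rewrite normr1. Qed.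

Lemma cmodX (R : realType) (x : R[i]) n : cmod (x ^+ n) = cmod x ^+ n.
Proof. by elim: n => [|n IH]; rewrite ?expr0 ?cmod1// !exprS cmodM IH. Qed.

Lemma cmodV (R : realType) (x : R[i]) : cmod x^-1 = (cmod x)^-1.
Proof.
have [->|x0] := eqVneq x 0; first by rewrite invr0 cmod0 invr0.
have cx : cmod x != 0 by rewrite gt_eqF ?cmod_gt0.
by apply: (mulfI cx); rewrite -cmodM !divff ?cmod1.
Qed.

Lemma cmod_nat (R : realType) n : cmod (n%:R : R[i]) = n%:R.
Proof. by rewrite -(rmorph_nat (real_complex R)) [LHS]cmodR ger0_norm. Qed.

Lemma cmod_i (R : realType) : cmod ('i : R[i]) = 1.
Proof.
apply: real_complex_inj; rewrite -cmodE normc_def /=.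
by rewrite expr0n expr1n add0r sqrtr1.
Qed.

Lemma cmod_Re (R : realType) (z : R[i]) : `|complex.Re z| <= cmod z.
Proof. by rewrite -lecR -cmodE normc_ge_Re. Qed.

Lemma cmod_Im (R : realType) (z : R[i]) : `|complex.Im z| <= cmod z.
Proof.
have := cmod_Re ('i * z); rewrite cmodM cmod_i mul1r.
by case: z => a b /=; rewrite mul0r mul1r sub0r normrN.
Qed.

Lemma cmod_leRI (R : realType) (z : R[i]) :
  cmod z <= `|complex.Re z| + `|complex.Im z|.
Proof.
have -> : z = (complex.Re z)%:C + 'i * (complex.Im z)%:C.
  by case: z => a b; rewrite /= ; apply/eqP; rewrite eq_complex /=; apply/andP; split; apply/eqP => /=; ring.
apply: cmodD_le; first by rewrite cmodR; case: z => a b /=; rewrite !(mul0r,mul1r,subr0,addr0,sub0r,mulr0,oppr0).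
rewrite cmodM cmod_i mul1r cmodR; case: z => a b /=.
by rewrite !(mul0r,mul1r,subr0,addr0,sub0r,mulr0,oppr0,add0r).
Qed.

Lemma cmodB_ge (R : realType) (x y : R[i]) : cmod x - cmod y <= cmod (x - y).
Proof. by rewrite lerBlDr; apply: le_trans (cmodD _ _); rewrite subrK. Qed.

Lemma cmod_dist (R : realType) (x y : R[i]) : `|cmod x - cmod y| <= cmod (x - y).
Proof. by rewrite ler_norml lerNl opprB {1}cmodB !cmodB_ge. Qed.

(** * Complex derivatives *)

(** The derivative in terms of the linear error term, which adds and multiplies
   without limits of quotients. *)
Definition has_cderiv (R : realType) (f : R[i] -> R[i]) (z l : R[i]) :=
  forall e : R, 0 < e -> exists2 d : R, 0 < d & forall w,
    cmod (w - z) < d -> cmod (f w - f z - l * (w - z)) <= e * cmod (w - z).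

Lemma gt0_complexE (R : realType) (e : R[i]) :
  0 < e -> exists2 e' : R, 0 < e' & e = e'%:C.
Proof.
case: e => a b; rewrite ltcE /= => /andP[/eqP -> a0].
by exists a.
Qed.

Lemma derivable_has_cderiv (R : realType) (f : R[i] -> R[i]) (z : R[i]) :
  derivable (f : R[i]^o -> R[i]^o) z 1 -> has_cderiv f z (cderive f z).
Proof.
move=> df e e0.
have := df; rewrite /derivable => /cvgrPdist_lt /(_ e%:C).
rewrite ltcR => /(_ e0).
rewrite -/(derive _ _ _) -/(cderive f z) => /nbhs_ballP[d /= d0 H].
have [d' d'0 dE] := gt0_complexE d0.
exists d' => // w wd.
have [->|wz] := eqVneq w z.
  by rewrite !subrr mulr0 subr0 cmod0 mulr0.
have wz' : w - z != 0 by rewrite subr_eq0.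
have := H (w - z); rewrite /ball /= sub0r normrN => /(_ _ wz').
rewrite dE cmodE ltcR => /(_ wd).
rewrite cmodE ltcR /GRing.scale /= mulr1 subrK => h.
have -> : f w - f z - cderive f z * (w - z) =
  - ((cderive f z - (w - z)^-1 * (f w - f z)) * (w - z)) by field.
by rewrite cmodN cmodM ler_wpM2r ?cmod_ge0 // ltW.
Qed.

Lemma has_cderivP (R : realType) (f : R[i] -> R[i]) (z l : R[i]) :
  has_cderiv f z l ->
  derivable (f : R[i]^o -> R[i]^o) z 1 /\ cderive f z = l.
Proof.
move=> H.
pose V : normedModType R[i] := R[i]^o.
have cv : (fun h : (R[i] : numFieldType) =>
    h^-1 *: (((f : V -> V) \o shift (z : V)) (h *: (1 : V)) - (f z : V))) @ 0^'
    --> (l : V).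
  apply/cvgrPdist_le => e /gt0_complexE [e' e'0 ->].
  have [d d0 Hd] := H _ e'0.
  apply/nbhs_ballP; exists d%:C; first by rewrite /= ltcR.
  move=> h /=; rewrite /ball /= sub0r normrN cmodE ltcR => hd h0.
  rewrite cmodE lecR.
  have := Hd (h + z); rewrite addrK => /(_ hd).
  rewrite /GRing.scale /= mulr1 => hh.
  have -> : l - h^-1 * (f (h + z) - f z) =
    - ((f (h + z) - f z - l * h) / h) by field.
  by rewrite cmodN cmodM cmodV ler_pdivrMr ?cmod_gt0.
split; first by apply/cvg_ex; exists l.
exact: (@cvg_lim _ (@norm_hausdorff R[i] V) _ _ _ _ _ cv).
Qed.

Lemma has_cderiv_lip (R : realType) (f : R[i] -> R[i]) (z l : R[i]) :
  has_cderiv f z l -> exists2 d : R, 0 < d & forall w,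
    cmod (w - z) < d -> cmod (f w - f z) <= (cmod l + 1) * cmod (w - z).
Proof.
move=> /(_ 1 ltr01) [d d0 H]; exists d => // w /H h.
rewrite -(subrK (l * (w - z)) (f w - f z)) addrC mulrDl.
by apply: cmodD_le => //; rewrite cmodM.
Qed.

Lemma has_cderiv_cst (R : realType) (c z : R[i]) : has_cderiv (fun=> c) z 0.
Proof.
move=> e e0; exists 1 => // w _.
by rewrite subrr mul0r subr0 cmod0 mulr_ge0 ?cmod_ge0 ?ltW.
Qed.

Lemma has_cderiv_id (R : realType) (z : R[i]) : has_cderiv id z 1.
Proof.
move=> e e0; exists 1 => // w _.
by rewrite mul1r subrr cmod0 mulr_ge0 ?cmod_ge0 ?ltW.
Qed.

Lemma has_cderivD (R : realType) (f g : R[i] -> R[i]) (z k l : R[i]) :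
  has_cderiv f z k -> has_cderiv g z l ->
  has_cderiv (fun w => f w + g w) z (k + l).
Proof.
move=> Hf Hg e e0.
have e20 : 0 < e / 2 by rewrite divr_gt0.
have [d1 d10 H1] := Hf _ e20; have [d2 d20 H2] := Hg _ e20.
exists (Num.min d1 d2); first by rewrite lt_min d10.
move=> w; rewrite lt_min => /andP[/H1 h1 /H2 h2].
have -> : f w + g w - (f z + g z) - (k + l) * (w - z) =
  (f w - f z - k * (w - z)) + (g w - g z - l * (w - z)) by ring.
by rewrite (splitr e) mulrDl; apply: cmodD_le.
Qed.

(** The error term of the product is the sum of the error terms of the factors,
   multiplied by values of the other factor, and of a term of second order. *)
Lemma has_cderivM (R : realType) (f g : R[i] -> R[i]) (z k l : R[i]) :
  has_cderiv f z k -> has_cderiv g z l ->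
  has_cderiv (fun w => f w * g w) z (k * g z + f z * l).
Proof.
move=> Hf Hg e e0.
set A := cmod (g z); set B := cmod (f z); set C := cmod k * (cmod l + 1).
have A0 : 0 <= A := cmod_ge0 _; have B0 : 0 <= B := cmod_ge0 _.
have L0 : 0 <= cmod l + 1 by rewrite addr_ge0 ?cmod_ge0.
have C0 : 0 <= C by rewrite mulr_ge0 ?cmod_ge0.
(* with this choice the bounds of the three error terms add up to less than [e] *)
set eta := e / (A + B + C + cmod l + 2).
have den0 : 0 < A + B + C + cmod l + 2 by have := cmod_ge0 l; lra.
have eta0 : 0 < eta by rewrite divr_gt0.
have [d1 d10 H1] := Hf _ eta0; have [d2 d20 H2] := Hg _ eta0.
have [d3 d30 H3] := has_cderiv_lip Hg.
exists (Num.min (Num.min d1 d2) (Num.min d3 (Num.min 1 eta))).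
  by rewrite !lt_min d10 d20 d30 eta0 ltr01.
move=> w; rewrite !lt_min => /andP[/andP[/H1 h1 /H2 h2] /andP[/H3 h3]].
move=> /andP[w1 weta].
have -> : f w * g w - f z * g z - (k * g z + f z * l) * (w - z) =
  (f w - f z - k * (w - z)) * (g w) + (k * (w - z)) * (g w - g z)
  + f z * (g w - g z - l * (w - z)) by ring.
have W0 := cmod_ge0 (w - z).
have gw : cmod (g w) <= A + (cmod l + 1).
  rewrite -(subrK (g z) (g w)) addrC; apply: cmodD_le => //.
  by apply: (le_trans h3); rewrite ger_pMr ?ltW // ltr_wpDl ?cmod_ge0.
have -> : e = eta * (A + (cmod l + 1)) + eta * C + eta * B + eta.
  by rewrite /eta; field; rewrite gt_eqF.
apply: (@le_trans _ _ (eta * (A + (cmod l + 1)) * cmod (w - z) + eta * C * cmod (w - z) + eta * B * cmod (w - z))); last first.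
  by rewrite -!mulrDl ler_wpM2r // lerDl ltW.
apply: cmodD_le; first apply: cmodD_le.
- rewrite cmodM mulrAC; apply: ler_pM => //; exact: cmod_ge0.
- rewrite !cmodM.
  apply: (@le_trans _ _ (cmod k * cmod (w - z) * ((cmod l + 1) * cmod (w - z)))).
    by apply: ler_wpM2l; rewrite ?mulr_ge0 ?cmod_ge0.
  rewrite [leLHS](_ : _ = cmod (w - z) * C * cmod (w - z)); last by rewrite /C; ring.
  by apply: ler_wpM2r => //; apply: ler_wpM2r => //; exact: ltW.
- rewrite cmodM [leRHS](_ : _ = B * (eta * cmod (w - z))); last by ring.
  by apply: ler_wpM2l.
Qed.

Lemma has_cderiv_scale (R : realType) (f : R[i] -> R[i]) (c z l : R[i]) :
  has_cderiv f (c * z) l -> has_cderiv (fun w => f (c * w)) z (c * l).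
Proof.
have [->|c0] := eqVneq c 0.
  move=> _; rewrite mul0r => e e0; exists 1 => // w _.
  by rewrite !mul0r subrr subr0 cmod0 mulr_ge0 ?cmod_ge0 ?ltW.
have cc : 0 < cmod c by rewrite cmod_gt0.
move=> H e e0; have [d d0 Hd] := H (e / cmod c) (divr_gt0 e0 cc).
exists (d / cmod c); first by rewrite divr_gt0.
move=> w wd; have := Hd (c * w).
rewrite -mulrBr cmodM mulrA divfK ?gt_eqF // mulrA [l * c]mulrC; apply.
by rewrite mulrC -ltr_pdivlMr.
Qed.

Lemma has_cderiv_near (R : realType) (f g : R[i] -> R[i]) (z l : R[i]) (d : R) :
  0 < d -> (forall w, cmod (w - z) < d -> f w = g w) ->
  has_cderiv f z l -> has_cderiv g z l.
Proof.
move=> d0 fg H e e0; have [d' d'0 Hd] := H e e0.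
exists (Num.min d d'); first by rewrite lt_min d0.
move=> w; rewrite lt_min => /andP[wd wd'].
by rewrite -!fg ?subrr ?cmod0 //; exact: Hd.
Qed.

Lemma disc_near (R : realType) (z : R[i]) : disc z ->
  exists2 d : R, 0 < d & forall w, cmod (w - z) < d -> disc w.
Proof.
rewrite /disc /= => z1; exists (1 - cmod z); first by rewrite subr_gt0.
move=> w; rewrite ltrBrDr; apply: le_lt_trans.
by rewrite -{1}(subrK z w) cmodD.
Qed.

Lemma has_cderiv_disc (R : realType) (f g : R[i] -> R[i]) (z l : R[i]) :
  disc z -> (forall w, disc w -> f w = g w) ->
  has_cderiv f z l -> has_cderiv g z l.
Proof.
by move=> /disc_near[d d0 dw] fg; apply: has_cderiv_near d0 _ => w /dw /fg.
Qed.

Lemma holomorphicP (R : realType) (f : R[i] -> R[i]) :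
  holomorphic f <-> forall z, disc z -> has_cderiv f z (cderive f z).
Proof.
split=> H z /H; first exact: derivable_has_cderiv.
by move=> /has_cderivP[].
Qed.

(** * Integrals of complex-valued functions of a real variable *)

Definition cintegrable (R : realType) (D : set R) (F : R -> R[i]) :=
  lebesgue_measure.-integrable D (EFin \o (fun t => complex.Re (F t))) /\
  lebesgue_measure.-integrable D (EFin \o (fun t => complex.Im (F t))).

Lemma cReD (R : realType) (x y : R[i]) :
  complex.Re (x + y) = complex.Re x + complex.Re y.
Proof. by case: x => a b; case: y. Qed.

Lemma cImD (R : realType) (x y : R[i]) :
  complex.Im (x + y) = complex.Im x + complex.Im y.
Proof. by case: x => a b; case: y. Qed.

Lemma cReB (R : realType) (x y : R[i]) :
  complex.Re (x - y) = complex.Re x - complex.Re y.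
Proof. by case: x => ? ?; case: y. Qed.

Lemma cImB (R : realType) (x y : R[i]) :
  complex.Im (x - y) = complex.Im x - complex.Im y.
Proof. by case: x => ? ?; case: y. Qed.

Lemma cReM (R : realType) (x y : R[i]) : complex.Re (x * y) =
  complex.Re x * complex.Re y - complex.Im x * complex.Im y.
Proof. by case: x => a b; case: y. Qed.

Lemma cImM (R : realType) (x y : R[i]) : complex.Im (x * y) =
  complex.Re x * complex.Im y + complex.Im x * complex.Re y.
Proof. by case: x => a b; case: y. Qed.

Lemma complexP (R : realType) (x y : R[i]) :
  complex.Re x = complex.Re y -> complex.Im x = complex.Im y -> x = y.
Proof. by case: x => a b; case: y => c d /= -> ->. Qed.

Lemma integrable_lin (R : realType) (D : set R) (f g : R -> R) (a b : R) :
  measurable (D : set (measurableTypeR R)) ->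
  lebesgue_measure.-integrable D (EFin \o f) ->
  lebesgue_measure.-integrable D (EFin \o g) ->
  lebesgue_measure.-integrable D (EFin \o (fun t => a * f t + b * g t)).
Proof.
move=> mD hf hg.
have := @integrableD _ _ _ lebesgue_measure D mD _ _
  (integrableZl mD a hf) (integrableZl mD b hg).
by apply: eq_integrable => // t _ /=.
Qed.

Lemma Rintegral_lin (R : realType) (D : set R) (f g : R -> R) (a b : R) :
  measurable (D : set (measurableTypeR R)) ->
  lebesgue_measure.-integrable D (EFin \o f) ->
  lebesgue_measure.-integrable D (EFin \o g) ->
  \int[lebesgue_measure]_(t in D) (a * f t + b * g t) =
  a * \int[lebesgue_measure]_(t in D) f t +
  b * \int[lebesgue_measure]_(t in D) g t.
Proof.
move=> mD hf hg; rewrite RintegralD // ?RintegralZl //.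
- by have := integrableZl mD a hf; apply: eq_integrable => // t _ /=.
- by have := integrableZl mD b hg; apply: eq_integrable => // t _ /=.
Qed.

Lemma cintegrableZ (R : realType) (D : set R) (c : R[i]) (F : R -> R[i]) :
  measurable (D : set (measurableTypeR R)) -> cintegrable D F -> cintegrable D (fun t => c * F t).
Proof.
move=> mD [F1 F2]; split.
- have := integrable_lin (complex.Re c) (- complex.Im c) mD F1 F2.
  by apply: eq_integrable => // t _ /=; rewrite cReM mulNr.
- have := integrable_lin (complex.Re c) (complex.Im c) mD F2 F1.
  by apply: eq_integrable => // t _ /=; rewrite cImM.
Qed.

Lemma eq_cintegral (R : realType) (D : set R) (F G : R -> R[i]) :
  (forall t, D t -> F t = G t) -> cintegral D F = cintegral D G.
Proof.
move=> FG; rewrite /cintegral; congr (_ +i* _);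
  by apply: eq_Rintegral => t; rewrite inE => /FG ->.
Qed.

Lemma cintegralD (R : realType) (D : set R) (F G : R -> R[i]) :
  measurable (D : set (measurableTypeR R)) -> cintegrable D F -> cintegrable D G ->
  cintegral D (fun t => F t + G t) = cintegral D F + cintegral D G.
Proof.
move=> mD [F1 F2] [G1 G2].
apply: complexP; rewrite ?cReD ?cImD /=.
- have := Rintegral_lin 1 1 mD F1 G1; rewrite !mul1r => <-.
  by apply: eq_Rintegral => t _; rewrite !mul1r cReD.
- have := Rintegral_lin 1 1 mD F2 G2; rewrite !mul1r => <-.
  by apply: eq_Rintegral => t _; rewrite !mul1r cImD.
Qed.

Lemma cintegralZ (R : realType) (D : set R) (c : R[i]) (F : R -> R[i]) :
  measurable (D : set (measurableTypeR R)) -> cintegrable D F ->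
  cintegral D (fun t => c * F t) = c * cintegral D F.
Proof.
move=> mD [F1 F2].
apply: complexP; rewrite ?cReM ?cImM /=.
- rewrite -mulNr -Rintegral_lin //.
  by apply: eq_Rintegral => t _; rewrite cReM mulNr.
- by rewrite -Rintegral_lin //; apply: eq_Rintegral => t _; rewrite cImM.
Qed.

Lemma cintegralB (R : realType) (D : set R) (F G : R -> R[i]) :
  measurable (D : set (measurableTypeR R)) -> cintegrable D F -> cintegrable D G ->
  cintegral D (fun t => F t - G t) = cintegral D F - cintegral D G.
Proof.
move=> mD hF hG; rewrite -[- cintegral D G]mulN1r -cintegralZ // -cintegralD //.
  by apply: eq_cintegral => t _; rewrite mulN1r.
exact: cintegrableZ.
Qed.

(** If [I] is the integral and [u = |I| / I], then [|I|] is the integral of the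
   real part of [u * F], which is at most [|F|]. *)
Lemma cmod_cintegral (R : realType) (D : set R) (F : R -> R[i]) (g : R -> R) :
  measurable (D : set (measurableTypeR R)) -> cintegrable D F ->
  lebesgue_measure.-integrable D (EFin \o g) ->
  (forall t, D t -> cmod (F t) <= g t) ->
  cmod (cintegral D F) <= \int[lebesgue_measure]_(t in D) g t.
Proof.
move=> mD hF hg Fg.
have [I0|I0] := eqVneq (cintegral D F) 0.
  rewrite I0 cmod0; apply: Rintegral_ge0 => t /Fg; exact/le_trans/cmod_ge0.
set I := cintegral D F in I0 *.
pose u := (cmod I)%:C / I.
have cI : 0 < cmod I by rewrite cmod_gt0.
have u1 : cmod u = 1.
  by rewrite cmodM cmodV cmodR ger0_norm ?cmod_ge0 // divff // gt_eqF.
have -> : cmod I = complex.Re (u * I) by rewrite /u divfK.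
rewrite -cintegralZ //=; apply: le_Rintegral => //.
  by have [] := cintegrableZ u mD hF.
move=> t /Fg; apply: le_trans.
rewrite (le_trans (ler_norm _)) // (le_trans (cmod_Re _)) //.
by rewrite cmodM u1 mul1r.
Qed.

(** ** Continuous integrands on a segment *)

(** Continuity relative to the segment: the values of [F] outside of it are
   irrelevant. *)
Definition cts_on (R : realType) (a b : R) (F : R -> R[i]) :=
  forall t, a <= t <= b -> forall e : R, 0 < e -> exists2 d : R, 0 < d &
    forall u, a <= u <= b -> `|u - t| < d -> cmod (F u - F t) <= e.

Lemma cts_on_cst (R : realType) (a b : R) (c : R[i]) : cts_on a b (fun=> c).
Proof. by move=> t _ e e0; exists 1 => // u _ _; rewrite subrr cmod0 ltW. Qed.

Lemma cts_onD (R : realType) (a b : R) (F G : R -> R[i]) :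
  cts_on a b F -> cts_on a b G -> cts_on a b (fun t => F t + G t).
Proof.
move=> hF hG t tI e e0.
have e20 : 0 < e / 2 by rewrite divr_gt0.
have [d1 d10 H1] := hF t tI _ e20; have [d2 d20 H2] := hG t tI _ e20.
exists (Num.min d1 d2); first by rewrite lt_min d10.
move=> u uI; rewrite lt_min => /andP[/(H1 _ uI) h1 /(H2 _ uI) h2].
rewrite opprD addrACA (splitr e); exact: cmodD_le.
Qed.

Lemma cts_onM (R : realType) (a b : R) (F G : R -> R[i]) :
  cts_on a b F -> cts_on a b G -> cts_on a b (fun t => F t * G t).
Proof.
move=> hF hG t tI e e0.
set A := cmod (F t); set B := cmod (G t).
have A0 : 0 <= A := cmod_ge0 _; have B0 : 0 <= B := cmod_ge0 _.
pose eta := Num.min 1 (e / (A + B + 1)).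
have den : 0 < A + B + 1 by rewrite ltr_wpDl ?addr_ge0.
have eta0 : 0 < eta by rewrite lt_min ltr01 divr_gt0.
have [d1 d10 H1] := hF t tI _ eta0; have [d2 d20 H2] := hG t tI _ eta0.
exists (Num.min d1 d2); first by rewrite lt_min d10.
move=> u uI; rewrite lt_min => /andP[/(H1 _ uI) h1 /(H2 _ uI) h2].
have -> : F u * G u - F t * G t = (F u - F t) * (G u - G t)
  + (F u - F t) * G t + F t * (G u - G t) by ring.
have eta1 : eta <= 1 by rewrite ge_min lexx.
have ee : eta * (A + B + 1) <= e.
  by rewrite -ler_pdivlMr // ge_min lexx orbT.
apply: (@le_trans _ _ (eta * 1 + eta * B + A * eta)); last first.
  by apply: le_trans ee; rewrite [leRHS](_ : _ = eta * 1 + eta * B + A * eta) //; ring.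
apply: cmodD_le; [apply: cmodD_le|]; rewrite cmodM; apply: ler_pM => //;
  try exact: cmod_ge0.
exact: le_trans eta1.
Qed.

Lemma cts_on_lip (R : realType) (a b L : R) (F : R -> R[i]) :
  (forall t u, a <= t <= b -> a <= u <= b ->
    cmod (F u - F t) <= L * `|u - t|) -> cts_on a b F.
Proof.
move=> H t tI e e0; exists (e / (`|L| + 1)); first by rewrite divr_gt0 // ltr_wpDl.
move=> u uI; rewrite ltr_pdivlMr ?ltr_wpDl // => h.
apply: (le_trans (H _ _ tI uI)); apply: le_trans (ltW h).
by rewrite mulrC ler_wpM2l // (le_trans (ler_norm L)) // lerDl.
Qed.

Lemma cts_on_cmod (R : realType) (a b : R) (F : R -> R[i]) :
  cts_on a b F -> cts_on a b (fun t => (cmod (F t))%:C).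
Proof.
move=> cF t tI e e_0; have [d d0 H] := cF t tI e e_0; exists d => // u uI ut.
by rewrite -rmorphB /= cmodR; apply: le_trans (cmod_dist _ _) (H u uI ut).
Qed.

Lemma cts_on_within (R : realType) (a b : R) (F : R -> R[i]) :
  cts_on a b F ->
  {within `[a, b], continuous (fun t => complex.Re (F t) : R^o)} /\
  {within `[a, b], continuous (fun t => complex.Im (F t) : R^o)}.
Proof.
move=> H; split; apply/subspace_continuousP => t /= tI;
  apply/cvgrPdist_le => e e0; rewrite in_itv /= in tI;
  have [d d0 Hd] := H t tI e e0;
  apply/nbhs_ballP; exists d => //= u; rewrite /ball /= => ut;
  rewrite in_itv /= => uI; rewrite distrC in ut;
  apply: le_trans (Hd u uI ut); rewrite distrC.
- by apply: le_trans (cmod_Re _); rewrite /from_subspace /=; case: (F u); case: (F t).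
- by apply: le_trans (cmod_Im _); rewrite /from_subspace /=; case: (F u); case: (F t).
Qed.

Lemma cts_on_integrable (R : realType) (a b : R) (F : R -> R[i]) :
  cts_on a b F -> cintegrable `[a, b] F.
Proof.
move=> /cts_on_within[h1 h2].
by split; apply: continuous_compact_integrable => //; exact: segment_compact.
Qed.

Definition cint (R : realType) (a b : R) (F : R -> R[i]) := cintegral `[a, b] F.

Lemma cintD (R : realType) (a b : R) (F G : R -> R[i]) :
  cts_on a b F -> cts_on a b G ->
  cint a b (fun t => F t + G t) = cint a b F + cint a b G.
Proof.
by move=> hF hG; apply: cintegralD; [exact: measurable_itv | |]; exact: cts_on_integrable.
Qed.

Lemma cintB (R : realType) (a b : R) (F G : R -> R[i]) :
  cts_on a b F -> cts_on a b G ->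
  cint a b (fun t => F t - G t) = cint a b F - cint a b G.
Proof.
by move=> hF hG; apply: cintegralB; [exact: measurable_itv | |]; exact: cts_on_integrable.
Qed.

Lemma cintZ (R : realType) (a b : R) (c : R[i]) (F : R -> R[i]) :
  cts_on a b F -> cint a b (fun t => c * F t) = c * cint a b F.
Proof.
by move=> hF; apply: cintegralZ; [exact: measurable_itv |]; exact: cts_on_integrable.
Qed.

Lemma eq_cint (R : realType) (a b : R) (F G : R -> R[i]) :
  (forall t, a <= t <= b -> F t = G t) -> cint a b F = cint a b G.
Proof. by move=> FG; apply: eq_cintegral => t /=; rewrite in_itv; exact: FG. Qed.

Lemma fine_lebesgue_itvcc (R : realType) (a b : R) : a <= b ->
  fine (lebesgue_measure (`[a, b]%classic : set R)) = b - a.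
Proof.
move=> ab; rewrite lebesgue_measure_itv /= lte_fin; case: ltP => //= h.
by apply/eqP; rewrite eq_sym subr_eq0 eq_le h ab.
Qed.

Lemma cint_cst (R : realType) (a b : R) (c : R[i]) : a <= b ->
  cint a b (fun=> c) = (b - a)%:C * c.
Proof.
move=> ab; apply: complexP; rewrite ?cReM ?cImM /= Rintegral_cst //=.
- by rewrite fine_lebesgue_itvcc // mul0r subr0 mulrC.
- by rewrite fine_lebesgue_itvcc // mul0r addr0 mulrC.
Qed.

Lemma cint_bound (R : realType) (a b M : R) (F : R -> R[i]) : a <= b ->
  cts_on a b F -> (forall t, a <= t <= b -> cmod (F t) <= M) ->
  cmod (cint a b F) <= M * (b - a).
Proof.
move=> ab hF FM.
have cst : lebesgue_measure.-integrable `[a, b] (EFin \o (fun=> M)).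
  by have [] := @cts_on_integrable _ a b _ (@cts_on_cst _ a b M%:C).
have := cmod_cintegral (measurable_itv _) (cts_on_integrable hF) cst.
rewrite Rintegral_cst //= fine_lebesgue_itvcc //; apply => t /=.
by rewrite in_itv /=; exact: FM.
Qed.

Lemma Rintegral_split (R : realType) (a b c : R) (f : R -> R) :
  a <= b -> b <= c ->
  lebesgue_measure.-integrable `[a, c] (EFin \o f) ->
  \int[lebesgue_measure]_(t in `[a, c]) f t =
  \int[lebesgue_measure]_(t in `[a, b]) f t +
  \int[lebesgue_measure]_(t in `[b, c]) f t.
Proof.
move=> ab bc hf.
have := @Rintegral_itvB R f (BLeft a) (BRight c) b hf.
rewrite !bnd_simp => /(_ ab bc) h.
rewrite -[X in _ + X]Rintegral_itv_obnd_cbnd; last first.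
  apply: integrableS hf => // t /=; rewrite !in_itv /= => /andP[bt ->].
  by rewrite (le_trans ab (ltW bt)).
by rewrite -h addrC subrK.
Qed.

Lemma cint_split (R : realType) (a b c : R) (F : R -> R[i]) :
  a <= b -> b <= c -> cts_on a c F -> cint a c F = cint a b F + cint b c F.
Proof.
move=> ab bc /cts_on_integrable[h1 h2].
by apply: complexP; rewrite ?cReD ?cImD /=; exact: Rintegral_split.
Qed.

Lemma Rintegral_FTC (R : realType) (a b : R) (f F : R -> R) : a <= b ->
  {within `[a, b], continuous (f : R -> R^o)} ->
  (forall t, is_derive t (1 : R) (F : R -> R^o) (f t)) ->
  \int[lebesgue_measure]_(t in `[a, b]) f t = F b - F a.
Proof.
rewrite le_eqVlt => /predU1P[-> _ _|ab cf dF].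
  by rewrite set_itv1 Rintegral_set1 subrr.
rewrite /Rintegral (@continuous_FTC2 _ _ F) //.
  have cF t : {for t, continuous F}.
    by apply: differentiable_continuous; apply/derivable1_diffP; have [] := dF t.
  split.
  - by move=> t _; have [] := dF t.
  - by apply: cvg_at_right_filter; exact: cF.
  - by apply: cvg_at_left_filter; exact: cF.
by move=> t _; rewrite derive1E; have [] := dF t.
Qed.

Lemma cint_FTC (R : realType) (a b : R) (F G : R -> R[i]) : a <= b ->
  cts_on a b F ->
  (forall t, is_derive t (1 : R) (fun u => complex.Re (G u) : R^o) (complex.Re (F t))) ->
  (forall t, is_derive t (1 : R) (fun u => complex.Im (G u) : R^o) (complex.Im (F t))) ->
  cint a b F = G b - G a.
Proof.
move=> ab /cts_on_within[c1 c2] d1 d2.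
apply: complexP; rewrite /= (Rintegral_FTC ab _ (fun t => _)) //;
  by case: (G a); case: (G b).
Qed.

(** * The circle *)

Lemma polarE (R : realType) (r t : R) : polar r t = r%:C * polar 1 t.
Proof. by apply: complexP; rewrite ?cReM ?cImM /= !mul1r mul0r ?subr0 ?addr0. Qed.

Lemma cmod_polar1 (R : realType) (t : R) : cmod (polar 1 t) = 1.
Proof.
apply: real_complex_inj; rewrite -cmodE normc_def /=.
by rewrite !mul1r cos2Dsin2 sqrtr1.
Qed.

Lemma cmod_polar (R : realType) (r t : R) : 0 <= r -> cmod (polar r t) = r.
Proof. by move=> r0; rewrite polarE cmodM cmodR cmod_polar1 mulr1 ger0_norm. Qed.

Lemma polar_neq0 (R : realType) (r t : R) : 0 < r -> polar r t != 0.
Proof. by move=> r0; rewrite -cmod_gt0 cmod_polar // ltW. Qed.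

Lemma polar1D (R : realType) (s t : R) :
  polar 1 (s + t) = polar 1 s * polar 1 t.
Proof.
apply: complexP; rewrite ?cReM ?cImM /= !mul1r ?cosD ?sinD //.
by rewrite addrC.
Qed.

Lemma polar10 (R : realType) : polar 1 (0 : R) = 1.
Proof. by apply: complexP => /=; rewrite ?cos0 ?sin0 ?mulr1 ?mulr0. Qed.

Lemma polar1N (R : realType) (t : R) : polar 1 (- t) = (polar 1 t)^-1.
Proof.
apply: (mulfI (polar_neq0 t ltr01)).
by rewrite -polar1D subrr polar10 divff // polar_neq0.
Qed.

Lemma polar1X (R : realType) (t : R) n : polar 1 t ^+ n = polar 1 (n%:R * t).
Proof.
elim: n => [|n IH]; first by rewrite mul0r polar10 expr0.
by rewrite exprS IH -polar1D -{1}[t]mul1r -mulrDl -nat1r.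
Qed.

Lemma polar_Npi (R : realType) (r : R) : polar r (- pi) = polar r pi.
Proof. by apply: complexP; rewrite /= ?cosN ?sinN ?sinpi ?oppr0. Qed.

Lemma is_derive_cosM (R : realType) (k t : R) :
  is_derive t (1 : R) (fun u : R => cos (k * u) : R^o) (- (k * sin (k * t))).
Proof.
have h : is_derive t (1:R) (fun u : R => k * u : R^o) k.
  by apply: is_derive_eq; rewrite /GRing.scale /= mulr1.
have := @is_derive1_comp _ cos (fun u : R => k * u) t _ _ (is_derive_cos _) h.
by rewrite mulNr mulrC.
Qed.

Lemma is_derive_sinM (R : realType) (k t : R) :
  is_derive t (1 : R) (fun u : R => sin (k * u) : R^o) (k * cos (k * t)).
Proof.
have h : is_derive t (1:R) (fun u : R => k * u : R^o) k.
  by apply: is_derive_eq; rewrite /GRing.scale /= mulr1.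
have := @is_derive1_comp _ sin (fun u : R => k * u) t _ _ (is_derive_sin _) h.
by rewrite mulrC.
Qed.

Lemma cts_on_real (R : realType) (a b : R) (f : R -> R) :
  (forall t, {for t, continuous (f : R -> R^o)}) -> cts_on a b (fun t => (f t)%:C).
Proof.
move=> cf t _ e e0.
have := cf t; move=> /cvgrPdist_le /(_ e e0) /nbhs_ballP[d /= d0 H].
exists d => // u _ ut; rewrite -rmorphB /= cmodR distrC.
by apply: H; rewrite /ball /= distrC.
Qed.

Lemma cts_on_polarM (R : realType) (a b k : R) :
  cts_on a b (fun t => polar 1 (k * t)).
Proof.
have E t : polar 1 (k * t) = (cos (k * t))%:C + 'i * (sin (k * t))%:C.
  by apply: complexP; rewrite ?cReD ?cImD ?cReM ?cImM /=; ring.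
have H : cts_on a b (fun t => (cos (k * t))%:C + 'i * (sin (k * t))%:C).
  apply: cts_onD; last apply: cts_onM.
  - apply: cts_on_real => t; apply: differentiable_continuous.
    by apply/derivable1_diffP; have [] := is_derive_cosM k t.
  - exact: cts_on_cst.
  - apply: cts_on_real => t; apply: differentiable_continuous.
    by apply/derivable1_diffP; have [] := is_derive_sinM k t.
by move=> t tI e e0; have [d d0 Hd] := H t tI e e0; exists d => // u; rewrite !E; exact: Hd.
Qed.

Lemma cts_on_polar1 (R : realType) (a b : R) : cts_on a b (polar 1).
Proof.
move=> t tI e e0; have [d d0 Hd] := @cts_on_polarM _ a b 1 t tI e e0.
by exists d => // u uI /(Hd u uI); rewrite !mul1r.
Qed.

(** The exponential [t |-> e^(ikt)] is a primitive of its multiple by [ik]. *)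
Lemma cint_polarM (R : realType) (a b k : R) : a <= b ->
  k%:C * 'i * cint a b (fun t => polar 1 (k * t)) =
  polar 1 (k * b) - polar 1 (k * a).
Proof.
move=> ab; rewrite -cintZ; last exact: cts_on_polarM.
apply: (cint_FTC (G := fun t => polar 1 (k * t)) ab).
- apply: cts_onM; [exact: cts_on_cst | exact: cts_on_polarM].
- move=> t; rewrite ?(cImM, cReM) /=.
  have := is_derive_cosM k t => h.
  under eq_fun do rewrite mul1r.
  apply: is_derive_eq; ring.
- move=> t; rewrite ?(cImM, cReM) /=.
  have := is_derive_sinM k t => h.
  under eq_fun do rewrite mul1r.
  apply: is_derive_eq; ring.
Qed.

Lemma polar1_lip (R : realType) (s t : R) :
  cmod (polar 1 s - polar 1 t) <= `|s - t|.
Proof.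
wlog ts : s t / t <= s.
  move=> H; case/orP: (le_total t s); first exact: H.
  by rewrite cmodB distrC; exact: H.
have := @cint_polarM _ t s 1 ts; rewrite !mul1r => <-.
rewrite ger0_norm ?subr_ge0 // cmodM cmod_i mul1r.
rewrite -[leRHS]mul1r; apply: cint_bound => //; first exact: cts_on_polarM.
by move=> u _; rewrite cmod_polar1.
Qed.

Lemma pi_Npi (R : realType) : - pi <= (pi : R).
Proof. by rewrite -subr_ge0 opprK addr_ge0 ?pi_ge0. Qed.

(** An exponential of nonzero integral frequency has the same value at both ends
   of the period. *)
Lemma cint_polar_ortho (R : realType) (k : R) n : k = n%:R \/ k = - n%:R ->
  cint (- pi) pi (fun t => polar 1 (k * t)) = (if n == 0 then 2 * pi else 0)%:C.
Proof.
move=> kn.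
have k0 : (k == 0) = (n == 0).
  by case: kn => ->; rewrite ?oppr_eq0 pnatr_eq0.
rewrite -k0; have [-> {kn}|k00] := eqVneq k 0.
  rewrite (eq_cint (G := fun=> 1)); last by move=> t _; rewrite mul0r polar10.
  by rewrite cint_cst ?pi_Npi // mulr1 opprK -mulr2n mulr_natl.
have h := @cint_polarM _ (- pi) pi k (pi_Npi R).
have s0 : polar 1 (k * pi) - polar 1 (k * - pi) = 0.
  have E m : polar 1 (m%:R * pi : R) = polar 1 (m%:R * - pi).
    by rewrite -!polar1X polar_Npi.
  by case: kn => ->; rewrite ?mulrNN ?mulNr -?mulrN -?E subrr.
move: h; rewrite s0 => /eqP; rewrite !mulf_eq0 => /orP[/orP[]|/eqP] //.
- by move=> /eqP/(congr1 (@complex.Re R)) /= /eqP; rewrite (negPf k00).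
- by move=> /eqP/(congr1 (@complex.Im R)) /= /eqP; rewrite oner_eq0.
Qed.

Lemma cts_on_ext (R : realType) (a b : R) (F G : R -> R[i]) :
  F =1 G -> cts_on a b F -> cts_on a b G.
Proof. by move=> /funext ->. Qed.

Lemma cts_on_polar (R : realType) (a b r : R) : cts_on a b (polar r).
Proof.
apply: (@cts_on_ext _ _ _ (fun t => r%:C * polar 1 t)); first by move=> t; rewrite -polarE.
by apply: cts_onM; [exact: cts_on_cst | exact: cts_on_polar1].
Qed.

(** * Cauchy's formula for circles *)

Lemma cts_on_bounded (R : realType) (a b : R) (F : R -> R[i]) : a <= b ->
  cts_on a b F ->
  exists2 B : R, 0 <= B & forall t, a <= t <= b -> cmod (F t) <= B.
Proof.
move=> ab cF.
have [c1 _] := cts_on_within (cts_on_cmod cF).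
have [c cI cM] := EVT_max ab c1.
exists (cmod (F c)); first exact: cmod_ge0.
by move=> t tI; apply: cM; rewrite in_itv.
Qed.

Section Bisection.
Variables (R : realType) (J : R -> R -> R -> R -> R[i]).

Let half (a : R) n := a / 2 ^+ n.

(** The corner of the first quarter on which [J] is at least [c]; the fourth
   quarter is the default, as it is large when the three others are not. *)
Let quarter (c a b : R) (p : R * R) : R * R :=
  if c <= cmod (J p.1 p.2 a b) then p else
  if c <= cmod (J (p.1 + a) p.2 a b) then (p.1 + a, p.2) else
  if c <= cmod (J p.1 (p.2 + b) a b) then (p.1, p.2 + b) else
  (p.1 + a, p.2 + b).

(** The left ends of nested segments increase to a point that belongs to all of
   them. *)
Lemma nested_point (s : R^nat) (a0 : R) : 0 <= a0 ->
  (forall n, s n <= s n.+1 <= s n + half a0 n.+1) ->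
  exists x, forall n, s n <= x <= s n + half a0 n.
Proof.
move=> a00 Hs.
have hS n : half a0 n = half a0 n.+1 + half a0 n.+1.
  by rewrite /half exprS invfM; lra.
have mono n m : s n <= s (n + m)%N.
  elim: m => [|m IH]; first by rewrite addn0.
  by rewrite addnS (le_trans IH) //; case/andP: (Hs (n + m)%N).
have mono2 n m : s (n + m)%N + half a0 (n + m)%N <= s n + half a0 n.
  elim: m => [|m]; first by rewrite addn0.
  apply: le_trans; rewrite addnS (hS (n + m)%N) addrA lerD2r.
  by case/andP: (Hs (n + m)%N).
have h0 n : 0 <= half a0 n by rewrite divr_ge0 // exprn_ge0.
have key n m : s m <= s n + half a0 n.
  case/orP: (leq_total n m) => [/subnKC <-|/subnKC <-].
    by apply: le_trans (mono2 n (m - n)%N); rewrite lerDl.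
  by rewrite (le_trans (mono m (n - m)%N)) // lerDl.
have ub n : ubound (range s) (s n + half a0 n) by move=> _ [m _ <-].
exists (sup (range s)) => n; apply/andP; split.
  by apply: ub_le_sup; [exists (s 0%N + half a0 0%N); exact: ub | exists n].
by apply: ge_sup; [exists (s 0%N), 0%N | exact: ub].
Qed.

(** Goursat's argument: a quantity that is additive under subdivision into
   quarters and is infinitely smaller than the area near each point
   vanishes. *)
Lemma bisection (s0 t0 a0 b0 : R) : 0 < a0 -> 0 < b0 ->
  (forall s t a b, 0 < a -> 0 < b -> s0 <= s -> s + (a + a) <= s0 + a0 ->
    t0 <= t -> t + (b + b) <= t0 + b0 ->
    J s t (a + a) (b + b) =
    J s t a b + J (s + a) t a b + J s (t + b) a b + J (s + a) (t + b) a b) ->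
  (forall x y, s0 <= x <= s0 + a0 -> t0 <= y <= t0 + b0 ->
    forall e : R, 0 < e -> exists2 d : R, 0 < d &
    forall s t k, 0 < k -> a0 * k < d -> b0 * k < d ->
      s0 <= s -> s + a0 * k <= s0 + a0 -> t0 <= t -> t + b0 * k <= t0 + b0 ->
      s <= x <= s + a0 * k -> t <= y <= t + b0 * k ->
      cmod (J s t (a0 * k) (b0 * k)) <= e * k ^+ 2) ->
  J s0 t0 a0 b0 = 0.
Proof.
move=> a00 b00 Jadd Jloc; apply: cmod_eq0; apply/eqP.
rewrite eq_le cmod_ge0 andbT leNgt; apply/negP; set c := cmod _ => c0.
pose p := fix p n := if n is m.+1
  then quarter (c / 4 ^+ m.+1) (half a0 m.+1) (half b0 m.+1) (p m) else (s0, t0).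
have hS a n : half a n = half a n.+1 + half a n.+1.
  by rewrite /half exprS invfM; lra.
have hgt a n : 0 < a -> 0 < half a n by move=> a_0; rewrite divr_gt0 // exprn_gt0.
have pS n : (p n).1 <= (p n.+1).1 <= (p n).1 + half a0 n.+1 /\
            (p n).2 <= (p n.+1).2 <= (p n).2 + half b0 n.+1.
  have := hgt a0 n.+1 a00; have := hgt b0 n.+1 b00.
  rewrite /= /quarter; move: (half a0 n.+1) (half b0 n.+1) => a b b_0 a_0.
  by case: ifP => _ /=; [|case: ifP => _ /=; [|case: ifP => _ /=]];
    rewrite !lexx ?lerDl ?ltW.
have inv n : [/\ s0 <= (p n).1, (p n).1 + half a0 n <= s0 + a0,
    t0 <= (p n).2, (p n).2 + half b0 n <= t0 + b0 &
    c / 4 ^+ n <= cmod (J (p n).1 (p n).2 (half a0 n) (half b0 n))].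
  elim: n => [|n [h1 h2 h3 h4 h5]].
    by rewrite /half !expr0 !divr1 /=; split; rewrite ?lexx.
  have [/andP[q1 q2] /andP[q3 q4]] := pS n.
  split.
  - exact: le_trans q1.
  - by apply: le_trans h2; rewrite (hS a0 n) addrA lerD2r.
  - exact: le_trans q3.
  - by apply: le_trans h4; rewrite (hS b0 n) addrA lerD2r.
  rewrite (hS a0 n) in h2 h5; rewrite (hS b0 n) in h4 h5.
  have a_0 := hgt a0 n.+1 a00; have b_0 := hgt b0 n.+1 b00.
  rewrite (Jadd _ _ _ _ a_0 b_0) // in h5.
  have c4 : c / 4 ^+ n = 4 * (c / 4 ^+ n.+1).
    by rewrite exprS; field; rewrite expf_neq0.
  rewrite /= /quarter.
  case: ifP => //= /negbT; rewrite -ltNge => k1.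
  case: ifP => //= /negbT; rewrite -ltNge => k2.
  case: ifP => //= /negbT; rewrite -ltNge => k3.
  rewrite leNgt; apply/negP => k4.
  move: h5; apply/negP; rewrite -ltNge c4.
  set z1 := J _ _ _ _ in k1 *; set z2 := J _ _ _ _ in k2 *.
  set z3 := J _ _ _ _ in k3 *; set z4 := J _ _ _ _ in k4 *.
  have := cmodD (z1 + z2 + z3) z4; have := cmodD (z1 + z2) z3.
  have := cmodD z1 z2; lra.
have [x Hx] := nested_point (ltW a00) (fun n => (pS n).1).
have [y Hy] := nested_point (ltW b00) (fun n => (pS n).2).
have xI : s0 <= x <= s0 + a0 by have := Hx 0%N; rewrite /half expr0 divr1.
have yI : t0 <= y <= t0 + b0 by have := Hy 0%N; rewrite /half expr0 divr1.
have [|d d0 Hd] := Jloc x y xI yI (c / 2); first by rewrite divr_gt0.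
(* a number of subdivisions after which the rectangle fits into the neighbourhood *)
have [n na nb] : exists2 n, a0 * (2 ^+ n)^-1 < d & b0 * (2 ^+ n)^-1 < d.
  pose m := Num.max a0 b0 / d.
  have m0 : 0 <= m by rewrite divr_ge0 ?ltW // lt_max a00.
  exists (Num.truncn m).+1; rewrite ltr_pdivrMr ?exprn_gt0 // mulrC -ltr_pdivrMr //.
    apply: (@le_lt_trans _ _ m); first by rewrite ler_pM2r ?invr_gt0 // le_max lexx.
    rewrite (lt_trans (truncnS_gt m)) // -natrX ltr_nat; exact: ltn_expl.
  apply: (@le_lt_trans _ _ m); first by rewrite ler_pM2r ?invr_gt0 // le_max lexx orbT.
  rewrite (lt_trans (truncnS_gt m)) // -natrX ltr_nat; exact: ltn_expl.
have [h1 h2 h3 h4] := inv n; apply/negP; rewrite -ltNge.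
have k0 : 0 < (2 ^+ n : R)^-1 by rewrite invr_gt0 exprn_gt0.
apply: le_lt_trans (Hd _ _ _ k0 na nb h1 h2 h3 h4 (Hx n) (Hy n)) _.
rewrite exprVn -exprM mulnC exprM (_ : 2 ^+ 2 = 4 :> R); last by rewrite -natrX.
by rewrite ltr_pM2r ?invr_gt0 ?exprn_gt0 //; lra.
Qed.
End Bisection.

Lemma cts_onN (R : realType) (a b : R) (F : R -> R[i]) :
  cts_on a b F -> cts_on a b (fun t => - F t).
Proof.
move=> cF t tI e e0; have [d d0 H] := cF t tI e e0.
by exists d => // u uI ut; rewrite -opprD cmodN; exact: H.
Qed.

Lemma cts_on_comp (R : realType) (a b : R) (f : R[i] -> R[i]) (G : R -> R[i]) :
  cts_on a b G -> (forall t, a <= t <= b -> exists l, has_cderiv f (G t) l) ->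
  cts_on a b (fun t => f (G t)).
Proof.
move=> cG df t tI e e0; have [l /has_cderiv_lip[d d0 Hd]] := df t tI.
have l0 : 0 < cmod l + 1 by rewrite ltr_wpDl ?cmod_ge0.
have [|d' d'0 H] := cG t tI (Num.min (d / 2) (e / (cmod l + 1))).
  by rewrite lt_min !divr_gt0.
exists d' => // u uI ut; have := H u uI ut; rewrite le_min => /andP[h1 h2].
apply: (@le_trans _ _ ((cmod l + 1) * cmod (G u - G t))).
  by apply: Hd; apply: le_lt_trans h1 _; rewrite ltr_pdivrMr // ltr_pMr // ltr1n.
by rewrite mulrC -ler_pdivlMr.
Qed.

(** The circle is contracted to [z0] by [G s t = z0 + s (g t - z0)]. In the
   coordinates [(s, t)] the form [f(w) dw / (w - z0)] is [F ds / s + i F v dt], so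
   [- i] times its integral over the boundary of a rectangle is the quantity [J]
   below. Goursat's argument shows that it vanishes on [eps, 1] x [-pi, pi]. *)
(** By periodicity the two sides [t = - pi] and [t = pi] cancel, hence the integral
   of [F s * v] does not depend on [s], and [s] may tend to [0]. *)
Section CauchyFormula.
Variables (R : realType) (f : R[i] -> R[i]) (r : R) (z0 : R[i]).
Hypotheses (r0 : 0 < r) (r1 : r < 1) (z0r : cmod z0 < r).
Hypothesis hf : forall z, disc z -> has_cderiv f z (cderive f z).

Let g (t : R) := polar r t.
Let G (s t : R) := z0 + s%:C * (g t - z0).
(** The Cauchy kernel for the parametrized circle. *)
Let v (t : R) := g t / (g t - z0).
Let V := r / (r - cmod z0).

Let den_ge t : r - cmod z0 <= cmod (g t - z0).
Proof. by have := cmodB_ge (g t) z0; rewrite cmod_polar // ltW. Qed.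

Let den_neq0 t : g t - z0 != 0.
Proof. by rewrite -cmod_gt0 (lt_le_trans _ (den_ge t)) // subr_gt0. Qed.

Let den_le t : cmod (g t - z0) <= 2.
Proof.
have := cmodD (g t) (- z0); rewrite cmodN cmod_polar ?(ltW r0) //.
by move: r1 z0r; lra.
Qed.

Lemma kernel_bound t : cmod (v t) <= V.
Proof.
have rz : 0 < r - cmod z0 by rewrite subr_gt0.
rewrite cmodM cmodV cmod_polar ?(ltW r0) // ler_pM2l // lef_pV2 ?posrE //.
exact: lt_le_trans (den_ge t).
Qed.

Let G_disc s t : 0 <= s <= 1 -> disc (G s t).
Proof.
move=> /andP[s0 s1]; rewrite /disc /=.
have -> : G s t = (1 - s)%:C * z0 + s%:C * g t.
  by rewrite /G rmorphB rmorph1 /=; ring.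
apply: (@le_lt_trans _ _ r) => //.
have -> : r = (1 - s) * r + s * r by ring.
apply: cmodD_le; rewrite cmodM cmodR ger0_norm ?subr_ge0 //.
  by rewrite ler_wpM2l ?subr_ge0 // ltW.
by rewrite cmod_polar // ltW.
Qed.

Let G_lip s t x y : 0 <= s <= 1 ->
  cmod (G s t - G x y) <= 2 * `|s - x| + `|t - y|.
Proof.
move=> /andP[s0 s1].
have -> : G s t - G x y = (s - x)%:C * (g y - z0) + s%:C * (g t - g y).
  by rewrite /G rmorphB /=; ring.
apply: cmodD_le; rewrite cmodM cmodR.
  by rewrite mulrC ler_wpM2r.
rewrite ger0_norm // /g (polarE r t) (polarE r y) -mulrBr cmodM cmodR.
rewrite (ger0_norm (ltW r0)) mulrA -[leRHS]mul1r.
apply: ler_pM; rewrite ?cmod_ge0 ?mulr_ge0 ?(ltW r0) ?polar1_lip //.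
by rewrite -[leRHS]mulr1 ler_pM // ltW.
Qed.

Let F s t := f (G s t).

Let ctsFt s a b : 0 <= s <= 1 -> cts_on a b (F s).
Proof.
move=> sI; apply: cts_on_comp.
  apply: (@cts_on_lip _ _ _ 1) => t u _ _.
  by apply: (le_trans (G_lip _ _ _ sI)); rewrite subrr normr0 mulr0 add0r mul1r.
by move=> t _; exists (cderive f (G s t)); apply/hf/G_disc.
Qed.

Let ctsFs t a b : 0 <= a -> b <= 1 -> cts_on a b (F^~ t).
Proof.
move=> a0 b1; apply: cts_on_comp.
  apply: (@cts_on_lip _ _ _ 2) => s u /andP[s1 s2] /andP[u1 u2].
  apply: (le_trans (G_lip _ _ _ _)); first by rewrite (le_trans a0) // (le_trans u2).
  by rewrite subrr normr0 addr0.
move=> s /andP[s1 s2]; exists (cderive f (G s t)); apply/hf/G_disc.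
by rewrite (le_trans a0) // (le_trans s2).
Qed.

Let cts_g a b : cts_on a b g.
Proof.
apply: (@cts_on_lip _ _ _ 1) => t u _ _.
rewrite /g (polarE r u) (polarE r t) -mulrBr cmodM cmodR ger0_norm ?(ltW r0) //.
apply: ler_pM; rewrite ?cmod_ge0 ?(ltW r0) ?(ltW r1) //; exact: polar1_lip.
Qed.

Let cts_inv (a b m : R) (H : R -> R[i]) : 0 < m ->
  (forall t, a <= t <= b -> m <= cmod (H t)) ->
  cts_on a b H -> cts_on a b (fun t => (H t)^-1).
Proof.
move=> m0 Hm cH t tI e e0.
have [|d d0 Hd] := cH t tI (e * (m * m)); first by rewrite !mulr_gt0.
exists d => // u uI ut.
have H1 : 0 < cmod (H u) := lt_le_trans m0 (Hm u uI).
have H2 : 0 < cmod (H t) := lt_le_trans m0 (Hm t tI).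
have -> : (H u)^-1 - (H t)^-1 = - ((H u - H t) / (H u * H t)).
  by field; rewrite -!cmod_gt0 H1 H2.
rewrite cmodN cmodM cmodV cmodM ler_pdivrMr ?mulr_gt0 //.
apply: (le_trans (Hd u uI ut)); rewrite ler_wpM2l ?(ltW e0) //.
by apply: ler_pM; rewrite ?(ltW m0) //; exact: Hm.
Qed.

Lemma cts_kernel a b : cts_on a b v.
Proof.
apply: cts_onM => //; apply: (@cts_inv _ _ (r - cmod z0)); rewrite ?subr_gt0 //.
by apply: cts_onD => //; exact: cts_on_cst.
Qed.

Let inv_cts a b : 0 < a -> cts_on a b (fun s : R => (s^-1)%:C).
Proof.
move=> a0 t tI e e0.
have cid : cts_on a b (fun s : R => s%:C).
  by apply: (@cts_on_lip _ _ _ 1) => ? ? _ _; rewrite -rmorphB /= cmodR mul1r.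
have [|d d0 H] := @cts_inv a b a _ a0 _ cid t tI e e0.
  move=> u /andP[au _]; rewrite cmodR; exact: le_trans (ler_norm u).
by exists d => // u uI ut; rewrite !fmorphV; exact: H.
Qed.

Let H t s a := cint s (s + a) (fun x => (x^-1)%:C * F x t).
Let K s t b := cint t (t + b) (fun y => F s y * v y).
Let J s t a b := - 'i * (H t s a - H (t + b) s a) + (K (s + a) t b - K s t b).

Let ctsH t a b : 0 < a -> b <= 1 -> cts_on a b (fun x => (x^-1)%:C * F x t).
Proof.
move=> a0 b1; apply: cts_onM; first exact: inv_cts.
by apply: ctsFs b1; exact: ltW.
Qed.

Let ctsK s a b : 0 <= s <= 1 -> cts_on a b (fun y => F s y * v y).
Proof. by move=> sI; apply: cts_onM; [exact: ctsFt | exact: cts_kernel]. Qed.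

Let J_add s t a b : 0 < a -> 0 < b -> 0 < s -> s + (a + a) <= 1 ->
    J s t (a + a) (b + b) =
    J s t a b + J (s + a) t a b + J s (t + b) a b + J (s + a) (t + b) a b.
Proof.
move=> a0 b0 s0 s1.
have HS u : H u s (a + a) = H u s a + H u (s + a) a.
  rewrite /H addrA (@cint_split _ s (s + a)) ?lerDl ?ltW //.
  by apply: ctsH => //; rewrite -addrA.
have KS x : 0 <= x <= 1 -> K x t (b + b) = K x t b + K x (t + b) b.
  by move=> xI; rewrite /K addrA (@cint_split _ t (t + b)) ?lerDl ?ltW //; exact: ctsK.
have sI : 0 <= s <= 1 by rewrite (ltW s0) (le_trans _ s1) // lerDl addr_ge0 // ltW.
have sI' : 0 <= s + (a + a) <= 1 by rewrite s1 !addr_ge0 // ltW.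
rewrite /J (HS t) (HS (t + (b + b))) (KS s sI) (KS _ sI') !addrA.
move: (H t s a) (H t (s + a) a) (H (t + b) s a) (H (t + b) (s + a) a).
move: (H (t + b + b) s a) (H (t + b + b) (s + a) a) (K s t b) (K s (t + b) b).
move: (K (s + a) t b) (K (s + a) (t + b) b) (K (s + a + a) t b).
move: (K (s + a + a) (t + b) b) => *; ring.
Qed.

Let int_g t b : 0 <= b -> cint t (t + b) g = - 'i * (g (t + b) - g t).
Proof.
move=> b0.
have tb : t <= t + b by rewrite lerDl.
have := @cint_polarM _ t (t + b) 1 tb.
rewrite !mul1r (eq_cint (G := polar 1)); last by move=> u _; rewrite mul1r.
rewrite /g (polarE r (t + b)) (polarE r t) -mulrBr => <-.
have -> : - 'i * (r%:C * ('i * cint t (t + b) (polar 1))) =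
   - ('i * 'i) * (r%:C * cint t (t + b) (polar 1)) by ring.
have -> : ('i : R[i]) * 'i = - 1 by rewrite -expr2 sqr_i.
rewrite opprK mul1r -cintZ; last exact: cts_on_polar1.
by apply: eq_cint => u _; exact: polarE.
Qed.

(** Near [P = G x y] the function [f] is an affine map up to a small error, and
   [J] vanishes for affine maps: constants cancel on opposite sides, and the
   linear part is integrated exactly by [int_g]. *)
Local Lemma J_local eps x y : 0 < eps -> eps <= x <= 1 -> forall e : R, 0 < e ->
  exists2 d : R, 0 < d & forall s t a b,
    0 < a -> 0 < b -> a < d -> b < d -> eps <= s -> s + a <= 1 ->
    s <= x <= s + a -> t <= y <= t + b ->
    cmod (J s t a b) <= e * ((a + b) * (a / eps + b * V)).
Proof.
move=> eps0 /andP[ex x1] e e0.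
have x0 : 0 < x := lt_le_trans eps0 ex.
have xI : 0 <= x <= 1 by rewrite ltW.
set P := G x y; set l := cderive f P.
have e40 : 0 < e / 4 by rewrite divr_gt0.
have [d d0 Hd] := hf (G_disc y xI) e40.
rewrite -/P -/l in Hd.
exists (d / 4); first by rewrite divr_gt0.
move=> s t a b a0 b0 ad bd es s1 /andP[sx xs] /andP[ty yt].
have s0 : 0 < s := lt_le_trans eps0 es.
pose E u w := F u w - f P - l * (G u w - P).
have E_le u w : s <= u <= s + a -> t <= w <= t + b ->
    cmod (E u w) <= e / 4 * (2 * (a + b)).
  move=> /andP[su us] /andP[tw wt].
  have uI : 0 <= u <= 1 by rewrite (le_trans (ltW s0)) // (le_trans us).
  have gl : cmod (G u w - P) <= 2 * (a + b).
    apply: (le_trans (G_lip _ _ _ uI)).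
    have h1 : `|u - x| <= a by rewrite ler_norml; apply/andP; split; lra.
    have h2 : `|w - y| <= b by rewrite ler_norml; apply/andP; split; lra.
    by move: (ltW b0) h1 h2; lra.
  apply: (@le_trans _ _ (e / 4 * cmod (G u w - P))).
    by apply: Hd; apply: le_lt_trans gl _; lra.
  by rewrite ler_wpM2l // ltW.
have sa : s <= s + a by rewrite lerDl ltW.
have tb : t <= t + b by rewrite lerDl ltW.
have tI : t <= t <= t + b by rewrite lexx.
have tbI : t <= t + b <= t + b by rewrite lexx tb.
have sI : s <= s <= s + a by rewrite lexx.
have saI : s <= s + a <= s + a by rewrite lexx sa.
have s01 : 0 <= s <= 1 by rewrite ltW // (le_trans sa).
have sa01 : 0 <= s + a <= 1 by rewrite s1 addr_ge0 // ltW.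
pose A1 u := (u^-1)%:C * F u t; pose A2 u := (u^-1)%:C * F u (t + b).
pose c := l * (g t - g (t + b)).
pose B1 w := F (s + a) w * v w; pose B2 w := F s w * v w.
have cA1 : cts_on s (s + a) A1 by exact: ctsH.
have cA2 : cts_on s (s + a) A2 by exact: ctsH.
have cB1 : cts_on t (t + b) B1 by exact: ctsK.
have cB2 : cts_on t (t + b) B2 by exact: ctsK.
have cA : cts_on s (s + a) (fun u => A1 u - A2 u - c).
  by apply: cts_onD; [apply: cts_onD => //; exact: cts_onN | exact: cts_on_cst].
have cgl : cts_on t (t + b) (fun w => a%:C * l * g w).
  by apply: cts_onM => //; exact: cts_on_cst.
have cB : cts_on t (t + b) (fun w => B1 w - B2 w - a%:C * l * g w).
  by apply: cts_onD; [apply: cts_onD => //; exact: cts_onN | exact: cts_onN].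
have IA : cint s (s + a) (fun u => A1 u - A2 u - c) =
    H t s a - H (t + b) s a - a%:C * c.
  rewrite cintB; [|by apply: cts_onD => //; exact: cts_onN | exact: cts_on_cst].
  have saa : s + a - s = a by ring.
  by rewrite cintB // cint_cst // saa.
have IB : cint t (t + b) (fun w => B1 w - B2 w - a%:C * l * g w) =
    K (s + a) t b - K s t b - a%:C * l * (- 'i * (g (t + b) - g t)).
  rewrite cintB //; last by apply: cts_onD => //; exact: cts_onN.
  by rewrite cintB // cintZ // int_g // ltW.
have -> : J s t a b = - 'i * cint s (s + a) (fun u => A1 u - A2 u - c) +
    cint t (t + b) (fun w => B1 w - B2 w - a%:C * l * g w).
  by rewrite IA IB /J /c; ring.
have -> : e * ((a + b) * (a / eps + b * V)) =
    (e * (a + b) / eps) * (s + a - s) + (e * (a + b) * V) * (t + b - t).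
  by field; rewrite gt_eqF.
have ab0 : 0 <= a + b by rewrite addr_ge0 // ltW.
apply: cmodD_le.
  rewrite cmodM cmodN cmod_i mul1r; apply: cint_bound => // u uI.
  have su : s <= u by case/andP: uI.
  have u0 : 0 < u := lt_le_trans s0 su.
  have uC : u%:C != 0 :> R[i] by rewrite -cmod_gt0 cmodR normr_gt0 gt_eqF.
  have -> : A1 u - A2 u - c = (u^-1)%:C * (E u t - E u (t + b)).
    rewrite /A1 /A2 /c /E /G fmorphV; field => //.
  rewrite cmodM cmodR ger0_norm ?invr_ge0 ?(ltW u0) // mulrC.
  apply: ler_pM; rewrite ?cmod_ge0 ?invr_ge0 ?(ltW u0) //.
    have := E_le u t uI tI; have := E_le u (t + b) uI tbI.
    have := cmodD (E u t) (- E u (t + b)); rewrite cmodN; lra.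
  by rewrite lef_pV2 ?posrE // (le_trans es).
apply: cint_bound => // w wI.
have -> : B1 w - B2 w - a%:C * l * g w = (E (s + a) w - E s w) * v w.
  rewrite /B1 /B2 /E /G /v rmorphD /=; field => //.
rewrite cmodM; apply: ler_pM; rewrite ?cmod_ge0 ?kernel_bound //.
have := E_le s w sI wI; have := E_le (s + a) w saI wI.
have := cmodD (E (s + a) w) (- E s w); rewrite cmodN; lra.
Qed.

Let J_eq0 eps : 0 < eps < 1 -> J eps (- pi) (1 - eps) (pi + pi) = 0.
Proof.
move=> /andP[e0 e1].
have ee : eps + (1 - eps) = 1 by ring.
have pp : 0 < (pi : R) + pi by rewrite addr_gt0 // pi_gt0.
have V0 : 0 <= V by apply: le_trans (kernel_bound 0); exact: cmod_ge0.
apply: bisection => //; first by rewrite subr_gt0.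
  move=> s t a b a0 b0 s0 s1 _ _; apply: J_add => //; first exact: lt_le_trans s0.
  by rewrite -ee.
rewrite ee => x y xI _ e e00.
set a0 := 1 - eps; set b0 := pi + pi.
(* the error of [J_local] is homogeneous of degree 2 in the sides, as required *)
pose C := (a0 + b0) * (a0 / eps + b0 * V) + 1.
have a00 : 0 < a0 by rewrite subr_gt0.
have C0 : 0 < C.
  rewrite ltr_wpDl //; apply: mulr_ge0; first by rewrite addr_ge0 // ltW.
  by apply: addr_ge0; [apply: divr_ge0 | apply: mulr_ge0] => //; exact: ltW.
have [d d0 Hd] := J_local y e0 xI (divr_gt0 e00 C0).
exists d => // s t k k0 ak bk s0 s1 _ _ sx ty.
apply: (le_trans (Hd _ _ _ _ _ _ ak bk s0 s1 sx ty)); rewrite ?mulr_gt0 //.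
have C1 : C - 1 = (a0 + b0) * (a0 / eps + b0 * V) by rewrite /C addrK.
have Cn : C != 0 by rewrite gt_eqF.
have en : eps != 0 by rewrite gt_eqF.
have -> : e / C * ((a0 * k + b0 * k) * (a0 * k / eps + b0 * k * V)) =
    e * k ^+ 2 * ((C - 1) / C).
  by rewrite C1; move: C Cn {Hd C0 C1} => C Cn; field; rewrite Cn en.
rewrite -[leRHS]mulr1; apply: ler_wpM2l.
  by apply: mulr_ge0; [exact: ltW | rewrite exprn_ge0 // ltW].
by rewrite ler_pdivrMr // mul1r gerBl.
Qed.

Lemma cauchy_circle :
  cint (- pi) pi (fun t => f (g t) * v t) = f z0 * cint (- pi) pi v.
Proof.
have V0 : 0 <= V by apply: le_trans (kernel_bound 0); exact: cmod_ge0.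
have pp : - pi + (pi + pi) = pi :> R by rewrite addrA addNr add0r.
have G1 t : G 1 t = g t by rewrite /G; ring.
(* independence of the radius, from the vanishing of [J] *)
have step eps : 0 < eps < 1 ->
    cint (- pi) pi (fun t => f (g t) * v t) = cint (- pi) pi (fun t => F eps t * v t).
  move=> eI; have := J_eq0 eI.
  have HH s a : H (- pi) s a = H (- pi + (pi + pi)) s a.
    by apply: eq_cint => u _; rewrite pp /F /G /g polar_Npi.
  have e1 : eps + (1 - eps) = 1 by ring.
  rewrite /J HH subrr mulr0 add0r e1 /K pp => /eqP; rewrite subr_eq0 => /eqP <-.
  by apply: eq_cint => t _; rewrite /F G1.
have z0d : disc z0 by rewrite /disc /=; exact: lt_trans r1.
have [d d0 Hd] := has_cderiv_lip (hf z0d).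
apply/eqP; rewrite -subr_eq0; apply/eqP/cmod_eq0/eqP.
rewrite eq_le cmod_ge0 andbT; apply/ler_addgt0Pl => e e0; rewrite addr0.
pose L := cmod (cderive f z0) + 1.
have L0 : 0 <= L by rewrite addr_ge0 ?cmod_ge0.
pose C := L * 2 * V * (pi + pi) + 1.
have C0 : 0 < C.
  rewrite ltr_wpDl //; apply: mulr_ge0; last by rewrite addr_ge0 ?pi_ge0.
  by do 2!apply: mulr_ge0 => //.
pose eps := Num.min (1 / 2) (Num.min (d / 3) (e / C)).
have eps0 : 0 < eps by rewrite !lt_min !divr_gt0.
have eps1 : eps < 1 by rewrite gt_min; apply/orP; left; lra.
have epsd : eps * 2 < d.
  have : eps <= d / 3 by rewrite !ge_min lexx !orbT.
  by move: d0; lra.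
have epse : eps * C <= e by rewrite -ler_pdivlMr // !ge_min lexx !orbT.
rewrite (step eps) ?eps0 // -cintZ; last exact: cts_kernel.
have eI : 0 <= eps <= 1 by rewrite !ltW.
rewrite -cintB; [|exact: ctsK | by apply: cts_onM; [exact: cts_on_cst|exact: cts_kernel]].
have E : L * (eps * 2) * V * (pi - - pi) <= e.
  apply: le_trans epse; rewrite opprK /C [leRHS](_ : _ = L * (eps * 2) * V * (pi + pi) + eps).
    by rewrite lerDl ltW.
  by ring.
apply: le_trans E; apply: cint_bound; first exact: pi_Npi.
  apply: cts_onD; first exact: ctsK.
  by apply: cts_onN; apply: cts_onM; [exact: cts_on_cst|exact: cts_kernel].
move=> t _; rewrite -mulrBl cmodM.
have Gz : cmod (G eps t - z0) <= eps * 2.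
  by rewrite /G addrC addKr cmodM cmodR gtr0_norm // ler_wpM2l // ltW.
apply: ler_pM; rewrite ?cmod_ge0 ?kernel_bound //.
apply: (le_trans (Hd _ _)); first exact: le_lt_trans epsd.
by rewrite ler_wpM2l.
Qed.

End CauchyFormula.

(** * Taylor expansion *)

Lemma geometric_small (R : realType) (q C e : R) : 0 <= q < 1 -> 0 < e ->
  exists N, C * q ^+ N <= e.
Proof.
move=> /andP[q0 q1] e0.
have := @cvg_expr R q; rewrite ger0_norm // => /(_ q1) /cvgrPdist_le.
have d0 : 0 < e / (`|C| + 1) by rewrite divr_gt0 // ltr_wpDl.
move=> /(_ _ d0) [N _ /(_ N (leqnn N))] /=; rewrite sub0r normrN => h.
exists N; apply: (@le_trans _ _ ((`|C| + 1) * q ^+ N)).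
  by rewrite ler_wpM2r ?exprn_ge0 // (le_trans (ler_norm C)) // lerDl.
rewrite mulrC -ler_pdivlMr ?ltr_wpDl //; exact: le_trans (ler_norm _) h.
Qed.

Lemma geometric_le0 (R : realType) (q C x : R) : 0 <= q < 1 ->
  (forall N, x <= C * q ^+ N) -> x <= 0.
Proof.
move=> qI H; apply/ler_addgt0Pl => e e0; rewrite addr0.
by have [N] := geometric_small C qI e0; exact/le_trans/H.
Qed.

Section KernelExpansion.
Variables (R : realType) (r : R) (z : R[i]).
Hypotheses (r0 : 0 < r) (r1 : r < 1) (zr : cmod z < r).

Let g (t : R) := polar r t.
Let v (t : R) := g t / (g t - z).
Let V := r / (r - cmod z).

(** The function [t |-> (r e^(it))^(-n)]. *)
Definition ipow (r : R) n (t : R) : R[i] := (r ^- n)%:C * polar 1 (- n%:R * t).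

Lemma ipowE n t : ipow r n t = (g t ^+ n)^-1.
Proof.
rewrite /ipow /g (polarE r t) exprMn invfM -rmorphXn /= fmorphV; congr (_ * _).
by rewrite mulNr polar1N polar1X.
Qed.

Lemma cts_ipow a b n : cts_on a b (ipow r n).
Proof. by apply: cts_onM; [exact: cts_on_cst | exact: cts_on_polarM]. Qed.

Lemma cmod_ipow n t : cmod (ipow r n t) = r ^- n.
Proof.
by rewrite cmodM cmod_polar1 mulr1 cmodR ger0_norm // invr_ge0 exprn_ge0 ?ltW.
Qed.

Let cv a b : cts_on a b v. Proof. exact: cts_kernel. Qed.

Variables (h : R -> R[i]) (B : R).
Hypothesis ch : cts_on (- pi) pi h.
Hypothesis hB : forall t, - pi <= t <= pi -> cmod (h t) <= B.

Let rest N := cint (- pi) pi (fun t => h t * v t * (z ^+ N * ipow r N t)).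

Let crest N : cts_on (- pi) pi (fun t => h t * v t * (z ^+ N * ipow r N t)).
Proof.
apply: cts_onM; first exact: cts_onM.
by apply: cts_onM; [exact: cts_on_cst | exact: cts_ipow].
Qed.

Let rest_bound N : cmod (rest N) <= 2 * pi * (B * V * (cmod z / r) ^+ N).
Proof.
rewrite mulrC (_ : 2 * pi = pi - - pi); last by rewrite opprK mulrDl !mul1r.
apply: cint_bound; [exact: pi_Npi | exact: crest |] => t tI.
rewrite cmodM; apply: ler_pM; rewrite ?cmod_ge0 //.
  rewrite cmodM; apply: ler_pM; rewrite ?cmod_ge0 ?hB //.
  exact: kernel_bound.
by rewrite cmodM cmodX cmod_ipow exprMn exprVn.
Qed.

(** The geometric series [g / (g - z) = sum_n (z / g)^n]; the difference with a
   partial sum is the integral of the same kernel multiplied by [(z / g)^N]. *)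
Lemma kernel_expansion N :
  cmod (cint (- pi) pi (fun t => h t * v t) -
        \sum_(n < N) z ^+ n * cint (- pi) pi (fun t => h t * ipow r n t))
  <= 2 * pi * (B * V * (cmod z / r) ^+ N).
Proof.
suff -> : cint (- pi) pi (fun t => h t * v t) -
        \sum_(n < N) z ^+ n * cint (- pi) pi (fun t => h t * ipow r n t) = rest N.
  exact: rest_bound.
elim: N => [|N IH].
  rewrite big_ord0 subr0; apply: eq_cint => t _.
  by rewrite ipowE !expr0 invr1 !mulr1.
rewrite big_ord_recr /=.
have -> (x y w : R[i]) : x - (y + w) = (x - y) - w by ring.
rewrite IH.
rewrite -cintZ; last by apply: cts_onM => //; exact: cts_ipow.
rewrite -cintB //; last first.
  by apply: cts_onM; [exact: cts_on_cst | apply: cts_onM => //; exact: cts_ipow].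
apply: eq_cint => t _; rewrite !ipowE /v !exprS invfM.
have g0 : g t != 0 by exact: polar_neq0.
have gz : g t - z != 0.
  rewrite -cmod_gt0; apply: lt_le_trans (cmodB_ge _ _).
  by rewrite cmod_polar ?subr_gt0 // ltW.
have gN : g t ^+ N != 0 by rewrite expf_neq0.
move: (g t ^+ N) gN => G gN; field.
by rewrite gN g0 gz.
Qed.

End KernelExpansion.

(** Only the constant term of the geometric series has a nonzero mean. *)
Lemma int_kernel (R : realType) (r : R) (z : R[i]) :
  0 < r -> r < 1 -> cmod z < r ->
  cint (- pi) pi (fun t => polar r t / (polar r t - z)) = (2 * pi)%:C.
Proof.
move=> r0 r1 zr; apply/eqP; rewrite -subr_eq0; apply/eqP/cmod_eq0/eqP.
rewrite eq_le cmod_ge0 andbT.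
have qI : 0 <= cmod z / r < 1.
  by rewrite divr_ge0 ?cmod_ge0 ?ltW //= ltr_pdivrMr // mul1r.
pose C := 2 * pi * (1 * (r / (r - cmod z))) * (cmod z / r).
apply: (@geometric_le0 _ _ C _ qI) => N.
have := @kernel_expansion _ r z r0 r1 zr (fun=> 1) 1 (@cts_on_cst _ _ _ 1) _ N.+1.
rewrite [X in cmod (X - _)](eq_cint (G := fun t => polar r t / (polar r t - z))); last by move=> t _; rewrite mul1r.
rewrite big_ord_recl expr0 mul1r big1 ?addr0; last first.
  move=> i _; rewrite (eq_cint (G := ipow r (lift ord0 i))); last first.
    by move=> t _; rewrite mul1r.
  rewrite cintZ ?(@cint_polar_ortho _ _ (lift ord0 i)) /=; [|by right|exact: cts_on_polarM].
  by rewrite !mulr0.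
rewrite (eq_cint (F := fun t => 1 * ipow r 0 t) (G := fun t => polar 1 (0 * t))); last first.
  by move=> t _; rewrite ipowE expr0 invr1 mul0r polar10 mulr1.
rewrite (@cint_polar_ortho _ 0 0) /=; last by left.
move=> H; apply: (le_trans (H _)); first by move=> t _; rewrite cmod1.
by rewrite /C exprS; lra.
Qed.

(** The value at [z] is the Cauchy integral over the circle of radius [r]; the
   coefficients do depend on [r] a priori, which is harmless. *)
Lemma taylor (R : realType) (f : R[i] -> R[i]) (r B : R) :
  0 < r -> r < 1 -> (forall z, disc z -> has_cderiv f z (cderive f z)) ->
  (forall t, - pi <= t <= pi -> cmod (f (polar r t)) <= B) ->
  exists a : nat -> R[i], (forall n, cmod (a n) <= B * r ^- n) /\
    forall z, cmod z < r -> forall N,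
      cmod (f z - \sum_(n < N) a n * z ^+ n) <=
      B * (r / (r - cmod z)) * (cmod z / r) ^+ N.
Proof.
move=> r0 r1 hf fB.
have cf a b : cts_on a b (fun t => f (polar r t)).
  apply: cts_on_comp; first exact: cts_on_polar.
  move=> t _; exists (cderive f (polar r t)); apply: hf.
  by rewrite /disc /= cmod_polar // ltW.
pose a n := ((2 * pi)^-1)%:C * cint (- pi) pi (fun t => f (polar r t) * ipow r n t).
have p0 : 0 < 2 * pi :> R by rewrite mulr_gt0 ?pi_gt0.
have cip n : cts_on (- pi) pi (fun t => f (polar r t) * ipow r n t).
  by apply: cts_onM => //; exact: cts_ipow.
exists a; split=> [n|z zr N].
  rewrite cmodM cmodR ger0_norm ?invr_ge0 ?(ltW p0) // ler_pdivrMl // mulrC.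
  rewrite (_ : 2 * pi = pi - - pi); last by rewrite opprK mulrDl !mul1r.
  apply: cint_bound; [exact: pi_Npi | exact: cip |] => t tI.
  by rewrite cmodM cmod_ipow //; apply: ler_pM; rewrite ?cmod_ge0 ?fB // invr_ge0 exprn_ge0 ?ltW.
have := @kernel_expansion _ r z r0 r1 zr _ B (cf _ _) fB N.
rewrite (cauchy_circle r0 r1 zr hf) int_kernel //.
rewrite -ler_pdivrMl //; apply: le_trans.
rewrite -[X in X * cmod _](ger0_norm (_ : 0 <= (2 * pi)^-1)) ?invr_ge0 ?(ltW p0) //.
rewrite -cmodR -cmodM mulrBr.
have -> : ((2 * pi)^-1)%:C * (f z * (2 * pi)%:C) = f z.
  by rewrite mulrCA -rmorphM /= mulVf ?gt_eqF // mulr1.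
rewrite mulr_sumr le_eqVlt; apply/orP; left; apply/eqP; congr (cmod (_ - _)).
by apply: eq_bigr => i _; rewrite /a mulrAC mulrA mulrC mulrA mulrC.
Qed.

(** * Power series with geometrically decaying coefficients *)

Lemma holomorphic_ex (R : realType) (f : R[i] -> R[i]) :
  (forall z, disc z -> exists l, has_cderiv f z l) -> holomorphic f.
Proof. by move=> H z /H[l /has_cderivP[]]. Qed.

Lemma holomorphic_cderiv (R : realType) (f : R[i] -> R[i]) z :
  holomorphic f -> disc z -> has_cderiv f z (cderive f z).
Proof. by move=> /holomorphicP; exact. Qed.

Lemma eq_holomorphic (R : realType) (f g : R[i] -> R[i]) :
  f =1 g -> holomorphic f -> holomorphic g.
Proof. by move=> /funext ->. Qed.

Lemma holomorphicD (R : realType) (f g : R[i] -> R[i]) :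
  holomorphic f -> holomorphic g -> holomorphic (fun z => f z + g z).
Proof.
move=> hf hg; apply: holomorphic_ex => z zd.
by eexists; apply: has_cderivD; exact: holomorphic_cderiv.
Qed.

Lemma holomorphicM (R : realType) (f g : R[i] -> R[i]) :
  holomorphic f -> holomorphic g -> holomorphic (fun z => f z * g z).
Proof.
move=> hf hg; apply: holomorphic_ex => z zd.
by eexists; apply: has_cderivM; exact: holomorphic_cderiv.
Qed.

Lemma holomorphic_cst (R : realType) (c : R[i]) : holomorphic (fun=> c).
Proof. by apply: holomorphic_ex => z _; eexists; exact: has_cderiv_cst. Qed.

Lemma holomorphic_id (R : realType) : holomorphic (fun z : R[i] => z).
Proof. by apply: holomorphic_ex => z _; eexists; exact: has_cderiv_id. Qed.

Lemma holomorphicX (R : realType) (f : R[i] -> R[i]) n :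
  holomorphic f -> holomorphic (fun z => f z ^+ n).
Proof.
move=> hf; elim: n => [|n IH]; first exact: holomorphic_cst.
apply: (@eq_holomorphic _ (fun z => f z * f z ^+ n)); last exact: (holomorphicM hf IH).
by move=> z; rewrite exprS.
Qed.

Lemma holomorphic_sum (R : realType) (f : nat -> R[i] -> R[i]) n :
  (forall k, holomorphic (f k)) -> holomorphic (fun z => \sum_(k < n) f k z).
Proof.
move=> hf; elim: n => [|n IH].
  apply: (@eq_holomorphic _ (fun=> 0)); last exact: holomorphic_cst.
  by move=> z; rewrite big_ord0.
apply: (@eq_holomorphic _ (fun z => \sum_(k < n) f k z + f n z)).
  by move=> z; rewrite big_ord_recr.
exact: (holomorphicD IH (hf n)).
Qed.

Lemma holomorphic_poly (R : realType) (a : nat -> R[i]) n :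
  holomorphic (fun z => \sum_(k < n) a k * z ^+ k).
Proof.
apply: (holomorphic_sum (f := fun k z => a k * z ^+ k)) => k.
exact: (holomorphicM (@holomorphic_cst _ (a k)) (@holomorphicX _ _ k (@holomorphic_id R))).
Qed.

Definition dilate (R : realType) (rho : R) (f : R[i] -> R[i]) : R[i] -> R[i] :=
  fun z => f (rho%:C * z).

Lemma dilate_cderiv (R : realType) (rho : R) (f : R[i] -> R[i]) z :
  holomorphic f -> 0 <= rho < 1 -> cmod z <= 1 ->
  has_cderiv (dilate rho f) z (rho%:C * cderive f (rho%:C * z)).
Proof.
move=> hf /andP[r0 r1] z1; apply: has_cderiv_scale; apply: holomorphic_cderiv => //.
rewrite /disc /= cmodM cmodR ger0_norm //; apply: le_lt_trans r1.
by rewrite -[leRHS]mulr1 ler_wpM2l.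
Qed.

Lemma dilate_holomorphic (R : realType) (rho : R) (f : R[i] -> R[i]) :
  holomorphic f -> 0 <= rho < 1 -> holomorphic (dilate rho f).
Proof.
move=> hf rI; apply: holomorphic_ex => z zd; eexists.
by apply: dilate_cderiv => //; exact: ltW.
Qed.

(** [expands h a]: on the closed disc [h] is the sum of the power series with
   coefficients [a], which converges geometrically. *)
Definition expands (R : realType) (h : R[i] -> R[i]) (a : nat -> R[i]) :=
  exists q C : R, [/\ 0 <= q < 1, 0 <= C, forall n, cmod (a n) <= C * q ^+ n &
    forall z, cmod z <= 1 -> forall N,
      cmod (h z - \sum_(n < N) a n * z ^+ n) <= C * q ^+ N].

(** The Taylor coefficients on a circle of radius between [rho] and [1], multiplied
   by [rho ^ n], decay geometrically. *)
Lemma dilate_expands (R : realType) (rho : R) (f : R[i] -> R[i]) :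
  holomorphic f -> 0 <= rho < 1 -> exists a, expands (dilate rho f) a.
Proof.
move=> hf /andP[rho0 rho1].
pose r := (1 + rho) / 2.
have [r0 r1 rr] : [/\ 0 < r, r < 1 & rho < r] by rewrite /r; split; lra.
have [B B0 fB] : exists2 B : R, 0 <= B &
    forall t, - pi <= t <= pi -> cmod (f (polar r t)) <= B.
  apply: (@cts_on_bounded _ _ _ (fun t => f (polar r t))); first exact: pi_Npi.
  apply: cts_on_comp; first exact: cts_on_polar.
  move=> t _; eexists; apply: holomorphic_cderiv => //.
  by rewrite /disc /= cmod_polar // ltW.
have [a [aB aS]] := taylor r0 r1 ((holomorphicP f).1 hf) fB.
exists (fun n => a n * (rho ^+ n)%:C); exists (rho / r), (B * (r / (r - rho))).
have rr0 : 0 < r - rho by rewrite subr_gt0.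
have K1 : 1 <= r / (r - rho) by rewrite ler_pdivlMr // mul1r gerBl.
have q0 : 0 <= rho / r by rewrite divr_ge0 // ltW.
split.
- by rewrite q0 ltr_pdivrMr // mul1r.
- by rewrite mulr_ge0 // (le_trans ler01).
- move=> n; rewrite cmodM cmodR ger0_norm ?exprn_ge0 // exprMn exprVn.
  rewrite [rho ^+ n * _]mulrC [leRHS]mulrA ler_wpM2r ?exprn_ge0 //.
  apply: (le_trans (aB n)); rewrite ler_wpM2r ?invr_ge0 ?exprn_ge0 ?(ltW r0) //.
  by rewrite -[leLHS]mulr1 ler_wpM2l.
move=> z z1 N.
have cz : cmod (rho%:C * z) <= rho.
  by rewrite cmodM cmodR ger0_norm // -[leRHS]mulr1 ler_wpM2l.
have czr := le_lt_trans cz rr.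
have := aS _ czr N.
have -> : \sum_(n < N) a n * (rho%:C * z) ^+ n =
  \sum_(n < N) a n * (rho ^+ n)%:C * z ^+ n.
  by apply: eq_bigr => i _; rewrite exprMn rmorphXn /= mulrA.
rewrite -/(dilate rho f z) => /le_trans; apply.
have d0 : 0 < r - cmod (rho%:C * z) by rewrite subr_gt0.
apply: ler_pM.
- by rewrite mulr_ge0 // divr_ge0 // ltW.
- by rewrite exprn_ge0 // divr_ge0 ?cmod_ge0 // ltW.
- by rewrite ler_wpM2l // ler_wpM2l ?(ltW r0) // lef_pV2 ?posrE // lerB.
- apply: lerXn2r; rewrite ?nnegrE //; first by rewrite divr_ge0 ?cmod_ge0 ?(ltW r0).
  by rewrite ler_wpM2r // invr_ge0 ltW.
Qed.

Lemma geo_tail (R : realType) (q : R) (N M : nat) : 0 <= q < 1 ->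
  \sum_(N <= n < N + M) q ^+ n <= q ^+ N / (1 - q).
Proof.
move=> /andP[q0 q1]; have d0 : 0 < 1 - q by rewrite subr_gt0.
suff : \sum_(N <= n < N + M) q ^+ n = (q ^+ N - q ^+ (N + M)) / (1 - q).
  by move=> ->; rewrite ler_wpM2r ?invr_ge0 ?(ltW d0) // gerBl exprn_ge0.
elim: M => [|M IH]; first by rewrite addn0 big_geq // subrr mul0r.
rewrite addnS big_nat_recr ?leq_addr //= IH exprS; field.
by rewrite gt_eqF.
Qed.

(** With [s = q^(1/4)] one has [(n + 1) s^n <= 1 + s + ... + s^n <= 1 / (1 - s)], and
   the square of this inequality leaves the factor [s^(2n) = sqrt(q)^n]. *)
Lemma sqr_geo (R : realType) (q : R) : 0 <= q < 1 ->
  exists q' D : R, [/\ 0 <= q' < 1, 0 <= D &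
    forall n, n.+1%:R ^+ 2 * q ^+ n <= D * q' ^+ n].
Proof.
move=> /andP[q0 q1].
pose p := Num.sqrt q; pose s := Num.sqrt p.
have pq : p ^+ 2 = q by rewrite sqr_sqrtr.
have p0 : 0 <= p by exact: sqrtr_ge0.
have s0 : 0 <= s by exact: sqrtr_ge0.
have sp : s ^+ 2 = p by rewrite sqr_sqrtr.
have p1 : p < 1 by rewrite -(@ltr_pXn2r _ 2) ?nnegrE // pq expr1n.
have s1 : s < 1 by rewrite -(@ltr_pXn2r _ 2) ?nnegrE // sp expr1n.
exists p, ((1 - s)^-1 ^+ 2); rewrite p0 p1 exprn_ge0 ?invr_ge0 ?subr_ge0 ?ltW //.
split=> // n.
have -> : n.+1%:R ^+ 2 * q ^+ n = (n.+1%:R * s ^+ n) ^+ 2 * p ^+ n.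
  by rewrite exprMn -exprM mulnC exprM sp -pq -exprM mulnC exprM; ring.
rewrite ler_wpM2r ?exprn_ge0 //.
apply: lerXn2r; rewrite ?nnegrE ?mulr_ge0 ?exprn_ge0 ?invr_ge0 ?subr_ge0 ?(ltW s1) //.
have sI : 0 <= s < 1 by rewrite s0.
have := geo_tail 0 n.+1 sI; rewrite expr0 mul1r; apply: le_trans.
rewrite add0n big_mkord mulr_natl -[n.+1 in leLHS]card_ord -sumr_const.
apply: ler_sum => i _; rewrite ler_wiXn2l ?(ltW s1) //.
by rewrite -ltnS.
Qed.

Lemma expr_lip (R : realType) (z w : R[i]) n : cmod z <= 1 -> cmod w <= 1 ->
  cmod (z ^+ n - w ^+ n) <= n%:R * cmod (z - w).
Proof.
move=> z1 w1; elim: n => [|n IH]; first by rewrite !expr0 subrr cmod0 mul0r.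
have -> : z ^+ n.+1 - w ^+ n.+1 = z * (z ^+ n - w ^+ n) + (z - w) * w ^+ n.
  by rewrite !exprS; ring.
rewrite -[n.+1%:R]natr1 [leRHS]mulrDl mul1r; apply: cmodD_le; rewrite cmodM.
  by apply: le_trans IH; rewrite ler_piMl ?cmod_ge0.
by rewrite ler_piMr ?cmod_ge0 // cmodX exprn_ile1 ?cmod_ge0.
Qed.

(** Second order Taylor estimate of a power on the closed disc. The factor
   [(n + 1)^2] is harmless against geometrically decaying coefficients. *)
Lemma expr_diff2 (R : realType) (z w : R[i]) n : cmod z <= 1 -> cmod w <= 1 ->
  cmod (z ^+ n.+1 - w ^+ n.+1 - n.+1%:R * w ^+ n * (z - w)) <=
  n.+1%:R ^+ 2 * cmod (z - w) ^+ 2.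
Proof.
move=> z1 w1; elim: n => [|n IH].
  rewrite expr0 !expr1 !mul1r subrr cmod0 expr1n mul1r exprn_ge0 ?cmod_ge0 //.
have -> : z ^+ n.+2 - w ^+ n.+2 - n.+2%:R * w ^+ n.+1 * (z - w) =
   z * (z ^+ n.+1 - w ^+ n.+1 - n.+1%:R * w ^+ n * (z - w)) +
   n.+1%:R * (w ^+ n * (z - w) ^+ 2).
  by rewrite !exprS -[n.+2%:R]natr1; ring.
have nn : n.+1%:R ^+ 2 + n.+1%:R <= n.+2%:R ^+ 2 :> R.
  by rewrite -[n.+2%:R]natr1 sqrrD mulr1 expr1n; have := ler0n R n.+1; lra.
apply: (@le_trans _ _ ((n.+1%:R ^+ 2 + n.+1%:R) * cmod (z - w) ^+ 2)); last first.
  by rewrite ler_wpM2r // exprn_ge0 ?cmod_ge0.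
rewrite [leRHS]mulrDl; apply: cmodD_le; rewrite cmodM.
  by apply: le_trans IH; rewrite ler_piMl ?cmod_ge0.
rewrite cmod_nat ler_wpM2l // cmodM !cmodX ler_piMl ?exprn_ge0 ?cmod_ge0 //.
by rewrite exprn_ile1 ?cmod_ge0.
Qed.

Lemma geo_sum_le (R : realType) (q D : R) (F : nat -> R) (N m : nat) :
  0 <= q < 1 -> 0 <= D -> (forall n, F n <= D * q ^+ n) ->
  \sum_(N <= n < N + m) F n <= D / (1 - q) * q ^+ N.
Proof.
move=> qI D0 FD; apply: (@le_trans _ _ (D * \sum_(N <= n < N + m) q ^+ n)).
  by rewrite mulr_sumr; apply: ler_sum.
rewrite -mulrA ler_wpM2l // mulrC.
exact: geo_tail.
Qed.

(** The series may be differentiated term by term: the second order estimates of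
   the powers add up to [O(|z - w|^2)], uniformly in the number of terms. The
   Lipschitz bound comes from the series in the same way. *)
Lemma expands_cderiv (R : realType) (h h1 : R[i] -> R[i]) (a : nat -> R[i]) :
  expands h a -> (forall z, cmod z < 1 -> has_cderiv h z (h1 z)) ->
  exists q D : R, [/\ 0 <= q < 1, 0 <= D,
    forall z, cmod z < 1 -> forall N,
      cmod (h1 z - \sum_(0 <= n < N) n.+1%:R * a n.+1 * z ^+ n) <= D * q ^+ N &
    forall z w, cmod z < 1 -> cmod w < 1 ->
      cmod (h1 z - h1 w) <= D * cmod (z - w)].
Proof.
move=> [q0 [C [q0I C0 aC aS]]] dh.
have [q [D0 [qI D00 HD]]] := sqr_geo q0I.
have [q00 q01] := andP q0I.
have [q_0 q_1] := andP qI.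
pose b n := a n.+1.
have bC n : n.+1%:R ^+ 2 * cmod (b n) <= C * D0 * q ^+ n.
  rewrite -mulrA; apply: (@le_trans _ _ (n.+1%:R ^+ 2 * (C * q0 ^+ n))).
    rewrite ler_wpM2l ?exprn_ge0 //; apply: (le_trans (aC _)).
    by rewrite ler_wpM2l // exprS ler_piMl ?exprn_ge0 // ltW.
  by rewrite mulrCA ler_wpM2l.
pose E := C * D0 / (1 - q).
have E0 : 0 <= E by rewrite divr_ge0 ?mulr_ge0 // subr_ge0 ltW.
have CD0 : 0 <= C * D0 by rewrite mulr_ge0.
pose S N w := \sum_(0 <= n < N) n.+1%:R * b n * w ^+ n.
have sumE N m (F : nat -> R) : (forall n, F n <= n.+1%:R ^+ 2 * cmod (b n)) ->
    \sum_(N <= n < N + m) F n <= E * q ^+ N.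
  by move=> FF; apply: geo_sum_le => // n; exact: le_trans (FF n) (bC n).
have n1 n : n.+1%:R * cmod (b n) <= n.+1%:R ^+ 2 * cmod (b n).
  by rewrite ler_wpM2r ?cmod_ge0 // -natrX ler_nat expnS expn1 leq_pmulr.
(* the difference quotient against the differentiated partial sum, uniformly in [N] *)
have stepA z w N : cmod z <= 1 -> cmod w <= 1 ->
    cmod (h z - h w - S N w * (z - w)) <=
    E * cmod (z - w) ^+ 2 + E * q ^+ N * cmod (z - w).
  move=> z1 w1; rewrite -subr_le0.
  apply: (@geometric_le0 _ q0 (C + C) _ q0I) => m; rewrite lerBlDr.
  pose M := (N + m)%N.
  have SE u : \sum_(n < M.+1) a n * u ^+ n = a 0%N + \sum_(0 <= n < M) b n * u ^+ n.+1.
    by rewrite big_ord_recl expr0 mulr1 big_mkord.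
  have -> : h z - h w - S N w * (z - w) =
     ((h z - \sum_(n < M.+1) a n * z ^+ n) - (h w - \sum_(n < M.+1) a n * w ^+ n)) +
     (\sum_(0 <= n < N) b n * (z ^+ n.+1 - w ^+ n.+1 - n.+1%:R * w ^+ n * (z - w)) +
      \sum_(N <= n < M) b n * (z ^+ n.+1 - w ^+ n.+1)).
    rewrite !SE !(@big_cat_nat _ _ _ N 0 M) ?leq_addr //=.
    rewrite [X in _ + (X + _)](_ : _ = \sum_(0 <= n < N) b n * z ^+ n.+1 -
       \sum_(0 <= n < N) b n * w ^+ n.+1 - S N w * (z - w)); last first.
      rewrite /S mulr_suml -!sumrB; apply: eq_bigr => n _; ring.
    rewrite [X in _ + (_ + X)](_ : _ = \sum_(N <= n < M) b n * z ^+ n.+1 -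
       \sum_(N <= n < M) b n * w ^+ n.+1); last first.
      by rewrite -sumrB; apply: eq_bigr => n _; ring.
    ring.
  apply: cmodD_le.
    have qM : q0 ^+ M.+1 <= q0 ^+ m.
      by rewrite ler_wiXn2l ?(ltW q01) // leqW // leq_addl.
    rewrite mulrDl; apply: cmodD_le; rewrite ?cmodN.
      by apply: (le_trans (aS _ z1 _)); rewrite ler_wpM2l.
    by apply: (le_trans (aS _ w1 _)); rewrite ler_wpM2l.
  apply: cmodD_le; apply: (le_trans (cmod_sum _ _ _)).
    apply: (@le_trans _ _ (\sum_(0 <= n < N) (n.+1%:R ^+ 2 * cmod (b n)) * cmod (z - w) ^+ 2)).
      apply: ler_sum => n _; rewrite cmodM [_ * cmod (b n)]mulrC -[leRHS]mulrA.
      by apply: ler_wpM2l; [exact: cmod_ge0 | exact: expr_diff2].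
    rewrite -mulr_suml ler_wpM2r ?exprn_ge0 ?cmod_ge0 //.
    by have := @sumE 0%N N _ (fun n => lexx _); rewrite expr0 mulr1 add0n.
  apply: (@le_trans _ _ (\sum_(N <= n < M) (n.+1%:R * cmod (b n)) * cmod (z - w))).
    apply: ler_sum => n _; rewrite cmodM [n.+1%:R * _]mulrC -[leRHS]mulrA ler_wpM2l ?cmod_ge0 //.
    exact: expr_lip.
  by rewrite -mulr_suml ler_wpM2r ?cmod_ge0 //; exact: sumE.
(* the estimate at the limit [z -> w]; [t] is the size of an increment that is small enough *)
have stepB w N : cmod w < 1 -> cmod (h1 w - S N w) <= E * q ^+ N.
  move=> w1; apply/ler_addgt0Pl => e e0.
  have [|d d0 Hd] := dh w w1 (e / 2); first by rewrite divr_gt0.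
  pose t := Num.min (d / 2) (Num.min ((1 - cmod w) / 2) (e / 2 / (E + 1))).
  have t0 : 0 < t.
    by rewrite !lt_min !divr_gt0 ?subr_gt0 // ltr_wpDl.
  have td : t < d.
    by apply: (@le_lt_trans _ _ (d / 2)); [rewrite ge_min lexx | rewrite gtr_pMr ?invf_lt1 ?ltr1n].
  have tw : t <= (1 - cmod w) / 2 by rewrite !ge_min lexx !orbT.
  have tE : E * t <= e / 2.
    apply: (@le_trans _ _ ((E + 1) * t)); first by rewrite ler_wpM2r ?(ltW t0) // lerDl.
    by rewrite mulrC -ler_pdivlMr ?ltr_wpDl // !ge_min lexx !orbT.
  pose z := w + t%:C.
  have zw : z - w = t%:C by rewrite /z addrC addKr.
  have ct : cmod (z - w) = t by rewrite zw cmodR gtr0_norm.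
  have z1 : cmod z <= 1.
    apply: (le_trans (cmodD _ _)); rewrite cmodR gtr0_norm //.
    by move: tw w1; lra.
  have h_1 := Hd z; rewrite ct in h_1.
  have h_2 := stepA z w N z1 (ltW w1); rewrite ct in h_2.
  have : cmod (h1 w - S N w) * t <= (e + E * q ^+ N) * t.
    rewrite -{1}ct -cmodM.
    have -> : (h1 w - S N w) * (z - w) =
      (h z - h w - S N w * (z - w)) - (h z - h w - h1 w * (z - w)) by ring.
    apply: le_trans (cmodD _ _) _; rewrite cmodN.
    apply: (le_trans (lerD h_2 (h_1 td))).
    have -> : E * t ^+ 2 + E * q ^+ N * t + e / 2 * t =
      (E * t + E * q ^+ N + e / 2) * t by ring.
    by rewrite ler_wpM2r ?(ltW t0) //; move: tE; lra.
  by rewrite ler_pM2r.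
exists q, E; split => //; first by move=> z z1 N; exact: stepB.
move=> z w z1 w1.
rewrite -subr_le0; apply: (@geometric_le0 _ q (E + E) _ qI) => N; rewrite lerBlDr.
have -> : h1 z - h1 w = (h1 z - S N z) - (h1 w - S N w) + (S N z - S N w) by ring.
rewrite mulrDl; apply: cmodD_le; first apply: cmodD_le; rewrite ?cmodN.
- exact: stepB.
- exact: stepB.
rewrite /S -sumrB; apply: (le_trans (cmod_sum _ _ _)).
apply: (@le_trans _ _ (\sum_(0 <= n < N) (n.+1%:R ^+ 2 * cmod (b n)) * cmod (z - w))).
  apply: ler_sum => n _; rewrite -mulrBr !cmodM cmod_nat.
  rewrite expr2 -!mulrA ler_wpM2l // [leRHS]mulrCA ler_wpM2l ?cmod_ge0 //.
  apply: (le_trans (expr_lip _ (ltW z1) (ltW w1))).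
  by rewrite ler_wpM2r ?cmod_ge0 // ler_nat.
rewrite -mulr_suml ler_wpM2r ?cmod_ge0 //.
by have := @sumE 0%N N _ (fun n => lexx _); rewrite expr0 mulr1 add0n.
Qed.

(** * Growth of the derivative on circles *)

Lemma cderive_lip (R : realType) (f : R[i] -> R[i]) (rho : R) :
  holomorphic f -> 0 <= rho < 1 -> exists2 L : R, 0 <= L &
    (forall z w, cmod z <= rho -> cmod w <= rho ->
      cmod (cderive f z - cderive f w) <= L * cmod (z - w)) /\
    (forall z, cmod z <= rho -> cmod (cderive f z) <= L).
Proof.
move=> hf /andP[rho0 rho1].
pose r := (1 + rho) / 2.
have [r0 r1 rr] : [/\ 0 < r, r < 1 & rho < r] by rewrite /r; split; lra.
have rI : 0 <= r < 1 by rewrite ltW.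
have [a ha] := dilate_expands hf rI.
have [|q [D [qI D0 H1 H2]]] := expands_cderiv ha (h1 := fun z => r%:C * cderive f (r%:C * z)).
  by move=> z z1; apply: dilate_cderiv => //; exact: ltW.
have rC : r%:C != 0 :> R[i] by rewrite -cmod_gt0 cmodR normr_gt0 gt_eqF.
have zr z : cmod z <= rho -> cmod (z / r%:C) < 1.
  move=> zr; rewrite cmodM cmodV cmodR gtr0_norm // ltr_pdivrMr // mul1r.
  exact: le_lt_trans rr.
have E z : r%:C * (z / r%:C) = z by field.
exists (D / r ^+ 2); first by rewrite divr_ge0 // exprn_ge0 // ltW.
split=> [z w hz hw|z hz].
  have := H2 _ _ (zr z hz) (zr w hw).
  rewrite !E -mulrBr -mulrBl !cmodM cmodV !cmodR gtr0_norm // => h.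
  rewrite -(ler_pM2l r0); apply: (le_trans h).
  by rewrite le_eqVlt; apply/orP; left; apply/eqP; field; rewrite gt_eqF.
have := H1 _ (zr z hz) 0%N.
rewrite big_geq // subr0 expr0 mulr1 E cmodM cmodR gtr0_norm // => h.
rewrite ler_pdivlMr ?exprn_gt0 //; apply: le_trans h.
rewrite [leLHS](_ : _ = r * cmod (cderive f z) * r); last by ring.
by rewrite ler_piMr ?(ltW r1) // mulr_ge0 ?cmod_ge0 // ltW.
Qed.

(** Landau's proof of the maximum principle: Cauchy's formula loses a constant
   factor, which disappears when it is applied to high powers of [f]. *)
Lemma max_principle (R : realType) (f : R[i] -> R[i]) (r m : R) (z : R[i]) :
  holomorphic f -> 0 < r -> r < 1 ->
  (forall t, - pi <= t <= pi -> cmod (f (polar r t)) <= m) ->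
  cmod z < r -> cmod (f z) <= m.
Proof.
move=> hf r0 r1 fm zr; rewrite leNgt; apply/negP => mf.
have m0 : 0 <= m.
  apply: le_trans (fm 0 _); first exact: cmod_ge0.
  by rewrite oppr_le0 pi_ge0.
have f0 : 0 < cmod (f z) := le_lt_trans m0 mf.
have qI : 0 <= m / cmod (f z) < 1.
  by rewrite divr_ge0 ?cmod_ge0 //= ltr_pdivrMr // mul1r.
(* the powers of [m / |f z| < 1] would be bounded below by a positive constant *)
suff : (1 : R) <= 0 by rewrite ler10.
apply: (geometric_le0 (C := r / (r - cmod z)) qI) => k.
have [||a [_ /(_ z zr 0%N)]] := @taylor _ (fun w => f w ^+ k) r (m ^+ k) r0 r1.
- by apply/holomorphicP; exact: holomorphicX.
- by move=> t /fm h; rewrite cmodX; apply: lerXn2r; rewrite ?nnegrE ?cmod_ge0.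
rewrite big_ord0 subr0 expr0 mulr1 cmodX mulrC => h.
by rewrite exprMn exprVn mulrA ler_pdivlMr ?exprn_gt0 // mul1r.
Qed.

(** On smaller discs [f'] is a uniform limit of polynomials, and the maximum
   principle passes to the limit; [f'] itself need not be shown holomorphic. *)
Lemma max_principle_cderive (R : realType) (f : R[i] -> R[i]) (r m : R) z :
  holomorphic f -> 0 < r -> r < 1 ->
  (forall t, - pi <= t <= pi -> cmod (cderive f (polar r t)) <= m) ->
  cmod z < r -> cmod (cderive f z) <= m.
Proof.
move=> hf r0 r1 fm zr.
pose s := (1 + r) / 2.
have [s0 s1 rs] : [/\ 0 < s, s < 1 & r < s] by rewrite /s; split; lra.
have sI : 0 <= s < 1 by rewrite ltW.
have [a ha] := dilate_expands hf sI.
have [|q [D [qI D0 H1 _]]] := expands_cderiv ha (h1 := fun z => s%:C * cderive f (s%:C * z)).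
  by move=> w w1; apply: dilate_cderiv => //; exact: ltW.
have sC : s%:C != 0 :> R[i] by rewrite -cmod_gt0 cmodR normr_gt0 gt_eqF.
have E w : s%:C * (w / s%:C) = w by field.
have sm w : cmod (w / s%:C) = cmod w / s.
  by rewrite cmodM cmodV cmodR gtr0_norm.
rewrite -(ler_pM2l s0) -subr_le0.
apply: (geometric_le0 (C := D + D) qI) => N; rewrite lerBlDr.
pose P w := \sum_(k < N) (k.+1%:R * a k.+1) * w ^+ k.
have PE w : \sum_(0 <= k < N) k.+1%:R * a k.+1 * w ^+ k = P w by rewrite big_mkord.
have rs1 : r / s < 1 by rewrite ltr_pdivrMr // mul1r.
have cE w : cmod w / s < 1 -> cmod (s%:C * cderive f w - P (w / s%:C)) <= D * q ^+ N.
  by rewrite -sm => /H1 /(_ N); rewrite E PE.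
have Pm : cmod (P (z / s%:C)) <= s * m + D * q ^+ N.
  apply: (@max_principle _ P (r / s)).
  - exact: (@holomorphic_poly _ (fun k => k.+1%:R * a k.+1) N).
  - by rewrite divr_gt0.
  - exact: rs1.
  - move=> t tI.
    have -> : polar (r / s) t = polar r t / s%:C.
      by rewrite (polarE (r / s)) (polarE r) rmorphM fmorphV /=; ring.
    have -> : P (polar r t / s%:C) = s%:C * cderive f (polar r t) -
       (s%:C * cderive f (polar r t) - P (polar r t / s%:C)) by ring.
    apply: cmodD_le; last by rewrite cmodN; apply: cE; rewrite cmod_polar // ltW.
    by rewrite cmodM cmodR gtr0_norm // ler_pM2l //; exact: fm.
  - by rewrite sm ltr_pM2r ?invr_gt0.
have zs : cmod z / s < 1.
  by apply: lt_trans rs1; rewrite ltr_pM2r ?invr_gt0.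
have -> : s * cmod (cderive f z) = cmod (s%:C * cderive f z).
  by rewrite cmodM cmodR gtr0_norm.
rewrite -(subrK (P (z / s%:C)) (s%:C * cderive f z)).
apply: (le_trans (cmodD_le (cE z zs) Pm)).
by rewrite mulrDl; lra.
Qed.

Lemma preimage_oy (R : realType) (g : R -> R) (x u : R) : (g @^-1` `]x, +oo[) u <-> x < g u.
Proof. by rewrite /preimage /mkset /= in_itv /= andbT. Qed.

Lemma is_interval_nondecr (R : realType) (I : set R) (g : R -> R) x :
  is_interval I -> (forall r s, I r -> I s -> r <= s -> g r <= g s) ->
  is_interval (I `&` g @^-1` `]x, +oo[).
Proof.
move=> Ii Hg r s [Ir /preimage_oy xr] [Is /preimage_oy xs] t rts.
have It := Ii r s Ir Is t rts.
split => //; apply/preimage_oy; apply: (lt_le_trans xr).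
by apply: Hg => //; case/andP: rts.
Qed.

(** The preimages of half-lines under a monotone function are intervals. *)
Lemma nondecreasing_measurable_in (R : realType) (I : set R) (g : R -> R) :
  is_interval I -> (forall r s, I r -> I s -> r <= s -> g r <= g s) ->
  measurable_fun (I : set (measurableTypeR R)) g.
Proof.
move=> Ii Hg mD; apply: (measurability _ (measurable_realfun.RGenOInfty.measurableE R)).
move=> _ [_ [x ->] <-]; apply: measurable_realfun.is_interval_measurable.
  exact: is_interval_nondecr.
exact: mD.
Qed.

Definition circle_sup (R : realType) (f : R[i] -> R[i]) (r : R) : \bar R :=
  ereal_sup [set (cmod (cderive f (polar r t)))%:E | t in @angles R].

Lemma B0normE (R : realType) (f : R[i] -> R[i]) :
  B0norm f = (\int[lebesgue_measure]_(r in @radii R) circle_sup f r)%E.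
Proof. by []. Qed.

Lemma circle_sup_ub (R : realType) (f : R[i] -> R[i]) (r t : R) :
  - pi <= t <= pi -> ((cmod (cderive f (polar r t)))%:E <= circle_sup f r)%E.
Proof. by move=> tI; apply: ereal_sup_ubound; exists t; rewrite //= in_itv. Qed.

Lemma circle_sup_le (R : realType) (f : R[i] -> R[i]) (r m : R) :
  (forall t, - pi <= t <= pi -> cmod (cderive f (polar r t)) <= m) ->
  (circle_sup f r <= m%:E)%E.
Proof.
move=> H; apply: ge_ereal_sup => _ [t tI <-].
by rewrite lee_fin; apply: H; move: tI; rewrite /angles /= in_itv.
Qed.

Lemma circle_sup_ge0 (R : realType) (f : R[i] -> R[i]) (r : R) :
  (0 <= circle_sup f r)%E.
Proof.
apply: le_trans (circle_sup_ub f r (_ : - pi <= 0 <= pi)).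
  by rewrite lee_fin cmod_ge0.
by rewrite oppr_le0 pi_ge0.
Qed.

(** The supremum of [|f'|] over a circle is finite because [f'] is bounded on
   smaller closed discs; all estimates of the seminorm are comparisons of this
   function of the radius. *)
HB.lock Definition cmax (R : realType) (f : R[i] -> R[i]) (r : R) : R :=
  fine (circle_sup f r).

Lemma cmaxE (R : realType) (f : R[i] -> R[i]) (r : R) :
  holomorphic f -> 0 < r < 1 -> circle_sup f r = (cmax f r)%:E.
Proof.
move=> hf /andP[r0 r1]; rewrite cmax.unlock fineK //.
have rI : 0 <= r < 1 by rewrite ltW.
have [L _ [_ HL]] := cderive_lip hf rI.
rewrite ge0_fin_numE ?circle_sup_ge0 //.
apply: (@le_lt_trans _ _ L%:E); last exact: ltry.
by apply: circle_sup_le => t _; apply: HL; rewrite cmod_polar // ltW.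
Qed.

Lemma cmax_ub (R : realType) (f : R[i] -> R[i]) (r t : R) :
  holomorphic f -> 0 < r < 1 -> - pi <= t <= pi ->
  cmod (cderive f (polar r t)) <= cmax f r.
Proof.
by move=> hf rI tI; rewrite -lee_fin -cmaxE //; exact: circle_sup_ub.
Qed.

Lemma cmax_le (R : realType) (f : R[i] -> R[i]) (r m : R) :
  holomorphic f -> 0 < r < 1 ->
  (forall t, - pi <= t <= pi -> cmod (cderive f (polar r t)) <= m) ->
  cmax f r <= m.
Proof. by move=> hf rI H; rewrite -lee_fin -cmaxE //; exact: circle_sup_le. Qed.

Lemma cmax_ge0 (R : realType) (f : R[i] -> R[i]) (r : R) : 0 <= cmax f r.
Proof. by rewrite cmax.unlock fine_ge0 // circle_sup_ge0. Qed.

Lemma cmax_nondecreasing (R : realType) (f : R[i] -> R[i]) (r s : R) :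
  holomorphic f -> 0 < r -> r <= s -> s < 1 -> cmax f r <= cmax f s.
Proof.
move=> hf r0; rewrite le_eqVlt => /predU1P[-> //|rs s1].
have s0 : 0 < s := lt_trans r0 rs.
have sI : 0 < s < 1 by rewrite s0.
apply: cmax_le => //; first by rewrite r0 (lt_trans rs).
move=> t tI; apply: (max_principle_cderive hf s0 s1).
  by move=> u uI; exact: cmax_ub.
by rewrite cmod_polar // ltW.
Qed.

Lemma radiiP (R : realType) (r : R) : @radii R r <-> 0 < r < 1.
Proof. by rewrite /radii /= in_itv. Qed.

Lemma measurable_radii (R : realType) :
  measurable (@radii R : set (measurableTypeR R)).
Proof. exact: measurable_itv. Qed.

Lemma measurable_cmax (R : realType) (f : R[i] -> R[i]) :
  holomorphic f ->
  measurable_fun (@radii R : set (measurableTypeR R)) (cmax f).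
Proof.
move=> hf; apply: nondecreasing_measurable_in.
  exact: interval_is_interval.
move=> r s /radiiP/andP[r0 _] /radiiP/andP[_ s1] rs.
exact: cmax_nondecreasing.
Qed.

(** * The seminorm of the Besov algebra *)

Local Open Scope ereal_scope.

Lemma lebesgue_radii (R : realType) : lebesgue_measure (@radii R) = 1%E.
Proof.
have := @lebesgue_measure_itv R `]0%R, 1%R[.
by rewrite /= lte_fin ltr01 sube0.
Qed.

Lemma B0norm_cmax (R : realType) (f : R[i] -> R[i]) : holomorphic f ->
  B0norm f = \int[lebesgue_measure]_(r in @radii R) (cmax f r)%:E.
Proof.
move=> hf; rewrite B0normE; apply: eq_integral => r.
by rewrite inE => /radiiP rI; rewrite cmaxE.
Qed.

Lemma B0norm_ge0 (R : realType) (f : R[i] -> R[i]) : 0 <= B0norm f.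
Proof. by apply: integral_ge0 => r _; exact: circle_sup_ge0. Qed.

Lemma measurable_cmaxE (R : realType) (f : R[i] -> R[i]) :
  holomorphic f ->
  measurable_fun (@radii R : set (measurableTypeR R)) (EFin \o cmax f).
Proof. by move=> hf; apply/measurable_EFinP; exact: measurable_cmax. Qed.

Lemma cmax_integrable (R : realType) (f : R[i] -> R[i]) :
  holomorphic f -> B0norm f < +oo ->
  lebesgue_measure.-integrable (@radii R) (EFin \o cmax f).
Proof.
move=> hf fB; apply/integrableP; split; first exact: measurable_cmaxE.
rewrite B0norm_cmax // in fB; apply: le_lt_trans fB.
rewrite le_eqVlt; apply/orP; left; apply/eqP; apply: eq_integral => r _ /=.
by rewrite ger0_norm // cmax_ge0.
Qed.

Lemma B0norm_le2 (R : realType) (f g h : R[i] -> R[i]) (A B : R) :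
  holomorphic f -> holomorphic g -> holomorphic h -> (0 <= A)%R -> (0 <= B)%R ->
  (forall r : R, (0 < r < 1)%R -> (cmax h r <= A * cmax f r + B * cmax g r)%R) ->
  B0norm h <= A%:E * B0norm f + B%:E * B0norm g.
Proof.
move=> hf hg hh A0 B0 H; rewrite !B0norm_cmax //.
have c0 u (r : R) : 0 <= (cmax u r)%:E by rewrite lee_fin cmax_ge0.
have mE u C : holomorphic u -> measurable_fun (@radii R : set (measurableTypeR R))
    (fun r => C%:E * (EFin \o cmax u) r).
  by move=> hu; apply: measurable_funeM; exact: measurable_cmaxE.
rewrite -!ge0_integralZl_EFin //;
  try exact: measurable_radii; try exact: measurable_cmaxE.
rewrite -ge0_integralD //;
  try exact: measurable_radii; try exact: mE;
  try (by move=> r _; rewrite mule_ge0).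
apply: ge0_le_integral => //.
- exact: measurable_radii.
- exact: measurable_cmaxE.
- by apply: emeasurable_funD; exact: mE.
Qed.

Lemma B0norm_bound (R : realType) (h : R[i] -> R[i]) (D : R) :
  holomorphic h -> (0 <= D)%R ->
  (forall z, (cmod z < 1)%R -> (cmod (cderive h z) <= D)%R) -> B0norm h <= D%:E.
Proof.
move=> hh D0 H; rewrite B0norm_cmax //.
apply: (@le_trans _ _ (\int[lebesgue_measure]_(r in @radii R) D%:E)).
  apply: ge0_le_integral => //.
  - exact: measurable_radii.
  - by move=> r _; rewrite lee_fin cmax_ge0.
  - exact: measurable_cmaxE.
  - move=> r /radiiP rI; rewrite lee_fin; apply: cmax_le => // t _; apply: H.
    by case/andP: rI => r0 r1; rewrite cmod_polar // ltW.
rewrite integral_cst; last exact: measurable_radii.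
by rewrite [X in _ * X](_ : _ = 1) ?mule1 //; exact: lebesgue_radii.
Qed.

Local Close Scope ereal_scope.

Lemma cderiveE (R : realType) (f : R[i] -> R[i]) z l :
  has_cderiv f z l -> cderive f z = l.
Proof. by move=> /has_cderivP[]. Qed.

Lemma disc_polar (R : realType) (r t : R) : 0 < r < 1 -> disc (polar r t).
Proof. by move=> /andP[r0 r1]; rewrite /disc /= cmod_polar // ltW. Qed.

Lemma cderiveD (R : realType) (f g : R[i] -> R[i]) z :
  holomorphic f -> holomorphic g -> disc z ->
  cderive (fun z => f z + g z) z = cderive f z + cderive g z.
Proof.
by move=> hf hg zd; apply: cderiveE; apply: has_cderivD; exact: holomorphic_cderiv.
Qed.

Lemma cderiveM (R : realType) (f g : R[i] -> R[i]) z :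
  holomorphic f -> holomorphic g -> disc z ->
  cderive (fun z => f z * g z) z = cderive f z * g z + f z * cderive g z.
Proof.
by move=> hf hg zd; apply: cderiveE; apply: has_cderivM; exact: holomorphic_cderiv.
Qed.

Lemma cderiveZ (R : realType) (f : R[i] -> R[i]) a z :
  holomorphic f -> disc z -> cderive (fun z => a * f z) z = a * cderive f z.
Proof.
move=> hf zd; rewrite (cderiveM (@holomorphic_cst _ a) hf zd).
by rewrite (cderiveE (has_cderiv_cst a z)) mul0r add0r.
Qed.

Lemma cderive_dilate (R : realType) (f : R[i] -> R[i]) (rho : R) z :
  holomorphic f -> 0 <= rho < 1 -> disc z ->
  cderive (dilate rho f) z = rho%:C * cderive f (rho%:C * z).
Proof.
by move=> hf rI zd; apply: cderiveE; apply: dilate_cderiv => //; exact: ltW.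
Qed.

Lemma eq_cderive_disc (R : realType) (f g : R[i] -> R[i]) z :
  holomorphic f -> (forall w, disc w -> f w = g w) -> disc z ->
  cderive f z = cderive g z.
Proof.
move=> hf fg zd; apply/esym/cderiveE.
by apply: has_cderiv_disc fg _ => //; exact: holomorphic_cderiv.
Qed.

(** The functions with finite seminorm. The supremum norm is left out: it does not
   enter the duality estimate. *)
Definition B0space (R : realType) (f : R[i] -> R[i]) :=
  holomorphic f /\ (B0norm f < +oo)%E.

HB.lock Definition b0 (R : realType) (f : R[i] -> R[i]) : R := fine (B0norm f).

Lemma b0E (R : realType) (f : R[i] -> R[i]) : B0space f -> B0norm f = (b0 f)%:E.
Proof. by move=> [_ fB]; rewrite b0.unlock fineK // ge0_fin_numE // B0norm_ge0. Qed.

Lemma b0_ge0 (R : realType) (f : R[i] -> R[i]) : 0 <= b0 f.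
Proof. by rewrite b0.unlock fine_ge0 // B0norm_ge0. Qed.

Lemma B0space_Bspace (R : realType) (f : R[i] -> R[i]) : Bspace f -> B0space f.
Proof. by case. Qed.

Lemma B0space_le2 (R : realType) (f g h : R[i] -> R[i]) (A B : R) :
  B0space f -> B0space g -> holomorphic h -> 0 <= A -> 0 <= B ->
  (forall r : R, 0 < r < 1 -> cmax h r <= A * cmax f r + B * cmax g r) ->
  B0space h /\ b0 h <= A * b0 f + B * b0 g.
Proof.
move=> fB gB hh A0 B0 H; have := B0norm_le2 fB.1 gB.1 hh A0 B0 H.
rewrite (b0E fB) (b0E gB) -!EFinM -EFinD => hb.
have hB : B0space h by split => //; apply: le_lt_trans hb (ltry _).
by split => //; rewrite -lee_fin -b0E.
Qed.

Lemma B0space_bound (R : realType) (h : R[i] -> R[i]) (D : R) :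
  holomorphic h -> 0 <= D ->
  (forall z, cmod z < 1 -> cmod (cderive h z) <= D) -> B0space h /\ b0 h <= D.
Proof.
move=> hh D0 H; have hb := B0norm_bound hh D0 H.
have hB : B0space h by split => //; apply: le_lt_trans hb (ltry _).
by split => //; rewrite -lee_fin -b0E.
Qed.

Lemma B0spaceD (R : realType) (f g : R[i] -> R[i]) :
  B0space f -> B0space g ->
  B0space (fun z => f z + g z) /\ b0 (fun z => f z + g z) <= b0 f + b0 g.
Proof.
move=> fB gB; have hD := holomorphicD fB.1 gB.1.
suff H r : 0 < r < 1 ->
    cmax (fun z => f z + g z) r <= 1 * cmax f r + 1 * cmax g r.
  have [hB hb] := B0space_le2 fB gB hD (@ler01 R) (@ler01 R) H.
  rewrite (mul1r (b0 f)) (mul1r (b0 g)) in hb.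
  exact: (conj hB hb).
move=> rI; rewrite !mul1r; apply: cmax_le => // t tI.
rewrite (cderiveD fB.1 gB.1 (disc_polar t rI)).
by apply: cmodD_le; [apply: cmax_ub fB.1 rI tI|apply: cmax_ub gB.1 rI tI].
Qed.

Lemma B0spaceZ (R : realType) (f : R[i] -> R[i]) (a : R[i]) :
  B0space f ->
  B0space (fun z => a * f z) /\ b0 (fun z => a * f z) <= cmod a * b0 f.
Proof.
move=> fB; have hM := holomorphicM (@holomorphic_cst _ a) fB.1.
suff H r : 0 < r < 1 ->
    cmax (fun z => a * f z) r <= cmod a * cmax f r + 0 * cmax f r.
  have [hB hb] := B0space_le2 fB fB hM (cmod_ge0 a) (@lexx _ R 0) H.
  rewrite (mul0r (b0 f)) (addr0 (cmod a * b0 f)) in hb.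
  exact: (conj hB hb).
move=> rI; rewrite mul0r addr0; apply: cmax_le => // t tI.
rewrite (cderiveZ a fB.1 (disc_polar t rI)) cmodM.
by apply: ler_wpM2l; [exact: cmod_ge0 | exact: cmax_ub fB.1 rI tI].
Qed.

Lemma B0spaceB (R : realType) (f g : R[i] -> R[i]) :
  B0space f -> B0space g ->
  B0space (fun z => f z - g z) /\ b0 (fun z => f z - g z) <= b0 f + b0 g.
Proof.
move=> fB gB; have [nB nb] := B0spaceZ (-1) gB.
rewrite cmodN cmod1 mul1r in nb.
have E : (fun z => f z - g z) = (fun z => f z + -1 * g z).
  by apply/funext => z; rewrite mulN1r.
rewrite E; have [sB sb] := B0spaceD fB nB; split => //.
by apply: (le_trans sb); rewrite lerD2l.
Qed.

Lemma cmax_dilate (R : realType) (f : R[i] -> R[i]) (r s : R) :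
  holomorphic f -> 0 < s < 1 -> 0 < r < 1 -> cmax (dilate s f) r <= cmax f r.
Proof.
move=> hf sI rI; have [s0 s1] := andP sI; have [r0 r1] := andP rI.
have sI' : 0 <= s < 1 by rewrite ltW.
apply: (cmax_le (dilate_holomorphic hf sI') rI) => t tI.
rewrite (cderive_dilate hf sI' (disc_polar t rI)) cmodM cmodR gtr0_norm //.
have -> : s%:C * polar r t = polar (s * r) t.
  by rewrite (polarE r) (polarE (s * r)) rmorphM mulrA.
have rrr : s * r <= r by rewrite ler_piMl ?ltW.
have rr0 : 0 < s * r by rewrite mulr_gt0.
apply: (@le_trans _ _ (1 * cmax f (s * r))); last first.
  by rewrite mul1r; exact: (cmax_nondecreasing hf rr0 rrr r1).
apply: ler_pM; rewrite ?cmod_ge0 ?(ltW s0) ?(ltW s1) //.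
have rrI1 : 0 < s * r < 1 by rewrite rr0 (le_lt_trans rrr).
exact: cmax_ub hf rrI1 tI.
Qed.

Lemma B0space_dilate (R : realType) (f : R[i] -> R[i]) (rho : R) :
  B0space f -> 0 < rho < 1 -> B0space (dilate rho f) /\ b0 (dilate rho f) <= b0 f.
Proof.
move=> fB rI; have [rho0 rho1] := andP rI.
have rI' : 0 <= rho < 1 by rewrite ltW.
have hd := dilate_holomorphic fB.1 rI'.
suff H r : 0 < r < 1 -> cmax (dilate rho f) r <= 1 * cmax f r + 0 * cmax f r.
  have [hB hb] := B0space_le2 fB fB hd (@ler01 R) (@lexx _ R 0) H.
  rewrite (mul1r (b0 f)) (mul0r (b0 f)) (addr0 (b0 f)) in hb.
  exact: (conj hB hb).
by move=> rI2; rewrite mul1r mul0r addr0; exact: cmax_dilate fB.1 rI rI2.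
Qed.

(** * Dilations approximate in the seminorm *)

Lemma has_cderivB (R : realType) (f g : R[i] -> R[i]) (z k l : R[i]) :
  has_cderiv f z k -> has_cderiv g z l ->
  has_cderiv (fun w => f w - g w) z (k - l).
Proof.
move=> Hf Hg.
have H := has_cderivD Hf (has_cderivM (has_cderiv_cst (-1) z) Hg).
rewrite (_ : k - l = k + (0 * g z + -1 * l)); last by ring.
by apply: has_cderiv_near ltr01 _ H => w _; rewrite mulN1r.
Qed.

Lemma holomorphicB (R : realType) (f g : R[i] -> R[i]) :
  holomorphic f -> holomorphic g -> holomorphic (fun z => f z - g z).
Proof.
move=> hf hg; apply: holomorphic_ex => z zd.
by eexists; apply: has_cderivB; exact: holomorphic_cderiv.
Qed.

Lemma cderiveB (R : realType) (f g : R[i] -> R[i]) z :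
  holomorphic f -> holomorphic g -> disc z ->
  cderive (fun z => f z - g z) z = cderive f z - cderive g z.
Proof.
by move=> hf hg zd; apply: cderiveE; apply: has_cderivB; exact: holomorphic_cderiv.
Qed.

Definition rho (R : realType) n : R := 1 - n.+2%:R^-1.

Lemma rho_itv (R : realType) n : 0 < rho R n < 1.
Proof.
rewrite /rho subr_gt0 invf_lt1 ?ltr0n // ltr1n /=.
by rewrite gtrBl invr_gt0 ltr0n.
Qed.

Lemma rho_itvW (R : realType) n : 0 <= rho R n < 1.
Proof. by have /andP[h ->] := rho_itv R n; rewrite ltW. Qed.

Lemma inv_nat_cvg0 (R : realType) (C : R) : (C / n.+2%:R) @[n --> \oo] --> 0.
Proof.
have h : (n.+2%:R^-1 : R) @[n --> \oo] --> 0.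
  have := @cvg_harmonic R; rewrite -(cvg_shiftn 1).
  by under eq_cvg do rewrite /harmonic /= addn1.
by rewrite -[X in _ --> X](mulr0 C); apply: cvgM => //; exact: cvg_cst.
Qed.

(** [f'(z) - p f'(p z) = (1 - p) f'(z) + p (f'(z) - f'(p z))], and [f'] is bounded
   and Lipschitz on the disc of radius [r]. *)
Lemma dilate_diff_bound (R : realType) (f : R[i] -> R[i]) (r : R) :
  holomorphic f -> 0 < r < 1 -> exists L : R, forall n,
  cmax (fun z => f z - dilate (rho R n) f z) r <= L / n.+2%:R.
Proof.
move=> hf rI; have [r0 r1] := andP rI.
have rI' : 0 <= r < 1 by rewrite ltW.
have [L L0 [HL HB]] := cderive_lip hf rI'.
exists (L + L) => n; have [p0 p1] := andP (rho_itv R n).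
have hd := dilate_holomorphic hf (rho_itvW R n).
have hD := holomorphicB hf hd.
apply: cmax_le => // t tI.
have zd := disc_polar t rI.
rewrite (cderiveB hf hd zd) (cderive_dilate hf (rho_itvW R n) zd).
have pE : 1 - rho R n = n.+2%:R^-1 by rewrite /rho opprB addrC subrK.
set z := polar r t; move: (rho R n) p0 p1 pE {hd hD} => p p0 p1 pE.
have cz : cmod z = r by rewrite cmod_polar // ltW.
have cpz : cmod (p%:C * z) <= r.
  by rewrite cmodM cmodR gtr0_norm // cz ler_piMl // ltW.
have split_p (u w : R[i]) : u - p%:C * w = (1 - p)%:C * u + p%:C * (u - w).
  by rewrite rmorphB rmorph1 /=; ring.
rewrite split_p.
have q0 : 0 <= n.+2%:R^-1 :> R by rewrite invr_ge0.
rewrite pE mulrDl; apply: cmodD_le; rewrite cmodM cmodR.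
  by rewrite ger0_norm // mulrC ler_wpM2r // HB // cz.
rewrite gtr0_norm //; apply: (@le_trans _ _ (1 * (L * cmod (z - p%:C * z)))).
  apply: ler_pM; rewrite ?cmod_ge0 ?(ltW p0) ?(ltW p1) //.
  by apply: HL; rewrite ?cz.
rewrite mul1r ler_wpM2l //.
have -> : z - p%:C * z = (1 - p)%:C * z by rewrite rmorphB rmorph1 /=; ring.
by rewrite cmodM cmodR pE ger0_norm // ler_piMr // cz ltW.
Qed.

Lemma cmaxB (R : realType) (f g : R[i] -> R[i]) (r : R) :
  holomorphic f -> holomorphic g -> 0 < r < 1 ->
  cmax (fun z => f z - g z) r <= cmax f r + cmax g r.
Proof.
move=> hf hg rI; apply: (cmax_le (holomorphicB hf hg) rI) => t tI.
rewrite (cderiveB hf hg (disc_polar t rI)).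
by apply: cmodD_le; rewrite ?cmodN; [apply: cmax_ub hf rI tI|apply: cmax_ub hg rI tI].
Qed.

(** Dominated convergence for the circle suprema. The majorant is [2 * cmax f],
   because a dilation decreases [cmax] by the maximum principle. *)
Lemma b0_dilate_cvg (R : realType) (f : R[i] -> R[i]) : B0space f ->
  b0 (fun z => f z - dilate (rho R n) f z) @[n --> \oo] --> 0.
Proof.
move=> fB; have hf := fB.1.
pose d n z := f z - dilate (rho R n) f z.
have dB n : B0space (d n).
  by have [gB _] := B0space_dilate fB (rho_itv R n); have [] := B0spaceB fB gB.
have dle n (r : R) : 0 < r < 1 -> cmax (d n) r <= 2 * cmax f r.
  move=> rI; rewrite mulr_natl mulr2n.
  apply: (le_trans (cmaxB hf (dilate_holomorphic hf (rho_itvW R n)) rI)).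
  by apply: lerD => //; exact: cmax_dilate hf (rho_itv R n) rI.
have g0 n : B0norm (d n) = (b0 (d n))%:E := b0E (dB n).
have [||| _ _ H] := @dominated_convergence _ _ _ (@lebesgue_measure R) (@radii R)
  (@measurable_radii R) (fun n => EFin \o cmax (d n)) (fun=> 0%E)
  (fun r => (2%:E * (EFin \o cmax f) r)%E)
  (fun n => measurable_cmaxE (dB n).1) (measurable_cst _).
- apply: aeW => r /radiiP rI; apply/fine_cvgP; split; first exact: nearW.
  have [L HL] := dilate_diff_bound hf rI.
  apply: (@squeeze_cvgr _ _ _ _ (fun=> 0) (fun n => L / n.+2%:R)).
  - by apply: nearW => n /=; rewrite cmax_ge0; exact: HL.
  - exact: cvg_cst.
  - exact: inv_nat_cvg0.
- apply: integrableZl; first exact: measurable_radii.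
  exact: cmax_integrable fB.1 fB.2.
- apply: aeW => r n /radiiP rI.
  by rewrite /= ger0_norm ?cmax_ge0 // -EFinM lee_fin; exact: dle.
have E n : (b0 (d n))%:E =
    (\int[lebesgue_measure]_(r in @radii R) (EFin \o cmax (d n)) r)%E.
  by rewrite -(g0 n) (B0norm_cmax (dB n).1).
rewrite integral0 in H.
have H' : (fun n => (b0 (d n))%:E) @ \oo --> 0%:E.
  by apply: cvg_trans H; apply: near_eq_cvg; apply: nearW => n; rewrite [RHS]E.
by have /fine_cvgP[_] := H'.
Qed.

(** * Bounded operators *)

Lemma opnorm_ub (R : realType) (V W : normedModType R[i]) (S : V -> W) x :
  nrm x <= 1 -> ((nrm (S x))%:E <= opnorm S)%E.
Proof. by move=> x1; apply: ereal_sup_ubound; exists x. Qed.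

Lemma opnorm_ge0 (R : realType) (V W : normedModType R[i]) (S : V -> W) :
  (0 <= opnorm S)%E.
Proof.
apply: (@le_trans _ _ (nrm (S 0))%:E); first by rewrite lee_fin nrm_ge0.
by apply: opnorm_ub; rewrite nrm0.
Qed.

Lemma opnorm_le (R : realType) (V W : normedModType R[i]) (S : V -> W) (K : R) :
  0 <= K -> (forall x, nrm (S x) <= K * nrm x) -> (opnorm S <= K%:E)%E.
Proof.
move=> K0 SK; apply: ge_ereal_sup => _ [x /= x1 <-]; rewrite lee_fin.
by apply: (le_trans (SK x)); rewrite -[leRHS]mulr1 ler_wpM2l.
Qed.

Lemma nrm_normalize (R : realType) (V : normedModType R[i]) (x : V) (c : R) :
  0 < nrm x -> 0 <= c -> nrm ((c / nrm x)%:C *: x) = c.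
Proof.
move=> x0 c0; rewrite nrmZ cmodR ger0_norm ?divfK ?gt_eqF //.
by rewrite divr_ge0 // ltW.
Qed.

Lemma opnorm_bound (R : realType) (V W : normedModType R[i]) (S : {linear V -> W})
    (K : R) : (opnorm S <= K%:E)%E -> forall x, nrm (S x) <= K * nrm x.
Proof.
move=> SK x; have [x0|x0] := eqVneq (nrm x) 0.
  by rewrite (nrm_eq0 x0) linear0 !nrm0 mulr0.
have xp : 0 < nrm x by rewrite lt_neqAle eq_sym x0 nrm_ge0.
have := le_trans (opnorm_ub S (x := (1 / nrm x)%:C *: x) _) SK.
rewrite nrm_normalize // lexx => /(_ isT).
rewrite lee_fin linearZ /= nrmZ cmodR ger0_norm ?divr_ge0 ?nrm_ge0 //.
by rewrite mul1r ler_pdivrMl // mulrC.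
Qed.

Lemma bounded_opP (R : realType) (V W : normedModType R[i]) (S : {linear V -> W}) :
  bounded_op V W S <-> exists2 K : R, 0 <= K & forall x, nrm (S x) <= K * nrm x.
Proof.
split=> [SB|[K K0 SK]]; last exact: le_lt_trans (opnorm_le K0 SK) (ltry _).
exists (fine (opnorm S)); first by rewrite fine_ge0 // opnorm_ge0.
by apply: opnorm_bound; rewrite fineK // ge0_fin_numE // opnorm_ge0.
Qed.

Lemma exists_linear (R : realType) (V W : lmodType R[i]) (f : V -> W) :
  linear f -> exists S : {linear V -> W}, S =1 f.
Proof.
move=> lf.
pose m := GRing.isLinear.Build R[i] V W *:%R f lf.
pose S : {linear V -> W} := HB.pack f m.
by exists S.
Qed.

(** * Norming functionals (Hahn-Banach) *)

Section HahnBanach.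
Variables (R : realType) (X : normedModType R[i]) (x0 : X).

(** Graphs of partially defined real-linear functionals dominated by the norm
   that extend the norm on the line of [x0]. *)
Definition partial_functional (G : set (X * R)) := [/\
  forall x a y b (s : R), G (x, a) -> G (y, b) -> G (s%:C *: x + y, s * a + b),
  forall x a, G (x, a) -> a <= nrm x & G (x0, nrm x0)].

Lemma partial_functional0 : exists G, partial_functional G.
Proof.
exists [set p | exists c : R, p = (c%:C *: x0, c * nrm x0)]; split.
- move=> x a y b s [c [-> ->]] [d [-> ->]]; exists (s * c + d).
  by rewrite rmorphD rmorphM /= scalerDl scalerA mulrDl mulrA.
- move=> x a [c [-> ->]]; rewrite nrmZ cmodR.
  by rewrite ler_wpM2r ?nrm_ge0 // ler_norm.
- by exists 1; rewrite scale1r mul1r.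
Qed.

Lemma partial_functional_sub G x a y b : partial_functional G ->
  G (x, a) -> G (y, b) -> G (y - x, b - a).
Proof.
by move=> [GL _ _] xa yb; have := GL _ _ _ _ (-1) xa yb;
  rewrite rmorphN1 scaleN1r mulN1r ![- _ + _]addrC.
Qed.

Lemma partial_functional_val G x a b : partial_functional G ->
  G (x, a) -> G (x, b) -> a = b.
Proof.
move=> GP xa xb; have [_ GN _] := GP; apply/eqP; rewrite eq_le.
apply/andP; split; rewrite -subr_le0.
  by have := GN _ _ (partial_functional_sub GP xb xa); rewrite subrr nrm0.
by have := GN _ _ (partial_functional_sub GP xa xb); rewrite subrr nrm0.
Qed.

Lemma partial_functional00 G : partial_functional G -> G (0, 0).
Proof.
move=> GP; have [_ _ G1] := GP.
by have := partial_functional_sub GP G1 G1; rewrite !subrr.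
Qed.

Lemma partial_functionalZ G x a (s : R) : partial_functional G ->
  G (x, a) -> G (s%:C *: x, s * a).
Proof.
move=> GP xa; have [GL _ _] := GP.
by have := GL _ _ _ _ s xa (partial_functional00 GP); rewrite !addr0.
Qed.

(** One-dimensional extension: the admissible values at [v] form a nonempty
   interval. *)
Lemma partial_functional_extend G v : partial_functional G ->
  exists G', [/\ partial_functional G', G `<=` G' & exists a, G' (v, a)].
Proof.
move=> GP; have [GL GN Gx0] := GP.
pose L' : set R := [set l | exists x a, G (x, a) /\ l = a - nrm (x - v)].
have Lub y b : G (y, b) -> ubound L' (nrm (y + v) - b).
  move=> yb _ [x [a [xa ->]]]; rewrite lerBrDr addrAC lerBlDr.
  have := GL _ _ _ _ 1 xa yb; rewrite rmorph1 scale1r mul1r => /GN /le_trans; apply.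
  have -> : x + y = (y + v) + (x - v) by rewrite addrACA subrr addr0 addrC.
  exact: nrmD.
have L0 : L' !=set0 by exists (nrm x0 - nrm (x0 - v)), x0, (nrm x0).
pose al := sup L'.
have al1 x a : G (x, a) -> a - al <= nrm (x - v).
  move=> xa; rewrite lerBlDr -lerBlDl; apply: ub_le_sup; last by exists x, a.
  by exists (nrm (x0 + v) - nrm x0); exact: Lub.
have al2 x a : G (x, a) -> a + al <= nrm (x + v).
  by move=> xa; rewrite -lerBrDl; apply: ge_sup => //; exact: Lub.
exists [set p | exists x a (s : R), G (x, a) /\ p = (x + s%:C *: v, a + s * al)].
split; first split.
- move=> x1 a1 y1 b1 s [x [a [t [xa [-> ->]]]]] [y [b [u [yb [-> ->]]]]].
  exists (s%:C *: x + y), (s * a + b), (s * t + u); split; first exact: GL.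
  rewrite rmorphD rmorphM /= scalerDr scalerA scalerDl mulrDr mulrDl mulrA.
  by rewrite addrACA [X in _ = (_, X)]addrACA.
- move=> _ _ [x [a [s [xa [-> ->]]]]].
  have [s0|s0|->] := ltgtP s 0; last by rewrite scale0r mul0r !addr0 GN.
  + have sn : 0 < - s by rewrite oppr_gt0.
    have := al1 _ _ (partial_functionalZ (- s)^-1 GP xa).
    rewrite -(ler_pM2l sn) mulrBr mulrA divff ?gt_eqF // mul1r mulNr opprK.
    move=> /le_trans; apply.
    rewrite -[X in X * _](gtr0_norm sn) -cmodR -nrmZ scalerBr scalerA.
    rewrite -rmorphM /= divff ?gt_eqF // scale1r.
    by rewrite rmorphN scaleNr opprK.
  + have := al2 _ _ (partial_functionalZ s^-1 GP xa).
    rewrite -(ler_pM2l s0) mulrDr mulrA divff ?gt_eqF // mul1r.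
    move=> /le_trans; apply.
    rewrite -[X in X * _](gtr0_norm s0) -cmodR -nrmZ scalerDr scalerA.
    by rewrite -rmorphM /= divff ?gt_eqF // scale1r.
- by exists x0, (nrm x0), 0; rewrite scale0r mul0r !addr0.
- by move=> [x a] xa; exists x, a, 0; rewrite scale0r mul0r !addr0.
- exists al; exists 0, 0, 1; split; first exact: partial_functional00.
  by rewrite scale1r mul1r !add0r.
Qed.

Lemma real_functional : exists u : X -> R, [/\
  forall x y (s : R), u (s%:C *: x + y) = s * u x + u y,
  forall x, u x <= nrm x & u x0 = nrm x0].
Proof.
have [G [Gcase Gmax]] : exists G, (G = set0 \/ partial_functional G) /\
    forall G', G `<` G' -> ~ (G' = set0 \/ partial_functional G').
  apply: (@Zorn_bigcup _ [set G | G = set0 \/ partial_functional G]) => F FP Ftot.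
  have [[s0 [Fs0 s0P]]|A0] := pselect (exists s, F s /\ partial_functional s); last first.
    left; apply/seteqP; split => // p [s Fs sp].
    have [s_0|sP] := FP s Fs; first by move: sp; rewrite s_0.
    by exfalso; apply: A0; exists s.
  right.
  have FPne s p : F s -> s p -> partial_functional s.
    by move=> /FP[s_0|//]; rewrite s_0.
  split.
  - move=> x a y b c [s Fs xa] [t Ft yb].
    have [st|ts] := Ftot s t Fs Ft.
      by exists t => //; have [GL _ _] := FPne _ _ Ft yb; apply: GL => //; exact: st.
    by exists s => //; have [GL _ _] := FPne _ _ Fs xa; apply: GL => //; exact: ts.
  - by move=> x a [s Fs xa]; have [_ GN _] := FPne _ _ Fs xa; exact: GN xa.
  - by exists s0 => //; have [_ _] := s0P.
have GP : partial_functional G.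
  case: Gcase => // G0; have [G1 G1P] := partial_functional0.
  exfalso; apply: (Gmax G1); last by right.
  rewrite G0; split=> // H; have [_ _ G1x] := G1P.
  exact: H _ G1x.
have [GL GN Gx0] := GP.
have tot v : exists a, G (v, a).
  have [G' [G'P sub [a va]]] := partial_functional_extend v GP.
  have [E|nE] := pselect (G' `<=` G); first by exists a; exact: E.
  by exfalso; apply: (Gmax G'); [split | right].
have [u uP] := choice tot.
exists u; split.
- move=> x y s; apply: (partial_functional_val GP (uP _)); exact: GL.
- by move=> x; exact: GN.
- exact: (partial_functional_val GP (uP _)).
Qed.

(** The complex functional [x |-> u x - i u (i x)] has real part [u]; a unimodular
   factor shows that it is dominated by the norm as well. *)
Lemma norming_functional : exists f : {linear X -> R[i]^o}, [/\ dual X f,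
  forall x, cmod (f x) <= nrm x & nrm x0 <= cmod (f x0)].
Proof.
have [u [uL uN ux0]] := real_functional.
have u0 : u 0 = 0.
  have := uL 0 0 1; rewrite scaler0 addr0 mul1r => /eqP.
  by rewrite addrC -subr_eq subrr => /eqP <-.
have uD x y : u (x + y) = u x + u y by rewrite -[x in LHS]scale1r uL mul1r.
have uZ (s : R) x : u (s%:C *: x) = s * u x by rewrite -[_ *: _]addr0 uL u0 addr0.
pose f x : R[i]^o := u x +i* - u ('i *: x).
have fZ (c : R[i]) x : f (c *: x) = c * f x.
  have cE : c = (complex.Re c)%:C + (complex.Im c)%:C * 'i.
    by case: c => a b; apply/eqP; rewrite eq_complex /=; apply/andP; split; apply/eqP; ring.
  set a := complex.Re c in cE *; set b := complex.Im c in cE *.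
  have e1 : u (c *: x) = a * u x + b * u ('i *: x).
    by rewrite cE scalerDl -scalerA uD !uZ.
  have e2 : u ('i *: (c *: x)) = a * u ('i *: x) - b * u x.
    have -> : 'i *: (c *: x) = a%:C *: ('i *: x) + (- b)%:C *: x.
      rewrite !scalerA -scalerDl; congr (_ *: _); rewrite cE mulrDr [_ * a%:C]mulrC.
      by rewrite mulrCA -expr2 sqr_i rmorphN mulrN1.
    by rewrite uD !uZ mulNr.
  apply: complexP; rewrite ?cReM ?cImM /f e1 e2 -/a -/b /=; ring.
have fL : linear f.
  move=> c x y; rewrite -[c *: f x]/(c * f x) -fZ.
  rewrite /f scalerDr !uD; apply/eqP; rewrite eq_complex /=.
  by rewrite opprD !eqxx.
have fN x : cmod (f x) <= nrm x.
  have [->|fx0] := eqVneq (f x) 0; first by rewrite cmod0 nrm_ge0.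
  have cf : 0 < cmod (f x) by rewrite cmod_gt0.
  pose c := (cmod (f x))%:C / f x.
  have cfx : f (c *: x) = (cmod (f x))%:C by rewrite fZ /c divfK.
  have c1 : cmod c = 1.
    by rewrite cmodM cmodV cmodR ger0_norm ?cmod_ge0 // divff // gt_eqF.
  have -> : cmod (f x) = u (c *: x) by have := congr1 (@complex.Re R) cfx.
  by apply: (le_trans (uN _)); rewrite nrmZ c1 mul1r.
have [F FE] := exists_linear fL.
exists F; split.
- by apply/bounded_opP; exists 1 => // x; rewrite mul1r FE; exact: fN.
- by move=> x; rewrite FE.
- rewrite FE; apply: le_trans (cmod_Re _); rewrite /= ux0.
  exact: ler_norm.
Qed.

End HahnBanach.

Lemma nrm_le_functional (R : realType) (X : normedModType R[i]) (x : X) (C : R) :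
  (forall f : {linear X -> R[i]^o}, dual X f ->
    (forall y, cmod (f y) <= nrm y) -> cmod (f x) <= C) -> nrm x <= C.
Proof.
move=> H; have [f [fd fN fx]] := norming_functional x.
exact: le_trans fx (H f fd fN).
Qed.

Lemma functional_separates (R : realType) (X : normedModType R[i]) (x y : X) :
  (forall f : {linear X -> R[i]^o}, dual X f -> f x = f y) -> x = y.
Proof.
move=> H; apply/eqP; rewrite -subr_eq0; apply/eqP/nrm_eq0/eqP.
rewrite eq_le nrm_ge0 andbT; apply: nrm_le_functional => f fd _.
by rewrite linearB /= (H f fd) subrr cmod0.
Qed.

(** * Completeness *)

(** Completeness with a rate, which passes to the limit. *)
Lemma complete_seq (R : realType) (X : completeNormedModType R[i]) (u : nat -> X)
    (e : nat -> R) :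
  (forall n m, nrm (u (n + m)%N - u n) <= e n) ->
  (forall d : R, 0 < d -> exists n, e n <= d) ->
  exists l, forall n, nrm (u n - l) <= e n.
Proof.
move=> ue e0.
have : cvg (u @ \oo).
  apply/cauchy_cvgP; apply: cauchy_exP => d /gt0_complexE[d' d'0 ->].
  have [|n en] := e0 (d' / 2); first by rewrite divr_gt0.
  exists (u n); exists n => // k /= nk.
  rewrite -ball_normE /ball_ /= normE ltcR nrmB -(subnKC nk).
  apply: (le_lt_trans (ue _ _)); apply: (le_lt_trans en).
  by rewrite gtr_pMr // invf_lt1 // ltr1n.
move=> /cvgrPdist_le cu; exists (lim (u @ \oo)) => n.
apply/ler_addgt0Pl => d d0.
have [|N _ HN] := cu d%:C; first by rewrite ltcR.
have := HN (n + N)%N (leq_addl _ _); rewrite normE lecR nrmB => h.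
apply: (le_trans (nrmBD (u (n + N)%N) _ _)).
by rewrite addrC; apply: lerD => //; rewrite nrmB; exact: ue.
Qed.

Lemma complete_seqR (R : realType) (u e : nat -> R) :
  (forall n m, `|u (n + m)%N - u n| <= e n) ->
  (forall d : R, 0 < d -> exists n, e n <= d) ->
  exists l, forall n, `|u n - l| <= e n.
Proof.
move=> ue e0.
have : cvg (u @ \oo).
  apply/cauchy_cvgP; apply: cauchy_exP => d d'0.
  have [|n en] := e0 (d / 2); first by rewrite divr_gt0.
  exists (u n); exists n => // k /= nk.
  rewrite -ball_normE /ball_ /= distrC -(subnKC nk).
  apply: (le_lt_trans (ue _ _)); apply: (le_lt_trans en).
  by rewrite gtr_pMr // invf_lt1 // ltr1n.
move=> /cvgrPdist_le cu; exists (lim (u @ \oo)) => n.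
apply/ler_addgt0Pl => d d0.
have [N _ HN] := cu d d0.
have := HN (n + N)%N (leq_addl _ _); rewrite distrC => h.
apply: (le_trans (ler_distD (u (n + N)%N) _ _)).
by rewrite addrC; apply: lerD => //; rewrite distrC; exact: ue.
Qed.

Lemma complete_seqC (R : realType) (u : nat -> R[i]) (e : nat -> R) :
  (forall n m, cmod (u (n + m)%N - u n) <= e n) ->
  (forall d : R, 0 < d -> exists n, e n <= d) ->
  exists l, forall n, cmod (u n - l) <= e n.
Proof.
move=> ue e0.
have [|a Ha] := @complete_seqR _ (fun n => complex.Re (u n)) e _ e0.
  by move=> n m; rewrite -cReB; apply: le_trans (cmod_Re _) (ue n m).
have [|b Hb] := @complete_seqR _ (fun n => complex.Im (u n)) e _ e0.
  by move=> n m; rewrite -cImB; apply: le_trans (cmod_Im _) (ue n m).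
pose l := a +i* b; exists l => n; apply/ler_addgt0Pl => d d0.
have [|N eN] := e0 (d / 3); first by rewrite divr_gt0.
have key k : cmod (u k - l) <= e k + e k.
  apply: (le_trans (cmod_leRI _)); rewrite cReB cImB; exact: lerD.
apply: (le_trans (cmodBD (u (n + N)%N) _ _)).
rewrite addrC; apply: lerD; last by rewrite cmodB; exact: ue.
have : cmod (u (n + N)%N - l) <= cmod (u (N + n)%N - u N) + cmod (u N - l).
  by rewrite [(n + N)%N]addnC; exact: cmodBD.
move/le_trans; apply.
apply: (le_trans (lerD (ue N n) (key N))).
by move: eN; lra.
Qed.

(** * Uniform boundedness *)

(** The uniform boundedness principle for a family of seminorms [p i] on a complete
   seminormed space [D]. The space is a subset of a vector space, so that the
   result applies to the dual, seen as a space of functions, and to the space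
   itself. *)
Section UniformBoundedness.
Variables (R : realType) (V : lmodType R[i]) (D : set V) (N : V -> R).
Variables (I : Type) (p : I -> V -> R).
Hypotheses (D0 : D 0) (DD : forall x y, D x -> D y -> D (x + y)).
Hypothesis DZ : forall a x, D x -> D (a *: x).
Hypothesis N0 : forall x, D x -> 0 <= N x.
Hypothesis NZ : forall a x, D x -> N (a *: x) = cmod a * N x.
Hypothesis complete : forall u : nat -> V, (forall n, D (u n)) ->
  (forall n, N (u n.+1 - u n) <= 3 ^- n) ->
  exists2 l, D l & forall n, N (l - u n) <= 3 / 2 * 3 ^- n.
Hypothesis pD : forall i x y, D x -> D y -> p i (x + y) <= p i x + p i y.
Hypothesis pZ : forall i a x, D x -> p i (a *: x) = cmod a * p i x.
Hypothesis pN : forall i, exists M, forall x, D x -> p i x <= M * N x.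
Hypothesis pb : forall x, D x -> exists c, forall i, p i x <= c.

Let DN x : D x -> D (- x). Proof. by move=> Dx; rewrite -scaleN1r; exact: DZ. Qed.

Let p0 i : p i 0 = 0.
Proof. by rewrite -(scale0r 0) pZ // cmod0 mul0r. Qed.

Let pNeg i x : D x -> p i (- x) = p i x.
Proof. by move=> Dx; rewrite -scaleN1r pZ // cmodN cmod1 mul1r. Qed.

(** The norm of the seminorm [p i]. *)
Let B i := sup [set p i v | v in [set v | D v /\ N v <= 1]].

Let B_has_sup i : has_sup [set p i v | v in [set v | D v /\ N v <= 1]].
Proof.
split.
  exists (p i 0), 0 => //; split => //.
  by rewrite -(scale0r 0) NZ // cmod0 mul0r.
have [M HM] := pN i; exists `|M| => _ [v [Dv v1] <-].
apply: (le_trans (HM v Dv)); apply: (@le_trans _ _ (`|M| * N v)).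
  by rewrite ler_wpM2r ?N0 // ler_norm.
by rewrite -[leRHS]mulr1 ler_wpM2l.
Qed.

Let B_ub i v : D v -> N v <= 1 -> p i v <= B i.
Proof. by move=> Dv v1; apply: ub_le_sup; [exact: (B_has_sup i).2 | exists v]. Qed.

Let B_ge0 i : 0 <= B i.
Proof. by rewrite -(p0 i) B_ub // -(scale0r 0) NZ // cmod0 mul0r. Qed.

Let B_le i v : D v -> p i v <= B i * N v.
Proof.
move=> Dv; have [v0|v0] := eqVneq (N v) 0.
  by have [M HM] := pN i; rewrite v0 mulr0; have := HM v Dv; rewrite v0 mulr0.
have vp : 0 < N v by rewrite lt_neqAle eq_sym v0 N0.
have cv : cmod ((N v)^-1)%:C = (N v)^-1 by rewrite cmodR gtr0_norm // invr_gt0.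
have := @B_ub i ((N v)^-1%:C *: v) (DZ _ Dv).
by rewrite NZ // pZ // cv mulVf // lexx => /(_ isT); rewrite mulrC ler_pdivrMr.
Qed.

Let B_near i : exists v, [/\ D v, N v <= 1 & 2 / 3 * B i <= p i v].
Proof.
have := B_ge0 i; rewrite le_eqVlt => /predU1P[B0|Bp].
  exists 0; split => //; first by rewrite -(scale0r 0) NZ // cmod0 mul0r.
  by rewrite -B0 mulr0 p0.
have e0 : 0 < B i / 3 by rewrite divr_gt0.
have [_ [v [Dv v1] <-] h] := sup_adherent e0 (B_has_sup i).
by exists v; split => //; apply: ltW; apply: le_lt_trans h; rewrite -/(B i); lra.
Qed.

(** A gliding hump in the form given by Sokal: one of [x + v], [x - v] is at
   least as large as [v] for a seminorm. *)
Lemma uniform_boundedness : exists K, forall i x, D x -> p i x <= K * N x.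
Proof.
apply: contrapT => nK.
have big n : exists i, n%:R * 6 * 3 ^+ n < B i.
  apply: contrapT => nB; apply: nK; exists (n%:R * 6 * 3 ^+ n) => i x Dx.
  apply: (le_trans (B_le i Dx)); rewrite ler_wpM2r ?N0 // leNgt.
  by apply/negP => h; apply: nB; exists i.
have [i iP] := choice big.
have [v vP] := choice (fun n => B_near (i n)).
pose w n := (3 ^- n)%:C *: v n.
have t0 n : 0 < 3 ^- n :> R by rewrite invr_gt0 exprn_gt0.
have ct n : cmod (3 ^- n : R)%:C = 3 ^- n by rewrite cmodR gtr0_norm.
have Dw n : D (w n) by apply: DZ; have [] := vP n.
have Nw n : N (w n) <= 3 ^- n.
  have [Dv v1 _] := vP n.
  by rewrite /w NZ // ct -[leRHS]mulr1 ler_pM2l.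
(* the sign of the n-th hump is the one that keeps [p (i n)] large *)
pose u := fix u n := if n is m.+1 then
  (if p (i m) (w m) <= p (i m) (u m + w m) then u m + w m else u m - w m) else 0.
have Du n : D (u n).
  by elim: n => [|n IH] //=; case: ifP => _; apply: DD => //; exact: DN.
have [l Dl Hl] : exists2 l, D l & forall n, N (l - u n) <= 3 / 2 * 3 ^- n.
  apply: complete => // n /=; case: ifP => _; rewrite addrC addKr //.
  by rewrite -scaleN1r NZ // cmodN cmod1 mul1r.
have pu n : p (i n) (w n) <= p (i n) (u n.+1).
  rewrite /=; case: ifPn => //; rewrite -ltNge => h.
  have Dm : D (u n - w n) by apply: DD => //; exact: DN.
  have Dp : D (u n + w n) by exact: DD.
  have : p (i n) (2%:R *: w n) <= p (i n) (u n + w n) + p (i n) (u n - w n).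
    have -> : 2%:R *: w n = (u n + w n) + - (u n - w n).
      by rewrite opprB addrC subrKA scaler_nat mulr2n.
    by apply: (le_trans (pD _ Dp (DN Dm))); rewrite pNeg.
  by rewrite pZ // cmod_nat; move: h; lra.
have [c Hc] := pb Dl.
have key n : n%:R <= c.
  apply: le_trans (Hc (i n)).
  have [Dv v1 vB] := vP n.
  have pw : p (i n) (w n) = 3 ^- n * p (i n) (v n) by rewrite /w pZ // ct.
  have Dlu : D (u n.+1 - l) by apply: DD => //; exact: DN.
  have h1 : p (i n) (u n.+1) <= p (i n) l + p (i n) (u n.+1 - l).
    by have := pD (i n) Dl Dlu; rewrite addrC subrK.
  have h2 : p (i n) (u n.+1 - l) <= B (i n) * (3 / 2 * 3 ^- n.+1).
    rewrite -opprB pNeg; last by apply: DD => //; exact: DN.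
    apply: (le_trans (B_le _ _)); first by apply: DD => //; exact: DN.
    by rewrite ler_wpM2l.
  have h3 : 3 ^- n * (2 / 3 * B (i n)) <= 3 ^- n * p (i n) (v n) by rewrite ler_pM2l.
  have h4 : n%:R * 6 <= B (i n) * 3 ^- n.
    by rewrite ler_pdivlMr ?exprn_gt0 // ltW.
  have h5 : B (i n) * (3 / 2 * 3 ^- n.+1) = B (i n) * 3 ^- n / 2.
    by rewrite exprS; field; rewrite expf_neq0.
  have := pu n; rewrite pw; move: h1 h2 h3 h4; rewrite h5.
  have -> : 3 ^- n * (2 / 3 * B (i n)) = (B (i n) * 3 ^- n) * (2 / 3) by ring.
  lra.
have := key (Num.truncn `|c|).+1; apply/negP; rewrite -ltNge.
exact: le_lt_trans (ler_norm c) (truncnS_gt _).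
Qed.

End UniformBoundedness.

Lemma third_itv (R : realType) : 0 <= (3^-1 : R) < 1.
Proof. by rewrite invr_ge0 ler0n /= invf_lt1 // ltr1n. Qed.

(** The factor is [1 + 1/3 + 1/9 + ... = 3/2]. *)
Lemma telescope3 (R : realType) (V : normedModType R[i]) (u : nat -> V) (c : R) :
  0 <= c -> (forall n, nrm (u n.+1 - u n) <= c * 3 ^- n) ->
  forall n m, nrm (u (n + m)%N - u n) <= c * (3 / 2 * 3 ^- n).
Proof.
move=> c0 Hu n m.
suff H : nrm (u (n + m)%N - u n) <= c * (3 / 2 * (3 ^- n - 3 ^- (n + m))).
  apply: (le_trans H); rewrite ler_wpM2l // ler_wpM2l // gerBl.
  by rewrite invr_ge0 exprn_ge0.
elim: m => [|m IH]; first by rewrite addn0 !subrr nrm0 !mulr0.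
apply: (le_trans (nrmBD (u (n + m)%N) _ _)); rewrite addnS.
apply: (le_trans (lerD (Hu _) IH)); rewrite -mulrDr ler_wpM2l //.
rewrite exprS invfM le_eqVlt; apply/orP; left; apply/eqP.
by move: (3 ^- n) (3 ^- (n + m)) => x y; lra.
Qed.

Lemma small3 (R : realType) (c d : R) : 0 < d -> exists n, c * (3 / 2 * 3 ^- n) <= d.
Proof.
move=> d0; have [n Hn] := geometric_small (c * (3 / 2)) (third_itv R) d0.
by exists n; rewrite mulrA -exprVn.
Qed.

Lemma le0_of3 (R : realType) (c x : R) :
  (forall n, x <= c * (3 / 2 * 3 ^- n)) -> x <= 0.
Proof.
move=> H; apply: (@geometric_le0 _ 3^-1 (c * (3 / 2))); first exact: third_itv.
by move=> n; rewrite exprVn -mulrA.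
Qed.

(** The dual of a normed space, as a space of functions. *)
Section DualSpace.
Variables (R : realType) (X : normedModType R[i]).

Definition dualfun : set (X -> R[i]^o) :=
  [set f | linear f /\ exists2 K : R, 0 <= K & forall x, cmod (f x) <= K * nrm x].

Definition dualnorm (f : X -> R[i]^o) : R := fine (opnorm f).

Lemma dualnorm_ge0 f : 0 <= dualnorm f.
Proof. by rewrite fine_ge0 // opnorm_ge0. Qed.

Lemma dualnorm_le (f : X -> R[i]^o) (K : R) : 0 <= K ->
  (forall x, cmod (f x) <= K * nrm x) -> dualnorm f <= K.
Proof.
move=> K0 fK; have h := @opnorm_le R X (R[i]^o : normedModType R[i]) f K K0 fK.
rewrite -lee_fin /dualnorm fineK // ge0_fin_numE ?opnorm_ge0 //.
exact: le_lt_trans h (ltry _).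
Qed.

Lemma dualnorm_ub (f : X -> R[i]^o) x : dualfun f -> cmod (f x) <= dualnorm f * nrm x.
Proof.
move=> [fl [K K0 fK]]; have [F FE] : exists F : {linear X -> R[i]^o}, F =1 f := exists_linear fl.
have h := @opnorm_le R X (R[i]^o : normedModType R[i]) f K K0 fK.
have E : f = F by apply/funext => y; rewrite FE.
rewrite -FE; apply: (@opnorm_bound R X (R[i]^o : normedModType R[i])).
rewrite -[F : X -> R[i]^o]E /dualnorm fineK // ge0_fin_numE ?opnorm_ge0 //.
exact: le_lt_trans h (ltry _).
Qed.

Lemma dualfunD f g : dualfun f -> dualfun g -> dualfun (f + g).
Proof.
move=> [fl [K K0 fK]] [gl [M M0 gM]]; split.
  by move=> a x y; rewrite !fctE fl gl scalerDr addrACA.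
exists (K + M); first exact: addr_ge0.
by move=> x; rewrite !fctE mulrDl; apply: cmodD_le.
Qed.

Lemma dualfunZ a f : dualfun f -> dualfun (a *: f).
Proof.
move=> [fl [K K0 fK]]; split.
  move=> b x y; rewrite !fctE fl scalerDr !scalerA; congr (_ + _).
  by rewrite mulrC.
exists (cmod a * K); first by rewrite mulr_ge0 ?cmod_ge0.
move=> x; rewrite -mulrA; apply: (@le_trans _ _ (cmod a * cmod (f x))).
  by rewrite -cmodM.
by rewrite ler_wpM2l ?cmod_ge0.
Qed.

Lemma dualfun0 : dualfun 0.
Proof.
have E x : (0 : X -> R[i]^o) x = 0 by [].
split; first by move=> a x y; rewrite !E scaler0 addr0.
by exists 0 => // x; rewrite E cmod0 mul0r.
Qed.

Lemma dualnormZ a f : dualfun f -> dualnorm (a *: f) = cmod a * dualnorm f.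
Proof.
have le b g : dualfun g -> dualnorm (b *: g) <= cmod b * dualnorm g.
  move=> gd; apply: dualnorm_le; first by rewrite mulr_ge0 ?cmod_ge0 ?dualnorm_ge0.
  move=> x; rewrite -mulrA; apply: (@le_trans _ _ (cmod b * cmod (g x))).
    by rewrite -cmodM.
  by rewrite ler_wpM2l ?cmod_ge0 // dualnorm_ub.
move=> fd; apply/eqP; rewrite eq_le le //=.
have [->|a0] := eqVneq a 0; first by rewrite cmod0 mul0r dualnorm_ge0.
have := le a^-1 _ (dualfunZ a fd).
by rewrite scalerA mulVf // scale1r cmodV ler_pdivlMl // cmod_gt0.
Qed.

Lemma dual_complete (u : nat -> X -> R[i]^o) : (forall n, dualfun (u n)) ->
  (forall n, dualnorm (u n.+1 - u n) <= 3 ^- n) ->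
  exists2 l, dualfun l & forall n, dualnorm (l - u n) <= 3 / 2 * 3 ^- n.
Proof.
move=> ud un.
have dB f g : dualfun f -> dualfun g -> dualfun (f - g).
  by move=> fd gd; rewrite -scaleN1r; apply: dualfunD => //; exact: dualfunZ.
have step x n : cmod (u n.+1 x - u n x) <= nrm x * 3 ^- n.
  apply: (@le_trans _ _ (dualnorm (u n.+1 - u n) * nrm x)).
    by apply: dualnorm_ub; exact: dB.
  by rewrite mulrC ler_wpM2l ?nrm_ge0.
have lim x : exists l, forall n, cmod (u n x - l) <= nrm x * (3 / 2 * 3 ^- n).
  apply: complete_seqC; last by move=> d; exact: small3.
  exact: (@telescope3 _ (R[i]^o : normedModType R[i]) (u^~ x) _ (nrm_ge0 x) (step x)).
have [l lP] := choice lim.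
have t0 n : 0 <= 3 / 2 * 3 ^- n :> R.
  by rewrite mulr_ge0 // ?divr_ge0 // invr_ge0 exprn_ge0.
have ld : dualfun l.
  split.
    move=> a x y; suff : l (a *: x + y) = a * l x + l y by [].
    apply/eqP; rewrite -subr_eq0; apply/eqP/cmod_eq0/eqP.
    rewrite eq_le cmod_ge0 andbT.
    apply: (@le0_of3 _ (nrm (a *: x + y) + cmod a * nrm x + nrm y)) => n.
    have -> : l (a *: x + y) - (a * l x + l y) = - (u n (a *: x + y) - l (a *: x + y))
       + a * (u n x - l x) + (u n y - l y).
      have ul : u n (a *: x + y) = a * u n x + u n y by rewrite (ud n).1.
      by rewrite ul; ring.
    rewrite [leRHS]mulrDl; apply: cmodD_le; last exact: lP.
    rewrite [leRHS]mulrDl; apply: cmodD_le; first by rewrite cmodN; exact: lP.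
    by rewrite cmodM -mulrA ler_wpM2l ?cmod_ge0.
  have [_ [K K0 uK]] := ud 0%N.
  exists (K + 3 / 2); first by rewrite addr_ge0 ?divr_ge0.
  move=> x; rewrite -(subrK (u 0%N x) (l x)) addrC mulrDl.
  apply: cmodD_le => //; rewrite cmodB; have := lP x 0%N.
  by rewrite expr0 invr1 mulr1 mulrC.
exists l => // n; apply: dualnorm_le => // x.
by have := lP x n; rewrite mulrC cmodB.
Qed.

End DualSpace.

(** Pointwise weakly bounded families of operators are bounded: uniform
   boundedness is applied to the dual space and then to the space. *)
Lemma weakly_bounded (R : realType) (X : completeNormedModType R[i]) (I : Type)
    (S : I -> {linear X -> X}) :
  (forall i, bounded_op X X (S i)) ->
  (forall x (f : {linear X -> R[i]^o}), dual X f ->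
     exists c, forall i, cmod (f (S i x)) <= c) ->
  exists2 K : R, 0 <= K & forall i x, nrm (S i x) <= K * nrm x.
Proof.
move=> Sb Sw.
have pw x : exists c, forall i, nrm (S i x) <= c.
  have [|||K HK] := @uniform_boundedness R (X -> R[i]^o) (@dualfun R X) (@dualnorm R X)
    I (fun i f => cmod (f (S i x))) (dualfun0 X) (@dualfunD R X) (@dualfunZ R X)
    (fun f _ => dualnorm_ge0 f) (@dualnormZ R X) (@dual_complete R X)
    (fun i f g _ _ => cmodD _ _).
  - by move=> i a f _; rewrite -cmodM.
  - by move=> i; exists (nrm (S i x)) => f fd; rewrite mulrC; exact: dualnorm_ub.
  - move=> f [fl fb].
    have [F FE] : exists F : {linear X -> R[i]^o}, F =1 f := exists_linear fl.
    have [|c Hc] := Sw x F; last by exists c => i; rewrite -FE.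
    have [K K0 fK] := fb; apply/bounded_opP; exists K => // y.
    by rewrite FE; exact: fK.
  exists `|K| => i; apply: nrm_le_functional => f fd fN.
  have fd' : dualfun f.
    split; first by move=> a u w; rewrite linearP.
    by exists 1 => // y; rewrite mul1r.
  apply: (le_trans (HK i f fd')); apply: (le_trans (ler_norm _)).
  rewrite normrM -[leRHS]mulr1 ler_wpM2l // ger0_norm ?dualnorm_ge0 //.
  by apply: dualnorm_le => // y; rewrite mul1r.
have cX (u : nat -> X) : (forall n, [set: X] (u n)) ->
    (forall n, nrm (u n.+1 - u n) <= 3 ^- n) ->
    exists2 l, [set: X] l & forall n, nrm (l - u n) <= 3 / 2 * 3 ^- n.
  move=> _ un.
  have [|d d0|l lP] := @complete_seq R X u (fun n => 1 * (3 / 2 * 3 ^- n)).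
  - by apply: telescope3 => // n; rewrite mul1r.
  - exact: small3.
  by exists l => // n; rewrite nrmB -[leRHS]mul1r.
have [||||K HK] := @uniform_boundedness R X setT (@nrm R X) I (fun i x => nrm (S i x))
  Logic.I (fun _ _ _ _ => Logic.I) (fun _ _ _ => Logic.I) (fun x _ => nrm_ge0 x) (fun a x _ => nrmZ a x) cX.
- by move=> i x y _ _; rewrite linearD; exact: nrmD.
- by move=> i a x _; rewrite linearZ; exact: nrmZ.
- by move=> i; have /bounded_opP[K K0 HK] := Sb i; exists K => x _; exact: HK.
- by move=> x _; exact: pw.
exists `|K| => // i x; apply: (le_trans (HK i x Logic.I)).
by rewrite ler_wpM2r ?nrm_ge0 // ler_norm.
Qed.

(** * Power series of a power-bounded operator *)

Definition powers_bounded_by (R : realType) (X : normedModType R[i])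
    (T : {linear X -> X}) (K : R) :=
  0 <= K /\ forall n x, nrm (iter n T x) <= K * nrm x.

Lemma iter_linear (R : realType) (X : normedModType R[i]) (T : {linear X -> X}) n :
  linear (iter n T).
Proof.
elim: n => [//|n IH] a x y; rewrite [LHS]/= IH linearP //.
Qed.

Lemma power_boundedP (R : realType) (X : normedModType R[i]) (T : {linear X -> X}) :
  power_bounded T -> exists K, powers_bounded_by T K.
Proof.
rewrite /power_bounded; set s := ereal_sup _ => Tp.
have s0 : (0 <= s)%E.
  apply: le_trans (opnorm_ge0 (iter 0 T)) _.
  by apply: ereal_sup_ubound; exists 0%N.
exists (fine s); split; first exact: fine_ge0.
move=> n x; have [S SE] := exists_linear (iter_linear T n).
rewrite -SE; apply: opnorm_bound; rewrite fineK ?ge0_fin_numE //.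
apply: ereal_sup_ubound; exists n => //.
by congr opnorm; apply/funext => y; rewrite SE.
Qed.

Section OperatorSeries.
Variables (R : realType) (X : completeNormedModType R[i]) (T : {linear X -> X}).

Definition opsum (a : nat -> R[i]) N (x : X) := \sum_(0 <= n < N) a n *: iter n T x.

(** [sums_to a S]: [S] is the sum of the series [a_n T^n], which converges
   geometrically in operator norm. *)
Definition sums_to (a : nat -> R[i]) (S : {linear X -> X}) :=
  exists q M : R, [/\ 0 <= q < 1, 0 <= M &
    forall N x, nrm (opsum a N x - S x) <= M * nrm x * q ^+ N].

Lemma opsum_linear a N : linear (opsum a N).
Proof.
move=> c x y; rewrite /opsum scaler_sumr -big_split /=; apply: eq_bigr => n _.
by rewrite iter_linear scalerDr !scalerA mulrC.
Qed.

(** The partial sums are Cauchy pointwise, with a tail that is linear in [nrm x]. *)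
Lemma opser (K q C : R) (a : nat -> R[i]) : powers_bounded_by T K ->
  0 <= q < 1 -> 0 <= C -> (forall n, cmod (a n) <= C * q ^+ n) ->
  exists S : {linear X -> X}, forall N x,
    nrm (opsum a N x - S x) <= K * C / (1 - q) * nrm x * q ^+ N.
Proof.
move=> [K0 TK] qI C0 aC; have [q0 q1] := andP qI.
pose M := K * C / (1 - q).
have M0 : 0 <= M by rewrite divr_ge0 ?mulr_ge0 // subr_ge0 ltW.
have tail x N m : nrm (opsum a (N + m) x - opsum a N x) <= M * nrm x * q ^+ N.
  rewrite /opsum (@big_cat_nat _ _ _ N 0) ?leq_addr //= addrAC subrr add0r.
  apply: (le_trans (nrm_sum _ _ _)).
  apply: (@le_trans _ _ (K * C * nrm x / (1 - q) * q ^+ N)); last first.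
    by rewrite le_eqVlt; apply/orP; left; apply/eqP; rewrite /M; ring.
  apply: (geo_sum_le (F := fun n => nrm (a n *: iter n T x))) => //.
    by rewrite !mulr_ge0 ?nrm_ge0.
  move=> n; rewrite nrmZ.
  have -> : K * C * nrm x * q ^+ n = (C * q ^+ n) * (K * nrm x) by ring.
  by apply: ler_pM; rewrite ?cmod_ge0 ?nrm_ge0.
have lim x : exists l, forall N, nrm (opsum a N x - l) <= M * nrm x * q ^+ N.
  apply: complete_seq; first exact: tail.
  by move=> d d0; exact: geometric_small.
have [s sP] := choice lim.
have sL : linear s.
  move=> c x y; apply/eqP; rewrite -subr_eq0; apply/eqP/nrm_eq0/eqP.
  rewrite eq_le nrm_ge0 andbT.
  apply: (@geometric_le0 _ q (M * nrm (c *: x + y) + cmod c * (M * nrm x) + M * nrm y) _ qI) => N.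
  apply: (le_trans (nrmBD (opsum a N (c *: x + y)) _ _)).
  rewrite -[X in _ <= X * _]addrA [leRHS]mulrDl; apply: lerD; first by rewrite nrmB.
  rewrite opsum_linear opprD addrACA -scalerBr [leRHS]mulrDl; apply: nrmD_le => //.
  by rewrite nrmZ -mulrA ler_wpM2l ?cmod_ge0.
have [S SE] := exists_linear sL.
by exists S => N x; rewrite SE.
Qed.

Lemma opser_bound (a : nat -> R[i]) (S : {linear X -> X}) (q M : R) :
  (forall N x, nrm (opsum a N x - S x) <= M * nrm x * q ^+ N) ->
  forall x, nrm (S x) <= M * nrm x.
Proof.
by move=> H x; have := H 0%N x; rewrite /opsum big_geq // sub0r nrmN expr0 mulr1.
Qed.

Lemma sums_to_bounded a S : sums_to a S -> bounded_op X X S.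
Proof.
by move=> [q [M [_ M0 H]]]; apply/bounded_opP; exists M => //; exact: opser_bound H.
Qed.

Lemma sums_to_ex (K q C : R) (a : nat -> R[i]) : powers_bounded_by T K ->
  0 <= q < 1 -> 0 <= C -> (forall n, cmod (a n) <= C * q ^+ n) ->
  exists S, sums_to a S.
Proof.
move=> TK qI C0 aC; have [S HS] := opser TK qI C0 aC; exists S.
exists q, (K * C / (1 - q)); split => //.
have [K0 _] := TK; have [_ q1] := andP qI.
by rewrite divr_ge0 ?mulr_ge0 // subr_ge0 ltW.
Qed.

Lemma opsumT a N x : opsum a N (T x) = T (opsum a N x).
Proof.
by rewrite /opsum linear_sum; apply: eq_bigr => n _; rewrite linearZ /= -iterSr.
Qed.

(** ** The resolvent *)

Lemma iter_resolvent (z : R[i]) N x :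
  iter N T (x - z *: T x) = iter N T x - z *: iter N.+1 T x.
Proof. by rewrite -scaleNr addrC iter_linear -iterSr addrC scaleNr. Qed.

Lemma opsum_resolvent (z : R[i]) N x :
  opsum (fun n => z ^+ n) N (x - z *: T x) = x - z ^+ N *: iter N T x.
Proof.
rewrite /opsum; elim: N => [|N IH]; first by rewrite big_geq // expr0 scale1r subrr.
by rewrite big_nat_recr //= IH iter_resolvent scalerBr scalerA -exprSr addrA subrK.
Qed.

Lemma geometric_opser (K : R) (z : R[i]) (q : R) : powers_bounded_by T K ->
  cmod z <= q -> q < 1 -> exists S : {linear X -> X}, forall N x,
    nrm (opsum (fun n => z ^+ n) N x - S x) <= K / (1 - q) * nrm x * q ^+ N.
Proof.
move=> TK zq q1.
have qI : 0 <= q < 1 by rewrite (le_trans (cmod_ge0 z)).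
have [||S HS] := @opser K q 1 (fun n => z ^+ n) TK qI.
- exact: ler01.
- move=> n; rewrite mul1r cmodX; apply: lerXn2r; rewrite ?nnegrE ?cmod_ge0 //.
  by case/andP: qI.
by exists S => N x; have := HS N x; rewrite mulr1.
Qed.

(** The partial sums of the geometric series telescope against [I - z T]. *)
Lemma resolvent_ex (K : R) (z : R[i]) (q : R) (S : {linear X -> X}) :
  powers_bounded_by T K -> bounded_op X X T -> cmod z <= q -> q < 1 ->
  (forall N x, nrm (opsum (fun n => z ^+ n) N x - S x) <=
     K / (1 - q) * nrm x * q ^+ N) ->
  [/\ bounded_op X X S, forall x, S (x - z *: T x) = x &
    forall x, S x - z *: T (S x) = x].
Proof.
move=> [K0 TK] /bounded_opP[L L0 TL] zq q1 HS.
have qI : 0 <= q < 1 by rewrite (le_trans (cmod_ge0 z)).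
have zN N : cmod (z ^+ N) <= q ^+ N.
  rewrite cmodX; apply: lerXn2r; rewrite ?nnegrE ?cmod_ge0 //.
  by case/andP: qI.
pose M := K / (1 - q).
have M0 : 0 <= M by rewrite divr_ge0 // subr_ge0 ltW.
have S1 x : S (x - z *: T x) = x.
  apply/eqP; rewrite -subr_eq0; apply/eqP/nrm_eq0/eqP.
  rewrite eq_le nrm_ge0 andbT; set y := x - z *: T x.
  apply: (@geometric_le0 _ q (M * nrm y + K * nrm x) _ qI) => N.
  apply: (le_trans (nrmBD (opsum (fun n => z ^+ n) N y) _ _)).
  rewrite [leRHS]mulrDl; apply: lerD; first by rewrite nrmB; exact: HS.
  rewrite opsum_resolvent addrC addKr nrmN nrmZ [leRHS]mulrC.
  by apply: ler_pM; rewrite ?cmod_ge0 ?nrm_ge0.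
have ST x : S (T x) = T (S x).
  apply/eqP; rewrite -subr_eq0; apply/eqP/nrm_eq0/eqP.
  rewrite eq_le nrm_ge0 andbT.
  apply: (@geometric_le0 _ q (M * nrm (T x) + L * (M * nrm x)) _ qI) => N.
  apply: (le_trans (nrmBD (opsum (fun n => z ^+ n) N (T x)) _ _)).
  rewrite [leRHS]mulrDl; apply: lerD; first by rewrite nrmB; exact: HS.
  rewrite opsumT -linearB; apply: (le_trans (TL _)).
  by rewrite -mulrA ler_wpM2l //; exact: HS.
split => //.
- by apply/bounded_opP; exists M => //; exact: opser_bound HS.
- by move=> x; rewrite -ST -linearZ -linearB.
Qed.

Lemma resolvent_spec (K : R) (z : R[i]) :
  powers_bounded_by T K -> bounded_op X X T -> cmod z < 1 ->
  [/\ bounded_op X X (resolvent T z),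
    forall x, resolvent T z (x - z *: T x) = x &
    forall x, resolvent T z x - z *: T (resolvent T z x) = x].
Proof.
move=> TK Tb z1; have [S HS] := geometric_opser TK (lexx (cmod z)) z1.
have H := resolvent_ex TK Tb (lexx _) z1 HS.
pose P := [set S : {linear X -> X} | [/\ bounded_op X X S,
  forall x, S (x - z *: T x) = x & forall x, S x - z *: T (S x) = x]].
exact: (@getPex _ P (ex_intro P S H)).
Qed.

Lemma resolvent_series (K : R) (z : R[i]) (q : R) :
  powers_bounded_by T K -> bounded_op X X T -> cmod z <= q -> q < 1 ->
  forall N x, nrm (opsum (fun n => z ^+ n) N x - resolvent T z x) <=
     K / (1 - q) * nrm x * q ^+ N.
Proof.
move=> TK Tb zq q1.
have [S HS] := geometric_opser TK zq q1.
have [_ S1 S2] := resolvent_ex TK Tb zq q1 HS.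
have [_ R1 _] := resolvent_spec TK Tb (le_lt_trans zq q1).
by move=> N x; have -> : resolvent T z x = S x by rewrite -{1}(S2 x) R1.
Qed.

End OperatorSeries.

(** * Matrix coefficients of the resolvent *)

Section Gfun.
Variables (R : realType) (X : completeNormedModType R[i]) (T : {linear X -> X}).
Variables (K : R) (x : X) (xs : {linear X -> R[i]^o}).
Hypotheses (TK : powers_bounded_by T K) (Tb : bounded_op X X T) (xd : dual X xs).

(** The Taylor coefficients of [gfun T x xs] at the origin are [xs (T^n x)]. *)
Lemma gfun_expands (s : R) : 0 <= s < 1 ->
  expands (dilate s (gfun T x xs)) (fun n => (s ^+ n)%:C * xs (iter n T x)).
Proof.
move=> sI; have [s0 s1] := andP sI.
have [F F0 HF] := (bounded_opP _).1 xd.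
have [K0 HK] := TK.
pose C := F * (K / (1 - s) * nrm x).
have K1 : K <= K / (1 - s).
  by rewrite ler_pdivlMr ?subr_gt0 // ler_piMr // lerBlDr lerDl.
exists s, C; split => //.
- by rewrite !mulr_ge0 ?nrm_ge0 // invr_ge0 subr_ge0 ltW.
- move=> n; rewrite cmodM cmodR ger0_norm ?exprn_ge0 // mulrC ler_wpM2r ?exprn_ge0 //.
  apply: (le_trans (HF _)); rewrite ler_wpM2l //; apply: (le_trans (HK _ _)).
  by rewrite ler_wpM2r ?nrm_ge0.
move=> z z1 N.
have cz : cmod (s%:C * z) <= s.
  by rewrite cmodM cmodR ger0_norm // ler_piMr.
have := resolvent_series TK Tb cz s1 N x.
have -> : dilate s (gfun T x xs) z - \sum_(n < N) (s ^+ n)%:C * xs (iter n T x) * z ^+ n =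
    - xs (opsum T (fun n => (s%:C * z) ^+ n) N x - resolvent T (s%:C * z) x).
  rewrite linearB opprB; congr (_ - _); rewrite /opsum linear_sum big_mkord.
  apply: eq_bigr => n _; rewrite linearZ /= exprMn rmorphXn /=.
  by rewrite mulrAC.
move=> h; rewrite cmodN; apply: (le_trans (HF _)).
by rewrite /C -mulrA ler_wpM2l.
Qed.

Lemma resolvent_identity (z w : R[i]) (y : X) : disc z -> disc w ->
  resolvent T w y - resolvent T z y =
  (w - z) *: resolvent T w (T (resolvent T z y)).
Proof.
move=> zd wd.
have [_ W1 _] := resolvent_spec TK Tb wd.
have [_ _ Z2] := resolvent_spec TK Tb zd.
set u := resolvent T z y.
have -> : resolvent T w y = resolvent T w (u - z *: T u) by rewrite Z2.
have E : u = resolvent T w (u - w *: T u) by rewrite W1.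
have D : (u - z *: T u) - (u - w *: T u) = (w - z) *: T u.
  by rewrite opprB addrC addrA subrK scalerBl.
by rewrite [X in _ - X]E -linearB D linearZ.
Qed.

Lemma resolventT (z : R[i]) (y : X) : disc z ->
  resolvent T z (T y) = T (resolvent T z y).
Proof.
move=> zd; have [_ Z1 Z2] := resolvent_spec TK Tb zd.
by rewrite -{1}(Z2 y) linearB linearZ /= Z1.
Qed.

(** Two applications of the resolvent identity exhibit the error term as
   [(w - z)^2] times a bounded quantity. *)
Lemma gfun_cderiv (z : R[i]) : disc z ->
  has_cderiv (gfun T x xs) z (xs (T (resolvent T z (resolvent T z x)))).
Proof.
move=> zd.
have [F F0 HF] := (bounded_opP _).1 xd.
have [L L0 HL] := (bounded_opP _).1 Tb.
have [K0 HK] := TK.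
pose q := (1 + cmod z) / 2.
have q1 : q < 1 by move: zd; rewrite /disc /= /q; lra.
have zq : cmod z < q by move: zd; rewrite /disc /= /q; lra.
have M0 : 0 <= K / (1 - q) by rewrite divr_ge0 // subr_ge0 ltW.
set M := K / (1 - q) in M0.
have RM w y : cmod w <= q -> nrm (resolvent T w y) <= M * nrm y.
  move=> wq; have := resolvent_series TK Tb wq q1 0%N y.
  by rewrite /opsum big_geq // sub0r nrmN expr0 mulr1.
pose v := T (resolvent T z (T (resolvent T z x))).
pose C := F * (M * nrm v).
have C0 : 0 <= C by do 2![apply: mulr_ge0 => //]; exact: nrm_ge0.
have zz : disc z by [].
move=> e e0; exists (Num.min (q - cmod z) (e / (C + 1))).
  by rewrite lt_min subr_gt0 zq divr_gt0 // ltr_wpDl.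
move=> w; rewrite lt_min => /andP[wz we].
have wq : cmod w <= q.
  by have := cmodD (w - z) z; rewrite subrK; move: wz; lra.
have wd : disc w by apply: le_lt_trans q1.
(* the error term is [(w - z)^2] times a coefficient of the resolvent at [w] *)
have -> : gfun T x xs w - gfun T x xs z -
     xs (T (resolvent T z (resolvent T z x))) * (w - z) =
   (w - z) * ((w - z) * xs (resolvent T w v)).
  rewrite /gfun -linearB (resolvent_identity x zd wd) linearZ /=.
  have -> : (w - z) *: (xs (resolvent T w (T (resolvent T z x))) : R[i]^o) =
    (w - z) * xs (resolvent T w (T (resolvent T z x))) by [].
  have factor (a b c : R[i]) : a * b - c * a = a * (b - c) by ring.
  rewrite factor -(resolventT (resolvent T z x) zd) -linearB (resolvent_identity _ zd wd).
  by rewrite linearZ.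
rewrite cmodM mulrC ler_wpM2r ?cmod_ge0 // cmodM.
have h : cmod (xs (resolvent T w v)) <= C.
  by apply: (le_trans (HF _)); rewrite ler_wpM2l // RM.
apply: (@le_trans _ _ (cmod (w - z) * (C + 1))).
  by rewrite ler_wpM2l ?cmod_ge0 // (le_trans h) // lerDl.
by rewrite -ler_pdivlMr ?ltr_wpDl // ltW.
Qed.

End Gfun.

(** The Taylor coefficients of [g'] are its Fourier coefficients on circles. *)
Lemma fourier_cderive (R : realType) (g : R[i] -> R[i]) (b : nat -> R[i]) (r : R) m :
  holomorphic g ->
  (forall s : R, 0 <= s < 1 -> expands (dilate s g) (fun n => (s ^+ n)%:C * b n)) ->
  0 < r < 1 ->
  cint (- pi) pi (fun t => polar 1 (m%:R * t) * cderive g (polar r (- t))) =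
  (2 * pi)%:C * (m.+1%:R * b m.+1 * (r ^+ m)%:C).
Proof.
move=> hg Hb rI; have [r0 r1] := andP rI.
have [s [s0 s1 rs]] : exists s : R, [/\ 0 < s, s < 1 & r < s].
  by exists ((1 + r) / 2); split; lra.
have sI : 0 <= s < 1 by rewrite ltW.
have [|q [D [qI D0 H1 _]]] :=
    expands_cderiv (Hb s sI) (h1 := fun z => s%:C * cderive g (s%:C * z)).
  by move=> z z1; apply: dilate_cderiv => //; exact: ltW.
have sC : s%:C != 0 :> R[i] by rewrite -cmod_gt0 cmodR normr_gt0 gt_eqF.
have rs0 : 0 < r / s by rewrite divr_gt0.
have rs1 : r / s < 1 by rewrite ltr_pdivrMr // mul1r.
have polE t : s%:C * polar (r / s) t = polar r t.
  rewrite (polarE (r / s)) (polarE r) mulrA -rmorphM /= mulrCA mulfV ?mulr1 //.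
  by rewrite gt_eqF.
pose c k := k.+1%:R * ((s ^+ k.+1)%:C * b k.+1) * ((r / s) ^+ k)%:C.
have polX k t : polar (r / s) (- t) ^+ k = ((r / s) ^+ k)%:C * polar 1 (- k%:R * t).
  by rewrite (polarE (r / s)) exprMn polar1X mulrN mulNr rmorphXn.
have ctsg a d : cts_on a d (fun t => s%:C * cderive g (polar r (- t))).
  have rI' : 0 <= r < 1 by rewrite ltW.
  have [L L0 [HL _]] := cderive_lip hg rI'.
  apply: (@cts_on_lip _ _ _ (s * (L * r))) => t u _ _.
  rewrite -mulrBr cmodM cmodR gtr0_norm // -!mulrA ler_wpM2l ?(ltW s0) //.
  apply: (le_trans (HL _ _ _ _)); rewrite ?cmod_polar ?(ltW r0) // ler_wpM2l //.
  rewrite (polarE r (- u)) (polarE r (- t)) -mulrBr cmodM cmodR gtr0_norm //.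
  rewrite ler_wpM2l ?(ltW r0) //; apply: (le_trans (polar1_lip _ _)).
  by rewrite opprK addrC distrC.
have term k a d : cts_on a d (fun t => c k * polar 1 ((m%:R - k%:R) * t)).
  by apply: cts_onM; [exact: cts_on_cst | exact: cts_on_polarM].
have cts_sum N a d : cts_on a d (fun t => \sum_(0 <= k < N) c k * polar 1 ((m%:R - k%:R) * t)).
  elim: N => [|N IH].
    by apply: (@cts_on_ext _ _ _ (fun=> 0)) => [t|]; [rewrite big_geq | exact: cts_on_cst].
  apply: (@cts_on_ext _ _ _ (fun t => \sum_(0 <= k < N) c k * polar 1 ((m%:R - k%:R) * t) +
     c N * polar 1 ((m%:R - N%:R) * t))); first by move=> t; rewrite big_nat_recr.
  exact: cts_onD.
have int_term k : cint (- pi) pi (fun t => c k * polar 1 ((m%:R - k%:R) * t)) =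
    if k == m then (2 * pi)%:C * c m else 0.
  rewrite cintZ; last exact: cts_on_polarM.
  have [mk|km] := leqP m k.
    rewrite (@cint_polar_ortho _ _ (k - m)); last by right; rewrite natrB // opprB.
    rewrite subn_eq0; have -> : (k <= m)%N = (k == m) by rewrite eqn_leq mk andbT.
    by case: eqP => [->|_]; rewrite ?mulr0 // mulrC.
  rewrite (@cint_polar_ortho _ _ (m - k)); last by left; rewrite natrB // ltnW.
  by rewrite subn_eq0 leqNgt km /= mulr0 ltn_eqF.
have int_sum N : cint (- pi) pi
    (fun t => \sum_(0 <= k < N) c k * polar 1 ((m%:R - k%:R) * t)) =
    if (m < N)%N then (2 * pi)%:C * c m else 0.
  elim: N => [|N IH].
    rewrite (eq_cint (G := fun=> 0)); last by move=> t _; rewrite big_geq.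
    by rewrite cint_cst ?pi_Npi // mulr0.
  rewrite (eq_cint (G := fun t => \sum_(0 <= k < N) c k * polar 1 ((m%:R - k%:R) * t) +
     c N * polar 1 ((m%:R - N%:R) * t))); last by move=> t _; rewrite big_nat_recr.
  rewrite cintD // IH int_term ltnS [(m <= N)%N]leq_eqVlt.
  have [->|mN] := eqVneq m N; first by rewrite ltnn ?eqxx add0r.
  by rewrite ?addr0.
have ctsF : cts_on (- pi) pi (fun t => polar 1 (m%:R * t) * (s%:C * cderive g (polar r (- t)))).
  by apply: cts_onM => //; exact: cts_on_polarM.
have key : cint (- pi) pi (fun t => polar 1 (m%:R * t) * (s%:C * cderive g (polar r (- t)))) =
    (2 * pi)%:C * c m.
  apply/eqP; rewrite -subr_eq0; apply/eqP/cmod_eq0/eqP.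
  rewrite eq_le cmod_ge0 andbT.
  apply: (@geometric_le0 _ q (D * q ^+ m.+1 * (pi - - pi)) _ qI) => N.
  have := int_sum (m.+1 + N)%N; rewrite addSn ltnS leq_addr => <-.
  rewrite -cintB //.
  have -> : D * q ^+ m.+1 * (pi - - pi) * q ^+ N = D * q ^+ (m.+1 + N) * (pi - - pi).
    by rewrite exprD; ring.
  apply: cint_bound; first exact: pi_Npi.
    by apply: cts_onD => //; exact: cts_onN.
  move=> t _.
  have rsd : cmod (polar (r / s) (- t)) < 1 by rewrite cmod_polar // ltW.
  have := H1 _ rsd (m.+1 + N)%N; rewrite polE => h.
  apply: le_trans h.
  have -> : \sum_(0 <= k < (m + N).+1) c k * polar 1 ((m%:R - k%:R) * t) =
     polar 1 (m%:R * t) *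
     \sum_(0 <= k < m.+1 + N) k.+1%:R * ((s ^+ k.+1)%:C * b k.+1) * polar (r / s) (- t) ^+ k.
    rewrite mulr_sumr addSn; apply: eq_bigr => k _; rewrite polX mulrDl polar1D /c.
    by rewrite mulrCA -!mulrA; congr (_ * _); rewrite !mulrA; ring.
  by rewrite -mulrBr cmodM cmod_polar1 mul1r.
have : s%:C * cint (- pi) pi (fun t => polar 1 (m%:R * t) * cderive g (polar r (- t))) =
    s%:C * ((2 * pi)%:C * (m.+1%:R * b m.+1 * (r ^+ m)%:C)).
  rewrite -cintZ; last first.
    apply: (@cts_on_ext _ _ _ (fun t => s%:C^-1 * (polar 1 (m%:R * t) *
      (s%:C * cderive g (polar r (- t)))))).
      move=> t; move: (cderive g _) (polar 1 _) => u w; field => //.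
    by apply: cts_onM => //; exact: cts_on_cst.
  rewrite (eq_cint (G := fun t => polar 1 (m%:R * t) *
    (s%:C * cderive g (polar r (- t))))); last by move=> t _; rewrite mulrCA.
  rewrite key /c exprS expr_div_n !rmorphM fmorphV /= !rmorphXn /=.
  have sm : s%:C ^+ m != 0 :> R[i] by rewrite expf_neq0.
  by field.
by move/(mulfI sC).
Qed.

(** * The duality between the two spaces *)

Lemma cderive_circle_lip (R : realType) (f : R[i] -> R[i]) (r : R) :
  holomorphic f -> 0 < r < 1 -> exists2 L : R, 0 <= L &
  (forall s u t : R, 0 < s <= r -> 0 < u <= r ->
    cmod (cderive f (polar s t) - cderive f (polar u t)) <= L * `|s - u|) /\
  (forall t u : R, cmod (cderive f (polar r t) - cderive f (polar r u)) <= L * `|t - u|).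
Proof.
move=> hf /andP[r0 r1].
have rI : 0 <= r < 1 by rewrite ltW.
have [L L0 [HL _]] := cderive_lip hf rI.
exists L => //; split.
- move=> s u t /andP[s0 sr] /andP[u0 ur].
  apply: (le_trans (HL _ _ _ _)); rewrite ?cmod_polar ?(ltW s0) ?(ltW u0) //.
  rewrite ler_wpM2l // (polarE s) (polarE u) -mulrBl cmodM cmod_polar1 mulr1.
  by rewrite -rmorphB cmodR.
- move=> t u; apply: (le_trans (HL _ _ _ _)); rewrite ?cmod_polar ?(ltW r0) //.
  rewrite ler_wpM2l // (polarE r t) (polarE r u) -mulrBr cmodM cmodR gtr0_norm //.
  apply: (@le_trans _ _ (1 * cmod (polar 1 t - polar 1 u))).
    by rewrite ler_wpM2r ?cmod_ge0 // ltW.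
  by rewrite mul1r polar1_lip.
Qed.

Lemma cts_cderive_circle (R : realType) (f : R[i] -> R[i]) (r a b : R) :
  holomorphic f -> 0 < r < 1 -> cts_on a b (fun t => cderive f (polar r t)).
Proof.
move=> hf rI; have [L L0 [_ HL]] := cderive_circle_lip hf rI.
by apply: (@cts_on_lip _ _ _ L) => t u _ _; exact: HL.
Qed.

Lemma cts_cderive_circleN (R : realType) (f : R[i] -> R[i]) (r a b : R) :
  holomorphic f -> 0 < r < 1 -> cts_on a b (fun t => cderive f (polar r (- t))).
Proof.
move=> hf rI; have [L L0 [_ HL]] := cderive_circle_lip hf rI.
apply: (@cts_on_lip _ _ _ L) => t u _ _; apply: (le_trans (HL _ _)).
by rewrite opprK addrC distrC.
Qed.

Definition circle_pairing (R : realType) (g f : R[i] -> R[i]) (r : R) : R[i] :=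
  cint (- pi) pi (fun t => cderive f (polar r t) * cderive g (polar r (- t))).

Definition log_weight (R : realType) (r : R) : R := r * ln (1 / r).

Lemma BpairingE (R : realType) (g f : R[i] -> R[i]) : Bpairing g f =
  cintegral (@radii R) (fun r => (log_weight r)%:C * circle_pairing g f r).
Proof. by []. Qed.

Lemma cts_circle_pairing (R : realType) (g f : R[i] -> R[i]) (r : R) :
  holomorphic f -> holomorphic g -> 0 < r < 1 -> cts_on (- pi) pi
    (fun t => cderive f (polar r t) * cderive g (polar r (- t))).
Proof.
move=> hf hg rI; apply: cts_onM.
  exact: cts_cderive_circle.
exact: cts_cderive_circleN.
Qed.

(** Since [ln (1 / r) <= 1 / r - 1], the logarithmic weight is compensated by
   the growth condition on the second function. *)
Lemma log_weight_bound (R : realType) (r : R) : 0 < r < 1 ->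
  0 <= log_weight r <= 1 - r.
Proof.
move=> /andP[r0 r1]; rewrite /log_weight div1r.
have v1 : 1 <= r^-1 by rewrite invf_ge1 // ltW.
have l0 : 0 <= ln r^-1 by exact: ln_ge0.
rewrite mulr_ge0 ?(ltW r0) //=.
have := expR_ge1Dx (ln r^-1); rewrite lnK ?posrE ?invr_gt0 // => h.
have := ler_wpM2l (ltW r0) h; rewrite mulfV ?gt_eqF //.
by rewrite mulrDr mulr1; lra.
Qed.

Lemma continuous_circle_pairing (R : realType) (g f : R[i] -> R[i]) (r : R) :
  holomorphic f -> holomorphic g -> 0 < r < 1 ->
  {for r, continuous (fun s => complex.Re (circle_pairing g f s) : R^o)} /\
  {for r, continuous (fun s => complex.Im (circle_pairing g f s) : R^o)}.
Proof.
move=> hf hg /andP[r0 r1].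
have [p [rp p1]] : exists p : R, r < p /\ p < 1.
  by exists ((1 + r) / 2); split; lra.
have p0 : 0 < p := lt_trans r0 rp.
have pI : 0 < p < 1 by rewrite p0.
have pI' : 0 <= p < 1 by rewrite ltW.
have [L L0 [HL _]] := cderive_circle_lip hf pI.
have [M M0 [HM _]] := cderive_circle_lip hg pI.
have [A A0 [_ HA]] := cderive_lip hf pI'.
have [B B0 [_ HB]] := cderive_lip hg pI'.
pose C := (L * B + A * M) * (pi - - pi).
have lip s : 0 < s -> s <= p ->
    cmod (circle_pairing g f s - circle_pairing g f r) <= C * `|s - r|.
  move=> s0 sp.
  have sI : 0 < s < 1 by rewrite s0 (le_lt_trans sp).
  have rI : 0 < r < 1 by rewrite r0.
  rewrite /circle_pairing -cintB; [|exact: cts_circle_pairing|exact: cts_circle_pairing].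
  have -> : C * `|s - r| = (L * `|s - r| * B + A * (M * `|s - r|)) * (pi - - pi).
    by rewrite /C; ring.
  apply: cint_bound; first exact: pi_Npi.
    by apply: cts_onD; [|apply: cts_onN]; exact: cts_circle_pairing.
  move=> t _.
  have split4 (a b c d : R[i]) : a * b - c * d = (a - c) * b + c * (b - d) by ring.
  rewrite split4; apply: cmodD_le; rewrite cmodM; apply: ler_pM; rewrite ?cmod_ge0 //.
  - by apply: HL; rewrite ?s0 ?r0 // ltW.
  - by apply: HB; rewrite cmod_polar // ltW.
  - by apply: HA; rewrite cmod_polar ltW.
  - by apply: HM; rewrite ?s0 ?r0 // ltW.
have C0 : 0 <= C.
  have LB : 0 <= L * B := mulr_ge0 L0 B0.
  have AM : 0 <= A * M := mulr_ge0 A0 M0.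
  by rewrite /C opprK; apply: mulr_ge0; apply: addr_ge0; rewrite ?pi_ge0.
have near (e : R) : 0 < e -> exists2 d : R, 0 < d & forall s, `|r - s| < d ->
    cmod (circle_pairing g f r - circle_pairing g f s) <= e.
  move=> e0; exists (Num.min (Num.min r (p - r)) (e / (C + 1))).
    by rewrite !lt_min r0 subr_gt0 rp divr_gt0 // ltr_wpDl.
  move=> s; rewrite !lt_min => /andP[/andP[h1 h2] h3].
  have [s0 sp] : 0 < s /\ s <= p.
    by move: h1 h2; rewrite !ltr_norml => /andP[? ?] /andP[? ?]; split; lra.
  rewrite cmodB; apply: (le_trans (lip s s0 sp)); rewrite distrC.
  apply: (@le_trans _ _ ((C + 1) * `|r - s|)).
    by rewrite ler_wpM2r // lerDl.
  by rewrite mulrC -ler_pdivlMr ?ltr_wpDl // ltW.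
split; apply/cvgrPdist_le => e e0; have [d d0 Hd] := near e e0;
  apply/nbhs_ballP; exists d => // s rs.
- have := le_trans (cmod_Re _) (Hd s rs); rewrite cReB; exact.
- have := le_trans (cmod_Im _) (Hd s rs); rewrite cImB; exact.
Qed.

Lemma measurable_radii_continuous (R : realType) (f : R -> R) :
  (forall r : R, 0 < r < 1 -> {for r, continuous (f : R -> R^o)}) ->
  measurable_fun (@radii R : set (measurableTypeR R)) f.
Proof.
move=> cf; apply: open_continuous_measurable_fun; first exact: itv_open.
by move=> r /set_mem /radiiP; exact: cf.
Qed.

Lemma continuous_log_weight (R : realType) (r : R) : 0 < r ->
  {for r, continuous (@log_weight R : R -> R^o)}.
Proof.
move=> r0; have rn0 : r != 0 by rewrite gt_eqF.
have h1 : (1 / s : R) @[s --> r] --> (1 / r : R).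
  by apply: cvgM; [exact: cvg_cst | apply: cvgV].
have h2 : ln (1 / s : R) @[s --> r] --> ln (1 / r : R).
  apply: (cvg_comp (fun s : R => 1 / s) (@ln R) h1).
  by apply: continuous_ln; rewrite divr_gt0.
by apply: cvgM => //; exact: cvg_id.
Qed.

Lemma integrableZr (R : realType) (D : set R) (f : R -> R) (k : R) :
  measurable (D : set (measurableTypeR R)) ->
  lebesgue_measure.-integrable D (EFin \o f) ->
  lebesgue_measure.-integrable D (EFin \o (fun t => k * f t)).
Proof.
move=> mD hf; have := integrableZl mD k hf.
by apply: eq_integrable => // t _ /=.
Qed.

Lemma Rintegral_oppr (R : realType) (a : R) (G : R -> R) : 0 <= a ->
  {within `[- a, a], continuous (G : R -> R^o)} ->
  \int[lebesgue_measure]_(t in `[- a, a]) G t =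
  \int[lebesgue_measure]_(t in `[- a, a]) G (- t).
Proof.
move=> a0 wG.
have aa : - a <= a by rewrite -subr_ge0 opprK addr_ge0.
have := @integration_by_substitution_oppr _ G (- a) a aa.
by rewrite opprK => /(_ wG) h; rewrite /Rintegral h.
Qed.

(** The circle supremum of [f'] is taken out of the integral, and the reflection
   [t |-> - t] removes the sign in the argument of [g']. *)
Lemma circle_pairing_bound (R : realType) (g f : R[i] -> R[i]) (r : R) :
  holomorphic f -> holomorphic g -> 0 < r < 1 ->
  cmod (circle_pairing g f r) <= cmax f r *
    \int[lebesgue_measure]_(t in `[- pi, pi]) cmod (cderive g (polar r t)).
Proof.
move=> hf hg rI.
pose G t := cmod (cderive g (polar r t)).
have cG : cts_on (- pi) pi (fun t => (G t)%:C).
  exact: (cts_on_cmod (cts_cderive_circle hg rI)).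
have cGN : cts_on (- pi) pi (fun t => (G (- t))%:C).
  exact: (cts_on_cmod (cts_cderive_circleN hg rI)).
have iGN : lebesgue_measure.-integrable `[- pi, pi] (EFin \o (fun t => G (- t))).
  exact: (cts_on_integrable cGN).1.
have wG : {within `[- pi, pi], continuous (G : R -> R^o)} := (cts_on_within cG).1.
rewrite (Rintegral_oppr (pi_ge0 R) wG).
rewrite -RintegralZl; [|exact: measurable_itv|exact: iGN].
apply: cmod_cintegral.
- exact: measurable_itv.
- exact: (cts_on_integrable (cts_circle_pairing hf hg rI)).
- by apply: integrableZr; [exact: measurable_itv|exact: iGN].
move=> t; rewrite /= in_itv /= => tI; rewrite cmodM ler_wpM2r ?cmod_ge0 //.
exact: cmax_ub hf rI tI.
Qed.

HB.lock Definition e0 (R : realType) (g : R[i] -> R[i]) : R := fine (E0norm g).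

Lemma E0norm_ge0 (R : realType) (g : R[i] -> R[i]) : (0 <= E0norm g)%E.
Proof.
have h : @radii R (1 / 2) by apply/radiiP; apply/andP; split; lra.
apply: le_trans (ereal_sup_ubound _); last by exists (1 / 2).
apply: mule_ge0; first by rewrite lee_fin; lra.
by apply: integral_ge0 => t _; rewrite lee_fin cmod_ge0.
Qed.

Lemma e0E (R : realType) (g : R[i] -> R[i]) : Espace g -> E0norm g = (e0 g)%:E.
Proof. by move=> [_ gE]; rewrite e0.unlock fineK // ge0_fin_numE // E0norm_ge0. Qed.

Lemma e0_ge0 (R : realType) (g : R[i] -> R[i]) : 0 <= e0 g.
Proof. by rewrite e0.unlock fine_ge0 // E0norm_ge0. Qed.

Lemma e0_ub (R : realType) (g : R[i] -> R[i]) (r : R) : Espace g -> 0 < r < 1 ->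
  (1 - r) * \int[lebesgue_measure]_(t in `[- pi, pi]) cmod (cderive g (polar r t))
  <= e0 g.
Proof.
move=> gE rI; have hg := gE.1.
have cG := cts_on_cmod (@cts_cderive_circle _ g r (- pi) pi hg rI).
have iG := (cts_on_integrable cG).1.
rewrite -lee_fin -e0E // EFinM /Rintegral fineK; last first.
  exact: integrable_fin_num iG.
by apply: ereal_sup_ubound; exists r => //; exact/radiiP.
Qed.

Definition pairing_integrand (R : realType) (g f : R[i] -> R[i]) (r : R) : R[i] :=
  (log_weight r)%:C * circle_pairing g f r.

Lemma pairing_integrand_bound (R : realType) (g f : R[i] -> R[i]) (r : R) :
  holomorphic f -> Espace g -> 0 < r < 1 ->
  cmod (pairing_integrand g f r) <= e0 g * cmax f r.
Proof.
move=> hf gE rI; rewrite cmodM cmodR.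
have /andP[w0 w1] := log_weight_bound rI.
rewrite ger0_norm //; set I := \int[lebesgue_measure]_(t in `[- pi, pi]) cmod (cderive g (polar r t)).
have I0 : 0 <= I by apply: Rintegral_ge0 => t _; exact: cmod_ge0.
apply: (@le_trans _ _ ((1 - r) * (cmax f r * I))).
  apply: ler_pM; rewrite ?cmod_ge0 //.
  exact: circle_pairing_bound hf gE.1 rI.
rewrite mulrCA mulrC ler_wpM2r ?cmax_ge0 //.
exact: e0_ub.
Qed.

Lemma pairing_integrable (R : realType) (g f : R[i] -> R[i]) :
  B0space f -> Espace g -> cintegrable (@radii R) (pairing_integrand g f).
Proof.
move=> fB gE.
have mW : measurable_fun (@radii R : set (measurableTypeR R)) (@log_weight R).
  by apply: measurable_radii_continuous => r /andP[r0 _]; exact: continuous_log_weight.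
have iM := integrableZl (@measurable_radii R) (e0 g) (cmax_integrable fB.1 fB.2).
have bound (r : R) (x : R) : radii r -> `|x| <= cmod (pairing_integrand g f r) ->
    (`|x%:E| <= `|(e0 g)%:E * (EFin \o cmax f) r|)%E.
  move=> /radiiP rI xb; rewrite /= lee_fin.
  apply: (le_trans xb); apply: (le_trans (pairing_integrand_bound fB.1 gE rI)).
  exact: ler_norm.
split; apply: (le_integrable _ _ _ iM).
- exact: measurable_radii.
- apply/measurable_EFinP.
  rewrite (_ : (fun t => _) = (fun r => log_weight r * complex.Re (circle_pairing g f r))); last first.
    by apply/funext => r; rewrite /pairing_integrand cReM /= mul0r subr0.
  apply: measurable_funM => //; apply: measurable_radii_continuous => r rI.
  by have [] := continuous_circle_pairing fB.1 gE.1 rI.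
- by move=> r rI; apply: bound => //; exact: cmod_Re.
- exact: measurable_radii.
- apply/measurable_EFinP.
  rewrite (_ : (fun t => _) = (fun r => log_weight r * complex.Im (circle_pairing g f r))); last first.
    by apply/funext => r; rewrite /pairing_integrand cImM /= mul0r addr0.
  apply: measurable_funM => //; apply: measurable_radii_continuous => r rI.
  by have [] := continuous_circle_pairing fB.1 gE.1 rI.
- by move=> r rI; apply: bound => //; exact: cmod_Im.
Qed.

Lemma b0_Rintegral (R : realType) (f : R[i] -> R[i]) : B0space f ->
  \int[lebesgue_measure]_(r in @radii R) cmax f r = b0 f.
Proof. by move=> fB; rewrite /Rintegral -B0norm_cmax ?b0.unlock //; case: fB. Qed.

Lemma Bpairing_bound (R : realType) (g f : R[i] -> R[i]) :
  B0space f -> Espace g -> cmod (Bpairing g f) <= e0 g * b0 f.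
Proof.
move=> fB gE; rewrite BpairingE -b0_Rintegral // -RintegralZl //;
  [|exact: measurable_radii|exact: cmax_integrable fB.1 fB.2].
apply: cmod_cintegral.
- exact: measurable_radii.
- exact: pairing_integrable.
- apply: integrableZr; [exact: measurable_radii|exact: cmax_integrable fB.1 fB.2].
- by move=> r /radiiP rI; exact: pairing_integrand_bound fB.1 gE rI.
Qed.

Lemma realcM (R : realType) (x y : R) : (x * y)%:C = x%:C * y%:C.
Proof. by rewrite rmorphM. Qed.

Lemma circle_pairingD (R : realType) (g f1 f2 : R[i] -> R[i]) (r : R) :
  holomorphic f1 -> holomorphic f2 -> holomorphic g -> 0 < r < 1 ->
  circle_pairing g (fun z => f1 z + f2 z) r =
  circle_pairing g f1 r + circle_pairing g f2 r.
Proof.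
move=> h1 h2 hg rI.
rewrite -(cintD (cts_circle_pairing h1 hg rI) (cts_circle_pairing h2 hg rI)).
apply: eq_cint => t _.
by rewrite (cderiveD h1 h2 (disc_polar t rI)) mulrDl.
Qed.

Lemma circle_pairingZ (R : realType) (g f : R[i] -> R[i]) (a : R[i]) (r : R) :
  holomorphic f -> holomorphic g -> 0 < r < 1 ->
  circle_pairing g (fun z => a * f z) r = a * circle_pairing g f r.
Proof.
move=> h1 hg rI; rewrite -(cintZ a (cts_circle_pairing h1 hg rI)).
apply: eq_cint => t _.
by rewrite (cderiveZ a h1 (disc_polar t rI)) mulrA.
Qed.

Lemma BpairingD (R : realType) (g f1 f2 : R[i] -> R[i]) :
  B0space f1 -> B0space f2 -> Espace g ->
  Bpairing g (fun z => f1 z + f2 z) = Bpairing g f1 + Bpairing g f2.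
Proof.
move=> h1 h2 gE; rewrite !BpairingE.
rewrite -(cintegralD (@measurable_radii R) (pairing_integrable h1 gE) (pairing_integrable h2 gE)).
apply: eq_cintegral => r /radiiP rI.
by rewrite (circle_pairingD h1.1 h2.1 gE.1 rI) mulrDr.
Qed.

Lemma BpairingZ (R : realType) (g f : R[i] -> R[i]) (a : R[i]) :
  B0space f -> Espace g -> Bpairing g (fun z => a * f z) = a * Bpairing g f.
Proof.
move=> h1 gE; rewrite !BpairingE.
rewrite -(cintegralZ a (@measurable_radii R) (pairing_integrable h1 gE)).
apply: eq_cintegral => r /radiiP rI.
by rewrite (circle_pairingZ a h1.1 gE.1 rI) mulrCA.
Qed.

Lemma eq_Bpairing (R : realType) (g f1 f2 : R[i] -> R[i]) :
  holomorphic f1 -> (forall z, disc z -> f1 z = f2 z) ->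
  Bpairing g f1 = Bpairing g f2.
Proof.
move=> h1 f12; rewrite !BpairingE; apply: eq_cintegral => r /radiiP rI.
have E : circle_pairing g f1 r = circle_pairing g f2 r.
  by apply: eq_cint => t _; rewrite (eq_cderive_disc h1 f12 (disc_polar t rI)).
by rewrite E.
Qed.

(** ** The pairing with monomials *)

(** With [r = s^2] this is the inequality [- ln s <= 1 / s]. *)
Lemma xlnx_small (R : realType) (r : R) : 0 < r -> r < 1 ->
  `|r * ln r| <= 2 * Num.sqrt r.
Proof.
move=> r0 r1.
have s0 : 0 < Num.sqrt r by rewrite sqrtr_gt0.
have rE : r = Num.sqrt r ^+ 2 by rewrite sqr_sqrtr // ltW.
have s1 : Num.sqrt r < 1 by rewrite -(@ltr_pXn2r _ 2) ?nnegrE ?(ltW s0) // -rE expr1n.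
rewrite {1 2}rE; move: (Num.sqrt r) s0 s1 => s s0 s1.
have l1 : ln s <= 0 by rewrite ln_le0 // ltW.
have h : - ln s <= s^-1.
  have := expR_ge1Dx (- ln s); rewrite expRN lnK ?posrE //; lra.
rewrite lnXn // normrM ger0_norm ?exprn_ge0 ?(ltW s0) // ler0_norm; last first.
  by rewrite mulrn_wle0.
have -> : s ^+ 2 * - (ln s *+ 2) = s * (s * - ln s) *+ 2.
  by rewrite !mulr2n expr2; ring.
rewrite mulr_natl ler_wMn2r // -[leRHS]mulr1 ler_wpM2l ?(ltW s0) //.
have := ler_wpM2l (ltW s0) h; rewrite mulfV ?gt_eqF //.
Qed.

(** The integrand has the primitive [F], and it extends continuously by [0] at the
   origin; thus the fundamental theorem of calculus applies on the closed
   segment. *)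
Lemma integral_log_weight (R : realType) m :
  lebesgue_measure.-integrable (@radii R)
    (EFin \o (fun r => log_weight r * r ^+ (2 * m))) /\
  \int[lebesgue_measure]_(r in @radii R) (log_weight r * r ^+ (2 * m)) =
  ((2 * m).+2%:R ^+ 2)^-1.
Proof.
pose k : R := (2 * m).+2%:R.
have k0 : k != 0 by rewrite pnatr_eq0.
pose f (r : R) := log_weight r * r ^+ (2 * m).
pose F (r : R) := - (r ^+ (2 * m).+2 * ln r) / k + r ^+ (2 * m).+2 / k ^+ 2.
have lwE (r : R) : 0 < r -> log_weight r = - (r * ln r).
  by move=> r0; rewrite /log_weight div1r lnV ?posrE // mulrN.
have lw0 : log_weight (0 : R) = 0 by rewrite /log_weight mul0r.
have small (e : R) : 0 < e -> exists2 d : R, 0 < d & forall r, 0 < r -> r < d -> `|r * ln r| <= e.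
  move=> e_0; exists (Num.min 1 ((e / 2) ^+ 2)).
    by rewrite lt_min ltr01 exprn_gt0 // divr_gt0.
  move=> r r0; rewrite lt_min => /andP[r1 re].
  apply: (le_trans (xlnx_small r0 r1)); rewrite -ler_pdivlMl //.
  rewrite -[leRHS](_ : Num.sqrt ((e / 2) ^+ 2) = _).
    by rewrite ler_sqrt ?exprn_ge0 ?divr_ge0 ?(ltW e_0) // ltW.
  by rewrite sqrtr_sqr ger0_norm ?divr_ge0 ?(ltW e_0) // mulrC.
have cf0 (r : R) : 0 < r -> {for r, continuous (f : R -> R^o)}.
  move=> r0; apply: cvgM; first exact: continuous_log_weight.
  exact: exprn_continuous.
have to0 (h : R -> R) : (forall r, 0 < r -> r < 1 -> `|h r| <= `|r * ln r|) ->
    h x @[x --> 0^'+] --> (0 : R).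
  move=> hb; apply/cvgrPdist_le => e e_0; have [d d0 Hd] := small e e_0.
  near=> r; rewrite sub0r normrN.
  have r0 : 0 < r by near: r; exact: nbhs_right_gt.
  have r1 : r < 1 by near: r; exact: nbhs_right_lt.
  have rd : r < d by near: r; exact: nbhs_right_lt.
  exact: le_trans (hb r r0 r1) (Hd r r0 rd).
have cf : {within `[0, 1], continuous (f : R -> R^o)}.
  apply/(continuous_within_itvP _ (@ltr01 R)); split.
  - by move=> r; rewrite in_itv => /andP[r0 _]; exact: cf0.
  - have -> : f 0 = 0 by rewrite /f lw0 mul0r.
    apply: to0 => r r0 r1; rewrite /f lwE // normrM normrN ler_piMr //.
    by rewrite ger0_norm ?exprn_ge0 ?exprn_ile1 // ltW.
  - by apply: cvg_at_left_filter; exact: (cf0 1 ltr01).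
have dF (r : R) : 0 < r -> is_derive r (1 : R) (F : R -> R^o) (f r).
  move=> r0; have dln := is_derive1_ln r0.
  have dX := is_deriveX (2 * m).+2 (@is_derive_id _ _ r (1 : R)).
  have H := is_deriveD (is_deriveZ (- k^-1) (is_deriveM dX dln))
    (is_deriveZ (k ^- 2) dX).
  have FE : F = (- k^-1) \*: (((id : R -> R) ^+ (2 * m).+2) * @ln R) +
     (k ^- 2) \*: ((id : R -> R) ^+ (2 * m).+2).
    have id1 (p q : R) : - (p * q) / k + p / k ^+ 2 = - k^-1 * (p * q) + k ^- 2 * p.
      by ring.
    by apply/funext => x; rewrite /F !fctE; exact: id1.
  rewrite FE; apply: (is_derive_eq H).
  rewrite /GRing.scale /= !fctE /= /f lwE // -/k.
  have rn0 : r != 0 by rewrite gt_eqF.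
  rewrite !mulr1 !exprS; move: (ln r) (r ^+ (2 * m)) (k) k0 => L P k' k'0; field.
  by rewrite k'0 rn0.
have F01 : F 1 - F 0 = (k ^+ 2)^-1.
  by rewrite /F expr1n ln1 mulr0 oppr0 mul0r add0r mul1r expr0n /= !mul0r oppr0 mul0r addr0 subr0.
have I01 : \int[lebesgue_measure]_(r in `[0, 1]) f r = (k ^+ 2)^-1.
  rewrite -F01 /Rintegral (@continuous_FTC2 _ _ F) //.
    have cF (r : R) : 0 < r -> {for r, continuous F}.
      move=> r0; apply: differentiable_continuous; apply/derivable1_diffP.
      by have [] := dF r r0.
    split.
    - by move=> r; rewrite in_itv => /andP[r0 _]; have [] := dF r r0.
    - have -> : F 0 = 0.
        by rewrite /F expr0n /= !mul0r oppr0 mul0r addr0.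
      rewrite -[X in _ --> X](addr0 (0 : R)).
      apply: cvgD.
        rewrite -[X in _ --> X](mul0r k^-1); apply: cvgM; last exact: cvg_cst.
        apply: (to0 (fun r => - (r ^+ (2 * m).+2 * ln r))) => r r0 r1.
        rewrite normrN exprS -mulrA [_ ^+ _ * _]mulrC mulrA normrM.
        rewrite ler_piMr // ger0_norm ?exprn_ge0 ?exprn_ile1 // ltW //.
      apply: cvg_at_right_filter.
      have e : (0 : R) ^+ (2 * m).+2 / k ^+ 2 = 0 by rewrite expr0n mul0r.
      rewrite -[X in _ --> X]e.
      by apply: cvgM; [exact: exprn_continuous | exact: cvg_cst].
    - by apply: cvg_at_left_filter; exact: (cF 1 ltr01).
  by move=> r; rewrite in_itv => /andP[r0 _]; rewrite derive1E; have [] := dF r r0.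
have wf : lebesgue_measure.-integrable `[0, 1] (EFin \o f).
  by apply: continuous_compact_integrable => //; exact: segment_compact.
have i1 : lebesgue_measure.-integrable `]0, 1] (EFin \o f).
  apply: integrableS wf; [exact: measurable_itv|exact: measurable_itv|].
  by move=> r; rewrite /= !in_itv /= => /andP[/ltW -> ->].
have i2 : lebesgue_measure.-integrable `]0, 1[ (EFin \o f).
  apply: integrableS wf; [exact: measurable_itv|exact: measurable_itv|].
  by move=> r; rewrite /= !in_itv /= => /andP[/ltW -> /ltW ->].
split; first exact: i2.
by rewrite -/k -I01 -(Rintegral_itv_obnd_cbnd i1) -(Rintegral_itv_bndo_bndc i2).
Unshelve. all: by end_near.
Qed.

Lemma cderive_monomial (R : realType) n (z : R[i]) :
  has_cderiv (fun z => z ^+ n.+1) z (n.+1%:R * z ^+ n).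
Proof.
elim: n => [|n IH].
  rewrite expr0 mulr1; apply: has_cderiv_near ltr01 _ (has_cderiv_id z).
  by move=> w _; rewrite expr1.
have := has_cderivM (has_cderiv_id z) IH.
rewrite (_ : 1 * z ^+ n.+1 + id z * (n.+1%:R * z ^+ n) = n.+2%:R * z ^+ n.+1); last first.
  by rewrite exprS -[n.+2%:R]natr1 /=; ring.
by apply: has_cderiv_near ltr01 _ => w _; rewrite [in RHS]exprS.
Qed.

Section PairingCoefficients.
Variables (R : realType) (g : R[i] -> R[i]) (b : nat -> R[i]).
Hypothesis gE : Espace g.
Hypothesis Hb : forall s : R, 0 <= s < 1 ->
  expands (dilate s g) (fun n => (s ^+ n)%:C * b n).

(** On the circle of radius [r], the derivative of [z^(m+1)] selects one Fourier
   coefficient of [g'], and the radial integral produces [1 / (2m + 2)^2]; the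
   constants combine to [pi / 2]. *)
Lemma Bpairing_monomial m :
  (2 / pi)%:C * Bpairing g (fun z => z ^+ m.+1) = b m.+1.
Proof.
have hm : holomorphic (fun z : R[i] => z ^+ m.+1).
  by apply: holomorphic_ex => z _; eexists; exact: cderive_monomial.
pose c := (2 * pi)%:C * (m.+1%:R ^+ 2 * b m.+1).
have cp (r : R) : 0 < r < 1 ->
    circle_pairing g (fun z => z ^+ m.+1) r = c * (r ^+ (2 * m))%:C.
  move=> rI; have [r0 r1] := andP rI.
  have -> : circle_pairing g (fun z => z ^+ m.+1) r = (m.+1%:R * (r ^+ m)%:C) *
      cint (- pi) pi (fun t => polar 1 (m%:R * t) * cderive g (polar r (- t))).
    rewrite -cintZ; last first.
      by apply: cts_onM; [exact: cts_on_polarM | exact: cts_cderive_circleN gE.1 rI].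
    apply: eq_cint => t _.
    rewrite (cderiveE (cderive_monomial m (polar r t))) (polarE r t) exprMn polar1X.
    by rewrite rmorphXn !mulrA.
  rewrite (fourier_cderive m gE.1 Hb rI) /c mul2n -addnn exprD.
  rewrite (realcM (r ^+ m)).
  by move: (r ^+ m)%:C (b m.+1) (2 * pi)%:C => x y p; ring.
have [iu Iu] := @integral_log_weight R m.
rewrite BpairingE (eq_cintegral (G := fun r => c * (log_weight r * r ^+ (2 * m))%:C)); last first.
  move=> r /radiiP rI; rewrite (cp r rI) (realcM (log_weight r)).
  by rewrite mulrCA.
have ciu : cintegrable (@radii R) (fun r => (log_weight r * r ^+ (2 * m))%:C).
  by split => //=; exact: integrable0.
rewrite (cintegralZ c (@measurable_radii R) ciu).
have -> : cintegral (@radii R) (fun r => (log_weight r * r ^+ (2 * m))%:C) =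
    (((2 * m).+2%:R ^+ 2)^-1)%:C.
  apply: complexP; rewrite /= ?Iu //.
  by rewrite Rintegral_cst ?mul0r //; exact: measurable_radii.
have p0 : pi != 0 :> R by rewrite gt_eqF ?pi_gt0.
have m0 : m.+1%:R != 0 :> R by rewrite pnatr_eq0.
have mC : m.+1%:R != 0 :> R[i] by rewrite pnatr_eq0.
have -> : ((2 * m).+2%:R : R) = 2 * m.+1%:R.
  by rewrite -natrM; congr (_%:R); rewrite mulnS.
have E : (2 / pi) * ((2 * pi) * ((2 * m.+1%:R) ^+ 2)^-1) = (m.+1%:R ^+ 2)^-1 :> R.
  move: (m.+1%:R : R) m0 (pi : R) p0 => w w0 p p_0; field.
  by rewrite w0 p_0.
rewrite /c; have -> : (2 / pi)%:C * ((2 * pi)%:C * (m.+1%:R ^+ 2 * b m.+1) *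
    (((2 * m.+1%:R) ^+ 2)^-1)%:C) =
  (2 / pi * ((2 * pi) * ((2 * m.+1%:R) ^+ 2)^-1))%:C * (m.+1%:R ^+ 2 * b m.+1).
  rewrite (realcM (2 / pi)) (realcM (2 * pi)).
  by move: (2 / pi)%:C (2 * pi)%:C (_^-1)%:C => x y w; ring.
rewrite E fmorphV rmorphXn rmorph_nat mulrA mulVf ?mul1r //.
Qed.

Lemma B0space_cst (c : R[i]) : B0space (fun=> c) /\ b0 (fun=> c : R[i]) <= 0.
Proof.
apply: (B0space_bound (@holomorphic_cst R c) (@lexx _ R 0)).
by move=> z _; rewrite (cderiveE (has_cderiv_cst c z)) cmod0.
Qed.

Lemma Bpairing_cst (c : R[i]) : Bpairing g (fun=> c) = 0.
Proof.
have [cB cb] := B0space_cst c.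
apply/cmod_eq0/eqP; rewrite eq_le cmod_ge0 andbT.
apply: (le_trans (Bpairing_bound cB gE)).
by rewrite mulr_ge0_le0 ?e0_ge0.
Qed.

Lemma B0space_monomial m : B0space (fun z : R[i] => z ^+ m).
Proof.
case: m => [|m]; first exact: (B0space_cst 1).1.
suff [] : B0space (fun z : R[i] => z ^+ m.+1) /\ b0 (fun z : R[i] => z ^+ m.+1) <= m.+1%:R by [].
have hm : holomorphic (fun z : R[i] => z ^+ m.+1).
  by apply: holomorphic_ex => z _; eexists; exact: cderive_monomial.
apply: (B0space_bound hm (ler0n _ _)).
move=> z z1; rewrite (cderiveE (cderive_monomial m z)) cmodM cmod_nat cmodX.
by rewrite ler_piMr // exprn_ile1 ?cmod_ge0 // ltW.
Qed.

Lemma B0space_poly (a : nat -> R[i]) N :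
  B0space (fun z => \sum_(0 <= n < N) a n * z ^+ n).
Proof.
elim: N => [|N IH].
  rewrite (_ : (fun z => _) = (fun=> 0)); first exact: (B0space_cst 0).1.
  by apply/funext => z; rewrite big_geq.
rewrite (_ : (fun z => _) = (fun z => \sum_(0 <= n < N) a n * z ^+ n + a N * z ^+ N)); last first.
  by apply/funext => z; rewrite big_nat_recr.
have [mB _] := B0spaceZ (a N) (B0space_monomial N).
by have [] := B0spaceD IH mB.
Qed.

(** The functional behind the calculus, on one matrix coefficient. *)
Definition weak_value (f : R[i] -> R[i]) : R[i] :=
  f 0 * b 0%N + (2 / pi)%:C * Bpairing g f.

Lemma weak_valueD (f1 f2 : R[i] -> R[i]) : B0space f1 -> B0space f2 ->
  weak_value (fun z => f1 z + f2 z) = weak_value f1 + weak_value f2.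
Proof.
move=> h1 h2; rewrite /weak_value (BpairingD h1 h2 gE).
by move: (Bpairing g f1) (Bpairing g f2) => x y; ring.
Qed.

Lemma weak_valueZ a (f : R[i] -> R[i]) : B0space f ->
  weak_value (fun z => a * f z) = a * weak_value f.
Proof.
move=> h1; rewrite /weak_value (BpairingZ a h1 gE).
by move: (Bpairing g f) => x; ring.
Qed.

Lemma weak_value_bound (f : R[i] -> R[i]) : B0space f ->
  cmod (weak_value f) <= cmod (f 0) * cmod (b 0%N) + 2 / pi * (e0 g * b0 f).
Proof.
move=> fB; apply: cmodD_le; rewrite cmodM // cmodR.
have p0 : 0 <= 2 / pi :> R by rewrite divr_ge0 ?pi_ge0.
by rewrite ger0_norm // ler_wpM2l // Bpairing_bound.
Qed.

Lemma weak_value_monomial n : weak_value (fun z => z ^+ n) = b n.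
Proof.
rewrite /weak_value; case: n => [|n]; last by rewrite Bpairing_monomial expr0n mul0r add0r.
by rewrite expr0 mul1r (Bpairing_cst 1) mulr0 addr0.
Qed.

Lemma weak_value_poly (a : nat -> R[i]) N :
  weak_value (fun z => \sum_(0 <= n < N) a n * z ^+ n) = \sum_(0 <= n < N) a n * b n.
Proof.
elim: N => [|N IH].
  rewrite (_ : (fun z => _) = (fun=> 0)); last by apply/funext => z; rewrite big_geq.
  by rewrite big_geq // /weak_value Bpairing_cst mul0r mulr0 addr0.
rewrite (_ : (fun z => _) = (fun z => \sum_(0 <= n < N) a n * z ^+ n + a N * z ^+ N)); last first.
  by apply/funext => z; rewrite big_nat_recr.
have mB := B0space_monomial N.
rewrite (weak_valueD (B0space_poly a N) (B0spaceZ (a N) mB).1) IH.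
by rewrite (weak_valueZ (a N) mB) weak_value_monomial big_nat_recr.
Qed.

End PairingCoefficients.

(** * Series that converge geometrically *)

Lemma cderive_poly (R : realType) (a : nat -> R[i]) N (z : R[i]) :
  has_cderiv (fun z => \sum_(0 <= n < N.+1) a n * z ^+ n) z
    (\sum_(0 <= n < N) n.+1%:R * a n.+1 * z ^+ n).
Proof.
elim: N => [|N IH].
  rewrite big_geq //; apply: has_cderiv_near ltr01 _ (has_cderiv_cst (a 0%N) z) => w _.
  by rewrite big_nat1 expr0 mulr1.
rewrite big_nat_recr //=.
have := has_cderivD IH (has_cderivM (has_cderiv_cst (a N.+1) z) (cderive_monomial N z)).
rewrite (_ : 0 * z ^+ N.+1 + a N.+1 * (N.+1%:R * z ^+ N) = N.+1%:R * a N.+1 * z ^+ N); last first.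
  by rewrite mul0r add0r mulrCA mulrA.
by apply: has_cderiv_near ltr01 _ => w _; rewrite [in RHS]big_nat_recr.
Qed.

Section WeakValue.
Variables (R : realType) (g : R[i] -> R[i]) (b : nat -> R[i]).
Hypothesis gE : Espace g.
Hypothesis Hb : forall s : R, 0 <= s < 1 ->
  expands (dilate s g) (fun n => (s ^+ n)%:C * b n).

Lemma expands_B0space (h : R[i] -> R[i]) (a : nat -> R[i]) :
  holomorphic h -> expands h a -> B0space h.
Proof.
move=> hh ha.
have [|q [D [qI D0 H _]]] := expands_cderiv ha (h1 := cderive h).
  by move=> z z1; exact: holomorphic_cderiv.
suff [] : B0space h /\ b0 h <= D by [].
apply: (B0space_bound hh D0) => z z1.
by have := H z z1 0%N; rewrite big_geq // subr0 expr0 mulr1.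
Qed.

(** The partial sums of the series converge to [h] geometrically in the seminorm,
   and on polynomials [weak_value] is known. *)
Lemma weak_value_expands (h : R[i] -> R[i]) (a : nat -> R[i]) :
  holomorphic h -> expands h a -> exists q C : R, [/\ 0 <= q < 1, 0 <= C &
    forall N, cmod (weak_value g b h - \sum_(0 <= n < N.+1) a n * b n) <= C * q ^+ N].
Proof.
move=> hh ha; have hB := expands_B0space hh ha.
have [|q [D [qI D0 HD _]]] := expands_cderiv ha (h1 := cderive h).
  by move=> z z1; exact: holomorphic_cderiv.
have [q1 [C [q1I C0 _ HC]]] := ha.
(* one rate for the value at the origin and for the derivative *)
pose Q := Num.max q q1.
have [q_0 q_1] := andP qI; have [q1_0 q1_1] := andP q1I.
have QI : 0 <= Q < 1 by rewrite le_max q_0 gt_max q_1 q1_1.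
have Q0 : 0 <= Q by case/andP: QI.
have p0 : 0 <= 2 / pi :> R by rewrite divr_ge0 ?pi_ge0.
exists Q, (C * cmod (b 0%N) + 2 / pi * (e0 g * D)); split => //.
  by rewrite addr_ge0 // !mulr_ge0 ?cmod_ge0 ?e0_ge0 // invr_ge0 pi_ge0.
move=> N; pose P z := \sum_(0 <= n < N.+1) a n * z ^+ n.
have PB : B0space P := B0space_poly a N.+1.
have [dB _] := B0spaceB hB PB.
have db : b0 (fun z => h z - P z) <= D * q ^+ N.
  have Dq : 0 <= D * q ^+ N by rewrite mulr_ge0 // exprn_ge0.
  suff [] : B0space (fun z => h z - P z) /\ b0 (fun z => h z - P z) <= D * q ^+ N by [].
  apply: (B0space_bound dB.1 Dq) => z z1.
  rewrite (cderiveB hB.1 PB.1 z1) (cderiveE (cderive_poly a N z)).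
  exact: HD.
have hE : h = (fun z => (h z - P z) + P z) by apply/funext => z; rewrite subrK.
have -> : weak_value g b h - \sum_(0 <= n < N.+1) a n * b n = weak_value g b (fun z => h z - P z).
  rewrite {1}hE (weak_valueD b gE dB PB) (weak_value_poly gE Hb a N.+1).
  by rewrite -addrA subrr addr0.
apply: (le_trans (weak_value_bound b gE dB)).
rewrite [leRHS]mulrDl; apply: lerD.
  rewrite mulrAC ler_wpM2r ?cmod_ge0 //.
  have z1 : cmod (0 : R[i]) <= 1 by rewrite cmod0.
  rewrite /P big_mkord; apply: (le_trans (HC 0 z1 N.+1)).
  rewrite ler_wpM2l //; apply: (@le_trans _ _ (q1 ^+ N)).
    by rewrite exprS ler_piMl ?exprn_ge0 // ltW.
  by apply: lerXn2r; rewrite ?nnegrE // le_max lexx orbT.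
rewrite -!mulrA ler_wpM2l // ler_wpM2l ?invr_ge0 ?pi_ge0 // ler_wpM2l ?e0_ge0 //.
apply: (le_trans db); rewrite ler_wpM2l //.
by apply: lerXn2r; rewrite ?nnegrE // le_max lexx.
Qed.

End WeakValue.

(** ** Cauchy products *)

Definition conv (R : realType) (a b : nat -> R[i]) (k : nat) : R[i] :=
  \sum_(0 <= i < k.+1) a i * b (k - i)%N.

Lemma triangle_sum (V : zmodType) (F : nat -> nat -> V) N :
  \sum_(0 <= k < N) \sum_(0 <= i < k.+1) F i (k - i)%N =
  \sum_(0 <= i < N) \sum_(0 <= j < N - i) F i j.
Proof.
elim: N => [|N IH]; first by rewrite !big_geq.
rewrite big_nat_recr //= IH [in RHS]big_nat_recr //= subSnn big_nat1.
rewrite [X in _ + X]big_nat_recr //= subnn addrA -big_split /=; congr (_ + _).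
rewrite !big_nat; apply: eq_bigr => i /andP[_ iN].
by rewrite subSn ?(ltnW iN) // big_nat_recr.
Qed.

(** The square partial sum and the triangular partial sum differ by at most [N^2]
   terms, each of total degree at least [N]. *)
Lemma conv_sum (R : realType) (V : normedModType R[i]) (a b : nat -> R[i])
    (v : nat -> V) (q C M : R) N :
  0 <= q <= 1 -> 0 <= C -> (forall n, cmod (a n) <= C * q ^+ n) ->
  (forall n, cmod (b n) <= C * q ^+ n) -> (forall n, nrm (v n) <= M) ->
  nrm (\sum_(0 <= i < N) \sum_(0 <= j < N) (a i * b j) *: v (i + j)%N -
       \sum_(0 <= k < N) conv a b k *: v k) <= C ^+ 2 * M * (N%:R ^+ 2 * q ^+ N).
Proof.
move=> /andP[q0 q1] C0 aC bC vM.
have M0 : 0 <= M := le_trans (nrm_ge0 _) (vM 0%N).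
have -> : \sum_(0 <= k < N) conv a b k *: v k =
    \sum_(0 <= i < N) \sum_(0 <= j < N - i) (a i * b j) *: v (i + j)%N.
  rewrite -triangle_sum; apply: eq_bigr => k _; rewrite scaler_suml !big_nat.
  by apply: eq_bigr => i /andP[_ ik]; rewrite subnKC.
rewrite -sumrB; apply: (le_trans (nrm_sum _ _ _)).
apply: (@le_trans _ _ (\sum_(0 <= i < N) N%:R * (C ^+ 2 * M * q ^+ N))); last first.
  rewrite sumr_const_nat subn0 -mulr_natl expr2.
  by rewrite le_eqVlt; apply/orP; left; apply/eqP; ring.
rewrite !big_nat; apply: ler_sum => i /andP[_ iN].
rewrite (@big_cat_nat _ _ _ (N - i)%N 0 N) ?leq_subr //= addrAC subrr add0r.
apply: (le_trans (nrm_sum _ _ _)).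
apply: (@le_trans _ _ (\sum_(N - i <= j < N) C ^+ 2 * M * q ^+ N)); last first.
  rewrite sumr_const_nat -[leLHS]mulr_natl ler_wpM2r ?mulr_ge0 ?exprn_ge0 //.
  by rewrite ler_nat leq_subr.
rewrite !big_nat; apply: ler_sum => j /andP[ij jN].
rewrite nrmZ cmodM.
apply: (@le_trans _ _ ((C * q ^+ i) * (C * q ^+ j) * M)).
  by apply: ler_pM; rewrite ?mulr_ge0 ?cmod_ge0 ?nrm_ge0 //; apply: ler_pM; rewrite ?cmod_ge0.
have -> : C * q ^+ i * (C * q ^+ j) * M = C ^+ 2 * M * q ^+ (i + j).
  by rewrite exprD; ring.
rewrite ler_wpM2l ?mulr_ge0 ?exprn_ge0 // ler_wiXn2l //.
by rewrite leq_subLR in ij.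
Qed.

Lemma conv_bound (R : realType) (a b : nat -> R[i]) (q C : R) n :
  0 <= q -> 0 <= C -> (forall n, cmod (a n) <= C * q ^+ n) ->
  (forall n, cmod (b n) <= C * q ^+ n) ->
  cmod (conv a b n) <= C ^+ 2 * (n.+1%:R ^+ 2 * q ^+ n).
Proof.
move=> q0 C0 aC bC; apply: (le_trans (cmod_sum _ _ _)).
apply: (@le_trans _ _ (\sum_(0 <= i < n.+1) C ^+ 2 * q ^+ n)).
  rewrite !big_nat; apply: ler_sum => i /andP[_ ik]; rewrite cmodM.
  apply: (@le_trans _ _ ((C * q ^+ i) * (C * q ^+ (n - i)))).
    by apply: ler_pM; rewrite ?cmod_ge0.
  have -> : C * q ^+ i * (C * q ^+ (n - i)) = C ^+ 2 * (q ^+ i * q ^+ (n - i)) by ring.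
  by rewrite -exprD subnKC.
rewrite sumr_const_nat subn0 -[leLHS]mulr_natl mulrCA ler_wpM2l ?exprn_ge0 //.
by rewrite ler_wpM2r ?exprn_ge0 // -natrX ler_nat expnS expn1 leq_pmulr.
Qed.

Lemma expands_common (R : realType) (f g : R[i] -> R[i]) (a b : nat -> R[i]) :
  expands f a -> expands g b -> exists q C : R, [/\ 0 <= q < 1, 0 <= C,
    forall n, cmod (a n) <= C * q ^+ n, forall n, cmod (b n) <= C * q ^+ n &
    forall z, cmod z <= 1 -> forall N,
      cmod (f z - \sum_(0 <= n < N) a n * z ^+ n) <= C * q ^+ N /\
      cmod (g z - \sum_(0 <= n < N) b n * z ^+ n) <= C * q ^+ N].
Proof.
move=> [q1 [C1 [/andP[q10 q11] C10 a1 f1]]] [q2 [C2 [/andP[q20 q21] C20 b2 g2]]].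
exists (Num.max q1 q2), (Num.max C1 C2).
have le1 n : C1 * q1 ^+ n <= Num.max C1 C2 * Num.max q1 q2 ^+ n.
  apply: ler_pM; rewrite ?exprn_ge0 // ?le_max ?lexx //.
  by apply: lerXn2r; rewrite ?nnegrE ?le_max ?q10 ?lexx.
have le2 n : C2 * q2 ^+ n <= Num.max C1 C2 * Num.max q1 q2 ^+ n.
  apply: ler_pM; rewrite ?exprn_ge0 // ?le_max ?lexx ?orbT //.
  by apply: lerXn2r; rewrite ?nnegrE ?le_max ?q20 ?lexx ?orbT.
split.
- by rewrite le_max q10 gt_max q11 q21.
- by rewrite le_max C10.
- by move=> n; exact: le_trans (a1 n) (le1 n).
- by move=> n; exact: le_trans (b2 n) (le2 n).
move=> z z1 N; rewrite !big_mkord; split.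
  exact: le_trans (f1 z z1 N) (le1 N).
exact: le_trans (g2 z z1 N) (le2 N).
Qed.

Lemma expandsM (R : realType) (f g : R[i] -> R[i]) (a b : nat -> R[i]) :
  expands f a -> expands g b -> expands (fun z => f z * g z) (conv a b).
Proof.
move=> fa gb; have [q [C [qI C0 aC bC fg]]] := expands_common fa gb.
have [q0 q1] := andP qI.
have [q' [D [qI' D0 HD]]] := sqr_geo qI.
have [q'0 q'1] := andP qI'.
have qD n : q ^+ n <= D * q' ^+ n.
  apply: le_trans (HD n); rewrite -[leLHS]mul1r ler_wpM2r ?exprn_ge0 //.
  by rewrite -natrX ler1n expn_gt0.
have C2 : 0 <= C ^+ 2 by rewrite exprn_ge0.
exists q', (4 * C ^+ 2 * D); split => //.
- by rewrite !mulr_ge0.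
- move=> n; apply: (le_trans (conv_bound n q0 C0 aC bC)).
  have -> : 4 * C ^+ 2 * D * q' ^+ n = C ^+ 2 * (D * q' ^+ n) + 3 * (C ^+ 2 * (D * q' ^+ n)) by ring.
  have h : C ^+ 2 * (n.+1%:R ^+ 2 * q ^+ n) <= C ^+ 2 * (D * q' ^+ n) by rewrite ler_wpM2l.
  by apply: (le_trans h); rewrite lerDl !mulr_ge0 // exprn_ge0.
move=> z z1 N; rewrite -(big_mkord xpredT (fun n => conv a b n * z ^+ n)).
have [fN gN] := fg z z1 N; have [f0 g0] := fg z z1 0%N.
set P := \sum_(0 <= n < N) a n * z ^+ n in fN *.
set Q := \sum_(0 <= n < N) b n * z ^+ n in gN *.
have PQ : P * Q = \sum_(0 <= i < N) \sum_(0 <= j < N) (a i * b j) * z ^+ (i + j).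
  rewrite /P mulr_suml; apply: eq_bigr => i _; rewrite /Q mulr_sumr.
  by apply: eq_bigr => j _; rewrite exprD; ring.
have zM n : nrm (z ^+ n : R[i]^o) <= 1 by rewrite -/(cmod _) cmodX exprn_ile1 ?cmod_ge0.
have qI1 : 0 <= q <= 1 by rewrite q0 ltW.
have := @conv_sum R (R[i]^o : normedModType R[i]) a b (fun n => z ^+ n) q C 1 N qI1 C0 aC bC zM.
rewrite -/(cmod _) mulr1 => hc.
rewrite !big_geq // !subr0 expr0 mulr1 in f0 g0.
have -> : f z * g z - \sum_(0 <= n < N) conv a b n * z ^+ n =
   (f z - P) * g z + (- (f z - P) + f z) * (g z - Q) +
   (P * Q - \sum_(0 <= n < N) conv a b n * z ^+ n).
  by move: (f z) (g z) P Q (\sum_(0 <= n < N) _) {PQ fN gN f0 g0 hc} => *; ring.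
have qN0 : 0 <= q ^+ N by rewrite exprn_ge0.
have h3 : cmod (P * Q - \sum_(0 <= n < N) conv a b n * z ^+ n) <= C ^+ 2 * (D * q' ^+ N).
  rewrite PQ; apply: (le_trans hc); rewrite ler_wpM2l //; apply: le_trans (HD N).
  rewrite ler_wpM2r //; apply: lerXn2r; rewrite ?nnegrE //.
  by rewrite ler_nat.
have h1 : cmod ((f z - P) * g z) <= C ^+ 2 * (D * q' ^+ N).
  rewrite cmodM; apply: (@le_trans _ _ ((C * q ^+ N) * C)).
    by apply: ler_pM; rewrite ?cmod_ge0.
  by rewrite mulrAC -expr2 ler_wpM2l.
have h2 : cmod ((- (f z - P) + f z) * (g z - Q)) <= 2 * (C ^+ 2 * (D * q' ^+ N)).
  rewrite cmodM; apply: (@le_trans _ _ ((C + C) * (C * q ^+ N))).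
    apply: ler_pM; rewrite ?cmod_ge0 //; apply: cmodD_le => //; rewrite cmodN.
    by apply: (le_trans fN); rewrite -[leRHS]mulr1 ler_wpM2l // exprn_ile1 // ltW.
  have -> : (C + C) * (C * q ^+ N) = 2 * (C ^+ 2 * q ^+ N) by ring.
  by rewrite ler_wpM2l // ler_wpM2l.
apply: (le_trans (cmodD_le (cmodD_le h1 h2) h3)).
by rewrite le_eqVlt; apply/orP; left; apply/eqP; ring.
Qed.

(** * The calculus *)

Section CalculusEstimates.
Variables (R : realType) (X : completeNormedModType R[i]) (T : {linear X -> X}).
Variable K : R.
Hypotheses (TK : powers_bounded_by T K) (Tb : bounded_op X X T) (TG : dGSF T).

Lemma weak_calculusD f g x xs : B0space f -> B0space g -> dual X xs ->
  weak_calculus T (fun z => f z + g z) x xs =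
  weak_calculus T f x xs + weak_calculus T g x xs.
Proof.
by move=> fB gB xd; exact: (weak_valueD (fun n => xs (iter n T x)) (TG x xd) fB gB).
Qed.

Lemma weak_calculusZ a f x xs : B0space f -> dual X xs ->
  weak_calculus T (fun z => a * f z) x xs = a * weak_calculus T f x xs.
Proof.
by move=> fB xd; exact: (weak_valueZ (fun n => xs (iter n T x)) (TG x xd) a fB).
Qed.

Lemma weak_calculusB f g x xs : B0space f -> B0space g -> dual X xs ->
  weak_calculus T (fun z => f z - g z) x xs =
  weak_calculus T f x xs - weak_calculus T g x xs.
Proof.
move=> fB gB xd; have [nB _] := B0spaceZ (-1) gB.
rewrite (_ : (fun z => f z - g z) = (fun z => f z + -1 * g z)).
  by rewrite (weak_calculusD x fB nB xd) (weak_calculusZ (-1) x gB xd) mulN1r.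
by apply/funext => z; rewrite mulN1r.
Qed.

Lemma weak_calculus_bound f x xs : B0space f -> dual X xs ->
  cmod (weak_calculus T f x xs) <=
  cmod (f 0) * cmod (xs x) + 2 / pi * (e0 (gfun T x xs) * b0 f).
Proof.
by move=> fB xd; exact: (weak_value_bound (fun n => xs (iter n T x)) (TG x xd) fB).
Qed.

Lemma representsZ a f S : B0space f -> represents T f S ->
  exists2 S', represents T (fun z => a * f z) S' & forall x, S' x = a *: S x.
Proof.
move=> fB [Sb SE].
have [|S' S'E] := @exists_linear R X X (fun x => a *: S x).
  by move=> c x y; rewrite linearP scalerDr !scalerA mulrC.
exists S'; [split|exact: S'E].
  have [k k0 Hk] := (bounded_opP _).1 Sb.
  apply/bounded_opP; exists (cmod a * k); first by rewrite mulr_ge0 ?cmod_ge0.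
  by move=> x; rewrite S'E nrmZ -mulrA ler_wpM2l ?cmod_ge0.
move=> x xs xd.
by rewrite S'E linearZ /= (SE x xs xd) (weak_calculusZ a x fB xd).
Qed.

Lemma representsB f g S U : B0space f -> B0space g ->
  represents T f S -> represents T g U ->
  exists2 V, represents T (fun z => f z - g z) V & forall x, V x = S x - U x.
Proof.
move=> fB gB [Sb SE] [Ub UE].
have [|V VE] := @exists_linear R X X (fun x => S x - U x).
  by move=> c x y; rewrite (linearP S) (linearP U) scalerBr opprD addrACA.
exists V; [split|exact: VE].
  have [k k0 Hk] := (bounded_opP _).1 Sb.
  have [l l0 Hl] := (bounded_opP _).1 Ub.
  apply/bounded_opP; exists (k + l); first by rewrite addr_ge0.
  move=> x; rewrite VE [leRHS]mulrDl; apply: nrmD_le => //; by rewrite nrmN.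
move=> x xs xd.
by rewrite VE linearB /= (SE x xs xd) (UE x xs xd) (weak_calculusB x fB gB xd).
Qed.

(** The constant comes from the uniform boundedness principle, since each
   scalar [xs (S x)] is controlled by the duality estimate. *)
Lemma represents_bound : exists2 K1 : R, 0 <= K1 & forall f S, B0space f ->
  represents T f S -> forall x, nrm (S x) <= K1 * (cmod (f 0) + b0 f) * nrm x.
Proof.
pose I := {p : (R[i] -> R[i]) * {linear X -> X} |
  [/\ B0space p.1, cmod (p.1 0) <= 1, b0 p.1 <= 1 & represents T p.1 p.2]}.
have [||K1 K10 HK] := @weakly_bounded R X I (fun i => (sval i).2).
- by move=> [[f S] /= [_ _ _ []]].
- move=> x xs xd; exists (cmod (xs x) + 2 / pi * e0 (gfun T x xs)).
  move=> [[f S] /= [fB f1 f2 [_ SE]]]; rewrite (SE x xs xd).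
  apply: (le_trans (weak_calculus_bound x fB xd)); apply: lerD.
    by rewrite ler_piMl ?cmod_ge0.
  rewrite ler_wpM2l ?divr_ge0 ?pi_ge0 //.
  by rewrite -[leRHS]mulr1 ler_wpM2l ?e0_ge0.
exists K1 => // f S fB fS x.
(* [f] is normalized by an upper bound [c > 0], since its own norm may vanish *)
suff H c : 0 < c -> cmod (f 0) + b0 f <= c -> nrm (S x) <= K1 * c * nrm x.
  apply/ler_addgt0Pl => e e0.
  have M0 : 0 <= K1 * nrm x by rewrite mulr_ge0 ?nrm_ge0.
  pose d := e / (K1 * nrm x + 1).
  have d0 : 0 < d by rewrite divr_gt0 // ltr_wpDl.
  have fb : 0 <= cmod (f 0) + b0 f by rewrite addr_ge0 ?cmod_ge0 ?b0_ge0.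
  have := H (cmod (f 0) + b0 f + d) (ltr_wpDl fb d0).
  rewrite lerDl (ltW d0) => /(_ isT) h; apply: (le_trans h).
  have -> (A k n : R) : k * (A + d) * n = k * n * d + k * A * n by ring.
  rewrite lerD2r /d mulrCA -[leRHS]mulr1 ler_wpM2l ?(ltW e0) //.
  by rewrite ler_pdivrMr ?mul1r ?lerDl // ltr_wpDl.
move=> c0 fc; have cN0 : c != 0 by rewrite gt_eqF.
have ci : cmod (c^-1)%:C = c^-1 by rewrite cmodR ger0_norm // invr_ge0 ltW.
have [S' S'r S'E] := representsZ (c^-1)%:C fB fS.
have [f'B f'b] := B0spaceZ (c^-1)%:C fB.
have p1 : cmod ((c^-1)%:C * f 0) <= 1.
  rewrite cmodM ci mulrC ler_pdivrMr // mul1r; apply: le_trans fc.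
  by rewrite lerDl b0_ge0.
have p2 : b0 (fun z => (c^-1)%:C * f z) <= 1.
  apply: (le_trans f'b); rewrite ci mulrC ler_pdivrMr // mul1r; apply: le_trans fc.
  by rewrite lerDr cmod_ge0.
have := HK (exist _ (fun z => (c^-1)%:C * f z, S') (And4 f'B p1 p2 S'r)) x.
by rewrite /= S'E nrmZ ci mulrC ler_pdivrMr // mulrAC.
Qed.

(** Both sides are limits of the same sums [sum_(n < N) a_n xs (T^n x)], one by the
   duality estimate and the other in operator norm. *)
Lemma sum_represents h a S : holomorphic h -> expands h a -> sums_to T a S ->
  represents T h S.
Proof.
move=> hh ha Sa; split; first exact: sums_to_bounded Sa.
move=> x xs xd.
have [q [C [qI C0 HC]]] := weak_value_expands (TG x xd) (gfun_expands x TK Tb xd) hh ha.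
have [q1 [M [q1I M0 HM]]] := Sa.
have [F F0 HF] := (bounded_opP _).1 xd.
have [q_0 q_1] := andP qI; have [q1_0 q1_1] := andP q1I.
apply/eqP; rewrite -subr_eq0; apply/eqP/cmod_eq0/eqP.
rewrite eq_le cmod_ge0 andbT.
have QI : 0 <= Num.max q q1 < 1 by rewrite le_max q_0 gt_max q_1 q1_1.
apply: (@geometric_le0 _ (Num.max q q1) (F * (M * nrm x) + C) _ QI) => N.
have E : \sum_(0 <= n < N.+1) a n * xs (iter n T x) = xs (opsum T a N.+1 x).
  by rewrite /opsum linear_sum; apply: eq_bigr => n _; rewrite linearZ.
rewrite -(subrK (xs (opsum T a N.+1 x)) (xs (S x))) -addrA [leRHS]mulrDl.
apply: cmodD_le.
  rewrite cmodB -(linearB xs) -mulrA.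
  apply: (le_trans (HF _)); rewrite ler_wpM2l //.
  apply: (le_trans (HM _ _)); rewrite ler_wpM2l ?mulr_ge0 ?nrm_ge0 //.
  apply: (@le_trans _ _ (q1 ^+ N)); first by rewrite exprS ler_piMl ?exprn_ge0 // ltW.
  by apply: lerXn2r; rewrite ?nnegrE ?le_max ?q_0 ?lexx ?orbT.
rewrite -E cmodB; apply: (le_trans (HC N)); rewrite ler_wpM2l //.
by apply: lerXn2r; rewrite ?nnegrE ?le_max ?q_0 ?lexx ?orbT.
Qed.

Lemma dilate_represents f n : holomorphic f ->
  exists a S, [/\ expands (dilate (rho R n) f) a, sums_to T a S &
    represents T (dilate (rho R n) f) S].
Proof.
move=> hf; have rI := rho_itvW R n.
have [a ha] := dilate_expands hf rI.
have [q [C [qI C0 aC _]]] := ha.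
have [S HS] := sums_to_ex TK qI C0 aC.
exists a, S; split => //; apply: (sum_represents _ ha HS).
exact: dilate_holomorphic.
Qed.

Lemma dilate0 (f : R[i] -> R[i]) r : dilate r f 0 = f 0.
Proof. by rewrite /dilate mulr0. Qed.

End CalculusEstimates.

Section DilationLimits.
Variables (R : realType) (X : completeNormedModType R[i]) (T : {linear X -> X}).
Variable K : R.
Hypotheses (TK : powers_bounded_by T K) (Tb : bounded_op X X T) (TG : dGSF T).

Lemma b0_dilate_near (f : R[i] -> R[i]) (e : R) : B0space f -> 0 < e ->
  \forall n \near \oo, b0 (fun z => f z - dilate (rho R n) f z) <= e.
Proof.
move=> fB e0; have /cvgrPdist_le /(_ e e0) := b0_dilate_cvg fB.
apply: filterS => n; move: (b0 _) (b0_ge0 (fun z => f z - dilate (rho R n) f z)) => b b_0.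
by rewrite sub0r normrN ger0_norm.
Qed.

Lemma B0space_dilate_diff (f : R[i] -> R[i]) n : B0space f ->
  B0space (fun z => f z - dilate (rho R n) f z).
Proof.
move=> fB; have [gB _] := B0space_dilate fB (rho_itv R n).
exact: (B0spaceB fB gB).1.
Qed.

Lemma b0_dilate_dist (f : R[i] -> R[i]) n m : B0space f ->
  b0 (fun z => dilate (rho R n) f z - dilate (rho R m) f z) <=
  b0 (fun z => f z - dilate (rho R m) f z) + b0 (fun z => f z - dilate (rho R n) f z).
Proof.
move=> fB; have [_ h] := B0spaceB (B0space_dilate_diff m fB) (B0space_dilate_diff n fB).
rewrite (_ : (fun z => dilate (rho R n) f z - dilate (rho R m) f z) =
  (fun z => f z - dilate (rho R m) f z - (f z - dilate (rho R n) f z))); first exact: h.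
apply/funext => z.
by rewrite opprB [RHS]addrC addrA subrK.
Qed.

(** By [represents_bound], the operators [f_rho(T)] are Cauchy along a sequence of
   dilations that converges to [f] fast enough; the weak formula passes to the
   limit by the duality estimate. *)
Lemma calculus_ex f : B0space f -> exists S, represents T f S.
Proof.
move=> fB; have [K1 K10 HK] := represents_bound TG.
pose e n := b0 (fun z => f z - dilate (rho R n) f z).
(* a subsequence with geometric rate, as required for completeness *)
have /choice[phi Hphi] : forall k, exists n, e n <= 3^-1 ^+ k.
  move=> k; have k0 : 0 < (3^-1 : R) ^+ k by rewrite exprn_gt0 // invr_gt0.
  by have [n _ /(_ n (leqnn n))] := b0_dilate_near fB k0; exists n.
have /choice[S HS] : forall k, exists S, represents T (dilate (rho R (phi k)) f) S.
  move=> k; by have [a [S [_ _ SR]]] := dilate_represents TK Tb TG (phi k) fB.1; exists S.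
have third01 : 0 <= (3^-1 : R) <= 1 by have /andP[-> /ltW ->] := third_itv R.
have ephi k m : e (phi (k + m)%N) <= 3^-1 ^+ k.
  apply: (le_trans (Hphi _)).
  by apply: ler_wiXn2l; [case/andP: third01|case/andP: third01|rewrite leq_addr].
have dB n : B0space (dilate (rho R n) f) by have [] := B0space_dilate fB (rho_itv R n).
have SC x k m : nrm (S (k + m)%N x - S k x) <= 2 * K1 * nrm x * 3^-1 ^+ k.
  have [V VR VE] := representsB TG (dB _) (dB _) (HS (k + m)%N) (HS k).
  rewrite -VE; have [VB _] := B0spaceB (dB (phi (k + m)%N)) (dB (phi k)).
  apply: (le_trans (HK _ _ VB VR x)).
  rewrite !dilate0 subrr cmod0 add0r [leRHS]mulrAC.
  rewrite ler_wpM2r ?nrm_ge0 // -mulrA mulrCA ler_wpM2l //.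
  apply: (le_trans (b0_dilate_dist _ _ fB)).
  rewrite mulr_natl mulr2n; apply: lerD; [exact: Hphi|exact: ephi].
have lim x : exists l, forall k, nrm (S k x - l) <= 2 * K1 * nrm x * 3^-1 ^+ k.
  apply: complete_seq; first exact: SC.
  by move=> d d0; exact: geometric_small (third_itv R) d0.
have [s sP] := choice lim.
have [S' S'E] : exists S' : {linear X -> X}, S' =1 s.
  apply: exists_linear => c x y; apply/eqP; rewrite -subr_eq0; apply/eqP/nrm_eq0/eqP.
  rewrite eq_le nrm_ge0 andbT; pose B := 2 * K1.
  apply: (@geometric_le0 _ 3^-1 (B * nrm (c *: x + y) + (cmod c * (B * nrm x) + B * nrm y)) _
    (third_itv R)) => k.
  apply: (le_trans (nrmBD (S k (c *: x + y)) _ _)).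
  rewrite [leRHS]mulrDl; apply: lerD; first by rewrite nrmB; exact: sP.
  rewrite linearP opprD addrACA -scalerBr [leRHS]mulrDl; apply: nrmD_le; last exact: sP.
  by rewrite nrmZ -mulrA ler_wpM2l ?cmod_ge0 //; exact: sP.
exists S'; split.
  have [l l0 Hl] := (bounded_opP _).1 (HS 0%N).1.
  apply/bounded_opP; exists (2 * K1 + l); first by rewrite addr_ge0 ?mulr_ge0.
  move=> x; rewrite S'E -(subrK (S 0%N x) (s x)) [leRHS]mulrDl; apply: nrmD_le; last exact: Hl.
  by have := sP x 0%N; rewrite expr0 mulr1 nrmB.
move=> x xs xd; rewrite S'E.
apply/eqP; rewrite -subr_eq0; apply/eqP/cmod_eq0/eqP.
rewrite eq_le cmod_ge0 andbT.
have [F F0 HF] := (bounded_opP _).1 xd.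
pose G := 2 / pi * e0 (gfun T x xs).
apply: (@geometric_le0 _ 3^-1 (F * (2 * K1 * nrm x) + G) _ (third_itv R)) => k.
rewrite -(subrK (xs (S k x)) (xs (s x))) -addrA [leRHS]mulrDl.
apply: cmodD_le.
  rewrite cmodB -(linearB xs) -mulrA.
  by apply: (le_trans (HF _)); rewrite ler_wpM2l //; exact: sP.
rewrite ((HS k).2 x xs xd) cmodB -(weak_calculusB TG x fB (dB _) xd).
apply: (le_trans (weak_calculus_bound TG x (B0space_dilate_diff _ fB) xd)).
rewrite dilate0 subrr cmod0 mul0r add0r /G -!mulrA.
rewrite ler_wpM2l // ler_wpM2l ?invr_ge0 ?pi_ge0 // ler_wpM2l ?e0_ge0 //.
exact: Hphi.
Qed.

Lemma fcalc_represents f : B0space f -> represents T f (fcalc T f).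
Proof. by move=> fB; have [S SR] := calculus_ex fB; exact: getPex (ex_intro _ S SR). Qed.

(** ** Products *)

Lemma opsum_comp (a b : nat -> R[i]) N x : opsum T a N (opsum T b N x) =
  \sum_(0 <= i < N) \sum_(0 <= j < N) (a i * b j) *: iter (i + j) T x.
Proof.
rewrite /opsum; apply: eq_bigr => i _.
have [I IE] := exists_linear (iter_linear T i).
rewrite -IE linear_sum scaler_sumr; apply: eq_bigr => j _.
by rewrite linearZ /= scalerA IE iterD.
Qed.

(** The triangular partial sums of the product series are compared with the
   composition of the partial sums, which converges to the composition. *)
Lemma sums_to_conv (a b : nat -> R[i]) (S U V : {linear X -> X}) (q C : R) :
  0 <= q < 1 -> 0 <= C -> (forall n, cmod (a n) <= C * q ^+ n) ->
  (forall n, cmod (b n) <= C * q ^+ n) ->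
  sums_to T a S -> sums_to T b U -> sums_to T (conv a b) V ->
  forall x, V x = S (U x).
Proof.
move=> qI C0 aC bC [qa [A [qaI A0 HA]]] [qb [B [qbI B0 HB]]] [qv [M [qvI M0 HM]]] x.
have [q' [D [q'I D0 HD]]] := sqr_geo qI.
have [K0 HK] := TK.
have [q0 q1] := andP qI; have [qa0 qa1] := andP qaI; have [qb0 qb1] := andP qbI.
have [qv0 qv1] := andP qvI; have [q'0 q'1] := andP q'I.
pose Q := Num.max (Num.max qa qb) (Num.max qv q').
have QI : 0 <= Q < 1.
  by rewrite !le_max qa0 !gt_max qa1 qb1 qv1 q'1.
have Qle p N : 0 <= p -> p <= Q -> p ^+ N <= Q ^+ N.
  by move=> p0 pQ; apply: lerXn2r; rewrite ?nnegrE //; exact: le_trans p0 pQ.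
have SA := opser_bound HA; have n0 := nrm_ge0 x.
apply/eqP; rewrite -subr_eq0; apply/eqP/nrm_eq0/eqP.
rewrite eq_le nrm_ge0 andbT.
apply: (@geometric_le0 _ Q (M * nrm x + (C ^+ 2 * (K * nrm x) * D +
  ((A * (B * nrm x) + A * (B * nrm x)) + A * nrm (U x)))) _ QI) => N.
apply: (le_trans (nrmBD (opsum T (conv a b) N x) _ _)).
rewrite [leRHS]mulrDl; apply: lerD.
  rewrite nrmB; apply: (le_trans (HM N x)); rewrite ler_wpM2l ?mulr_ge0 //.
  by apply: Qle => //; rewrite !le_max lexx !orbT.
apply: (le_trans (nrmBD (opsum T a N (opsum T b N x)) _ _)).
rewrite [leRHS]mulrDl; apply: lerD.
  rewrite nrmB opsum_comp.
  have q01 : 0 <= q <= 1 by rewrite q0 ltW.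
  apply: (le_trans (@conv_sum R X a b (fun n => iter n T x) q C (K * nrm x) N q01 C0 aC bC (fun n => HK n x))).
  rewrite -[leRHS]mulrA ler_wpM2l ?mulr_ge0 ?exprn_ge0 //.
  apply: (@le_trans _ _ (D * q' ^+ N)); last first.
    by rewrite ler_wpM2l //; apply: Qle => //; rewrite !le_max lexx !orbT.
  apply: le_trans (HD N); rewrite ler_wpM2r ?exprn_ge0 //.
  by apply: lerXn2r; rewrite ?nnegrE // ler_nat.
have h1 : nrm (opsum T b N x - U x) <= B * nrm x * Q ^+ N.
  apply: (le_trans (HB N x)); rewrite ler_wpM2l ?mulr_ge0 //.
  by apply: Qle => //; rewrite !le_max lexx !orbT.
have h2 y : nrm (opsum T a N y) <= A * nrm y + A * nrm y.
  rewrite -(subrK (S y) (opsum T a N y)); apply: nrmD_le; last exact: SA.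
  apply: (le_trans (HA N y)); rewrite ler_piMr ?mulr_ge0 ?nrm_ge0 //.
  by apply: exprn_ile1 => //; exact: ltW.
apply: (le_trans (nrmBD (opsum T a N (U x)) _ _)).
rewrite [leRHS]mulrDl; apply: lerD.
  have -> : opsum T a N (opsum T b N x) - opsum T a N (U x) = opsum T a N (opsum T b N x - U x).
    by have [L LE] := exists_linear (opsum_linear T a N); rewrite -!LE linearB.
  apply: (le_trans (h2 _)); rewrite [leRHS]mulrDl.
  by apply: lerD; rewrite -[leRHS]mulrA ler_wpM2l.
apply: (le_trans (HA N _)); rewrite ler_wpM2l ?mulr_ge0 ?nrm_ge0 //.
by apply: Qle => //; rewrite !le_max lexx.
Qed.
End DilationLimits.

Section Multiplicativity.
Variables (R : realType) (X : completeNormedModType R[i]) (T : {linear X -> X}).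
Variable K : R.
Hypotheses (TK : powers_bounded_by T K) (Tb : bounded_op X X T) (TG : dGSF T).

Lemma dilate_product n (f g : R[i] -> R[i]) : holomorphic f -> holomorphic g ->
  exists S U V, [/\ represents T (dilate (rho R n) f) S,
    represents T (dilate (rho R n) g) U,
    represents T (dilate (rho R n) (fun z => f z * g z)) V &
    forall x, V x = S (U x)].
Proof.
move=> hf hg.
have [a [S [fa Sa SR]]] := dilate_represents TK Tb TG n hf.
have [b [U [gb Ub UR]]] := dilate_represents TK Tb TG n hg.
have [q [C [qI C0 aC bC _]]] := expands_common fa gb.
have ab := expandsM fa gb.
have [q' [C' [q'I C'0 abC _]]] := ab.
have [V HV] := sums_to_ex TK q'I C'0 abC.
have rI := rho_itvW R n.
have hd := holomorphicM (dilate_holomorphic hf rI) (dilate_holomorphic hg rI).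
have VR := sum_represents TK Tb TG hd ab HV.
have VE := sums_to_conv TK qI C0 aC bC Sa Ub HV.
by exists S, U, V; exact: (And4 SR UR VR VE).
Qed.

(** The identity holds for the dilations, and by [represents_bound] all the
   errors are controlled by the seminorms of [f - f_rho], [g - g_rho] and
   [f g - (f g)_rho]. *)
Lemma fcalcM (f g : R[i] -> R[i]) : B0space f -> B0space g ->
  B0space (fun z => f z * g z) ->
  forall x, fcalc T (fun z => f z * g z) x = fcalc T f (fcalc T g x).
Proof.
move=> fB gB; set h := fun z => f z * g z => hB x.
have [K1 K10 HK] := represents_bound TG.
have approx u S n y : B0space u -> represents T (dilate (rho R n) u) S ->
    nrm (fcalc T u y - S y) <= K1 * b0 (fun z => u z - dilate (rho R n) u z) * nrm y.
  move=> uB uS; have [dB _] := B0space_dilate uB (rho_itv R n).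
  have [V VR VE] := representsB TG uB dB (fcalc_represents TK Tb TG uB) uS.
  rewrite -VE; have := HK _ V (B0space_dilate_diff n uB) VR y.
  by rewrite dilate0 subrr cmod0 add0r.
have [kf kf0 Hf] := (bounded_opP _).1 (fcalc_represents TK Tb TG fB).1.
pose c := K1 * (cmod (g 0) + b0 g) * nrm x.
have c0 : 0 <= c by rewrite !mulr_ge0 ?addr_ge0 ?cmod_ge0 ?b0_ge0 ?nrm_ge0.
apply/eqP; rewrite -subr_eq0; apply/eqP/nrm_eq0/eqP.
rewrite eq_le nrm_ge0 andbT.
apply: (@geometric_le0 _ 3^-1 (K1 * nrm x + (K1 * c + kf * (K1 * nrm x))) _ (third_itv R)) => k.
have e0 : 0 < (3^-1 : R) ^+ k by rewrite exprn_gt0 // invr_gt0.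
near \oo => n.
have ef : b0 (fun z => f z - dilate (rho R n) f z) <= 3^-1 ^+ k.
  by near: n; exact: b0_dilate_near.
have eg : b0 (fun z => g z - dilate (rho R n) g z) <= 3^-1 ^+ k.
  by near: n; exact: b0_dilate_near.
have eh : b0 (fun z => h z - dilate (rho R n) h z) <= 3^-1 ^+ k.
  by near: n; exact: b0_dilate_near.
have [S [U [V [SR UR VR VE]]]] := dilate_product n fB.1 gB.1.
have le_e (b : R) (y : X) : b <= 3^-1 ^+ k -> K1 * b * nrm y <= K1 * nrm y * 3^-1 ^+ k.
  by move=> be; rewrite [leRHS]mulrAC ler_wpM2r ?nrm_ge0 // ler_wpM2l.
apply: (le_trans (nrmBD (V x) _ _)); rewrite [leRHS]mulrDl; apply: lerD.
  by apply: (le_trans (approx h V n x hB VR)); exact: le_e.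
rewrite VE; apply: (le_trans (nrmBD (fcalc T f (U x)) _ _)).
rewrite [leRHS]mulrDl; apply: lerD.
  rewrite nrmB; apply: (le_trans (approx f S n _ fB SR)).
  apply: (le_trans (le_e _ (U x) ef)); rewrite ler_wpM2r ?(ltW e0) // ler_wpM2l //.
  have [gnB gnb] := B0space_dilate gB (rho_itv R n).
  apply: (le_trans (HK _ U gnB UR x)); rewrite ler_wpM2r ?nrm_ge0 // ler_wpM2l //.
  by rewrite dilate0 lerD2l.
rewrite -linearB; apply: (le_trans (Hf _)); rewrite -mulrA ler_wpM2l //.
rewrite nrmB; apply: (le_trans (approx g U n _ gB UR)); exact: le_e.
Unshelve. all: by end_near.
Qed.

End Multiplicativity.

(** * The algebra of functions *)

Lemma disc0 (R : realType) : disc (0 : R[i]).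
Proof. by rewrite /disc /= cmod0. Qed.

Lemma supnorm_ge0 (R : realType) (f : R[i] -> R[i]) : (0 <= supnorm f)%E.
Proof.
apply: (@le_trans _ _ (cmod (f 0))%:E); first by rewrite lee_fin cmod_ge0.
by apply: ereal_sup_ubound; exists 0 => //; exact: disc0.
Qed.

Lemma BspaceP (R : realType) (f : R[i] -> R[i]) : Bspace f <->
  B0space f /\ exists2 s : R, 0 <= s & forall z, disc z -> cmod (f z) <= s.
Proof.
split=> [[hf fB fs]|[[hf fB] [s s0 H]]].
  split => //; exists (fine (supnorm f)); first by rewrite fine_ge0 // supnorm_ge0.
  move=> z zd; rewrite -lee_fin fineK ?ge0_fin_numE ?supnorm_ge0 //.
  by apply: ereal_sup_ubound; exists z.
split => //; apply: le_lt_trans (ltry s).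
by apply: ge_ereal_sup => _ [z zd <-]; rewrite lee_fin; exact: H.
Qed.

Lemma BspaceD (R : realType) (f g : R[i] -> R[i]) :
  Bspace f -> Bspace g -> Bspace (fun z => f z + g z).
Proof.
move=> /BspaceP[fB [s s0 Hs]] /BspaceP[gB [t t0 Ht]]; apply/BspaceP; split.
  by have [] := B0spaceD fB gB.
exists (s + t); first by rewrite addr_ge0.
by move=> z zd; apply: cmodD_le; [exact: Hs|exact: Ht].
Qed.

Lemma BspaceZ (R : realType) (a : R[i]) (f : R[i] -> R[i]) :
  Bspace f -> Bspace (fun z => a * f z).
Proof.
move=> /BspaceP[fB [s s0 Hs]]; apply/BspaceP; split; first by have [] := B0spaceZ a fB.
exists (cmod a * s); first by rewrite mulr_ge0 ?cmod_ge0.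
by move=> z zd; rewrite cmodM ler_wpM2l ?cmod_ge0 ?Hs.
Qed.

(** [|(f g)'| <= |f'| |g| + |f| |g'|], where the functions without derivative are
   bounded by their suprema. *)
Lemma BspaceM (R : realType) (f g : R[i] -> R[i]) :
  Bspace f -> Bspace g -> Bspace (fun z => f z * g z).
Proof.
move=> /BspaceP[fB [s s0 Hs]] /BspaceP[gB [t t0 Ht]]; apply/BspaceP; split; last first.
  exists (s * t); first by rewrite mulr_ge0.
  by move=> z zd; rewrite cmodM; apply: ler_pM; rewrite ?cmod_ge0 ?Hs ?Ht.
have hM := holomorphicM fB.1 gB.1.
suff H r : 0 < r < 1 -> cmax (fun z => f z * g z) r <= t * cmax f r + s * cmax g r.
  by have [hB _] := B0space_le2 fB gB hM t0 s0 H.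
move=> rI; apply: (cmax_le hM rI) => u uI; have pd := disc_polar u rI.
rewrite (cderiveM fB.1 gB.1 pd); apply: cmodD_le; rewrite cmodM.
  by rewrite mulrC; apply: ler_pM; rewrite ?cmod_ge0 ?Ht //; exact: cmax_ub fB.1 rI uI.
by apply: ler_pM; rewrite ?cmod_ge0 ?Hs //; exact: cmax_ub gB.1 rI uI.
Qed.

Lemma Bspace_cst (R : realType) (c : R[i]) : Bspace (fun=> c).
Proof.
apply/BspaceP; split; first by have [] := B0space_cst c.
by exists (cmod c) => // ; exact: cmod_ge0.
Qed.

Lemma Bspace_id (R : realType) : Bspace (fun z : R[i] => z).
Proof.
apply/BspaceP; split; first exact: (B0space_monomial R 1).
by exists 1 => // z /ltW.
Qed.

Lemma BnormE (R : realType) (f : R[i] -> R[i]) : Bspace f ->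
  exists2 s, Bnorm f = (s + b0 f)%:E & cmod (f 0) <= s.
Proof.
move=> fB; have [_ _ fs] := fB; exists (fine (supnorm f)).
  rewrite /Bnorm (b0E (B0space_Bspace fB)) EFinD fineK //.
  by rewrite ge0_fin_numE ?supnorm_ge0.
rewrite -lee_fin fineK ?ge0_fin_numE ?supnorm_ge0 //.
by apply: ereal_sup_ubound; exists 0 => //; exact: disc0.
Qed.

(** * Norm of the calculus *)

Section FinalEstimate.
Variables (R : realType) (X : completeNormedModType R[i]) (T : {linear X -> X}).
Variable K : R.
Hypotheses (TK : powers_bounded_by T K) (Tb : bounded_op X X T) (TG : dGSF T).

Lemma fcalcE f x xs : B0space f -> dual X xs ->
  xs (fcalc T f x) = weak_calculus T f x xs.
Proof. by move=> fB; exact: (fcalc_represents TK Tb TG fB).2. Qed.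

(** The derivative of [gfun T x xs] is the function in the definition of [gamma].
   Since [gamma] may be negative, for instance on the trivial space, it is
   replaced with [Num.max 0 gamma]. *)
Lemma e0_gfun_le gamma x xs : dGSF_constant T gamma -> dual X xs ->
  (forall y, cmod (xs y) <= nrm y) -> e0 (gfun T x xs) <= Num.max 0 gamma * nrm x.
Proof.
move=> Hg xd xs1; have := Hg x xs xd.
have o1 : (opnorm xs <= 1%:E)%E.
  by apply: opnorm_le => // y; rewrite mul1r; exact: xs1.
have of_ : opnorm xs \is a fin_num.
  by rewrite ge0_fin_numE ?opnorm_ge0 //; apply: le_lt_trans o1 (ltry _).
rewrite -(fineK of_) lee_fin in o1 *.
have o0 : 0 <= fine (opnorm xs) by rewrite fine_ge0 // opnorm_ge0.
rewrite -!EFinM => h; rewrite -lee_fin -(e0E (TG x xd)).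
have -> : E0norm (gfun T x xs) = ereal_sup [set (1 - r)%R%:E *
      \int[lebesgue_measure]_(t in @angles R)
        (cmod (xs (T (resolvent T (polar r t)
                     (resolvent T (polar r t) x)))))%:E
    | r in @radii R]%E.
  rewrite /E0norm; congr ereal_sup; apply: eq_imagel => r /radiiP rI.
  congr (_ * _)%E; apply: eq_integral => t _.
  by rewrite (cderiveE (gfun_cderiv x TK Tb xd (disc_polar t rI))).
apply: (le_trans h); rewrite lee_fin.
have n0 := nrm_ge0 x.
apply: (@le_trans _ _ (Num.max 0 gamma * nrm x * fine (opnorm xs))).
  by rewrite -!mulrA ler_wpM2r ?mulr_ge0 // le_max lexx orbT.
by rewrite ler_piMr // mulr_ge0 // le_max lexx.
Qed.

Lemma fcalc_opnorm gamma f : dGSF_constant T gamma -> Bspace f ->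
  (opnorm (fcalc T f) <= (Num.max 1 (2 * gamma / pi))%:E * Bnorm f)%E.
Proof.
move=> Hg fB; have fB0 := B0space_Bspace fB.
have [s -> fs] := BnormE fB; rewrite -EFinM.
have s0 : 0 <= s := le_trans (cmod_ge0 _) fs.
set M := Num.max 1 _.
have M1 : 1 <= M by rewrite le_max lexx.
have M0 : 0 <= M := le_trans ler01 M1.
have bf0 := b0_ge0 f.
apply: opnorm_le; first by rewrite mulr_ge0 ?addr_ge0.
move=> x; apply: nrm_le_functional => xs xd xs1; have n0 := nrm_ge0 x.
rewrite (fcalcE x fB0 xd); apply: (le_trans (weak_calculus_bound TG x fB0 xd)).
rewrite mulrDr [leRHS]mulrDl; apply: lerD.
  apply: ler_pM; rewrite ?cmod_ge0 //.
  by apply: (le_trans fs); rewrite ler_peMl.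
have p0 : 0 <= 2 / pi :> R by rewrite divr_ge0 ?pi_ge0.
have gM : 2 / pi * Num.max 0 gamma <= M.
  rewrite /M; have [g0|g0] := leP gamma 0; first by rewrite mulr0.
  by rewrite le_max mulrAC lexx orbT.
have eg := e0_gfun_le x Hg xd xs1.
apply: (@le_trans _ _ (2 / pi * (Num.max 0 gamma * nrm x * b0 f))).
  by rewrite ler_wpM2l // ler_wpM2r.
have -> (p g n b : R) : p * (g * n * b) = p * g * (b * n) by ring.
by rewrite -[leRHS]mulrA ler_wpM2r ?mulr_ge0.
Qed.

End FinalEstimate.

Theorem theorem3p2 (R : realType) (X : completeNormedModType R[i])
    (T : {linear X -> X}) (hT : bounded_op X X T) (hpow : power_bounded T)
    (hdGSF : dGSF T) :
  [/\ forall f, Bspace f -> represents T f (fcalc T f),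
      B_calculus T (fcalc T)
    & forall gamma : R, dGSF_constant T gamma ->
      forall f, Bspace f ->
      (opnorm (fcalc T f) <= (Num.max 1 (2 * gamma / pi))%:E * Bnorm f)%E].
Proof.
have [K TK] := power_boundedP hpow.
have B0 f : Bspace f -> B0space f := @B0space_Bspace R f.
have rep f (fB : Bspace f) := fcalc_represents TK hT hdGSF (B0 f fB).
have fE f x xs (fB : Bspace f) (xd : dual X xs) := fcalcE TK hT hdGSF x (B0 f fB) xd.
split; [exact: rep| |by move=> gamma Hg f fB; exact: (fcalc_opnorm TK hT hdGSF Hg fB)].
split.
- by move=> f /rep[].
- move=> f g fB gB fg x; apply: functional_separates => xs xd.
  apply: (eq_trans (fE f x xs fB xd)); apply: (eq_trans _ (esym (fE g x xs gB xd))).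
  have E := eq_Bpairing (gfun T x xs) (B0 f fB).1 fg.
  exact: (f_equal2 (fun a b => a * xs x + (2 / pi)%:C * b) (fg 0 (disc0 R)) E).
- move=> f g fB gB x; apply: functional_separates => xs xd.
  apply: (eq_trans (fE _ x xs (BspaceD fB gB) xd)).
  apply: (eq_trans (weak_calculusD hdGSF x (B0 f fB) (B0 g gB) xd)).
  by rewrite linearD /= -(fE f x xs fB xd) -(fE g x xs gB xd).
- move=> a f fB x; apply: functional_separates => xs xd.
  apply: (eq_trans (fE _ x xs (BspaceZ a fB) xd)).
  apply: (eq_trans (weak_calculusZ hdGSF a x (B0 f fB) xd)).
  by rewrite linearZ /= -(fE f x xs fB xd).
- by move=> f g fB gB; exact: (fcalcM TK hT hdGSF (B0 f fB) (B0 g gB) (B0 _ (BspaceM fB gB))).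
- move=> x; apply: functional_separates => xs xd.
  apply: (eq_trans (fE _ x xs (Bspace_cst 1) xd)).
  exact: (weak_value_monomial (hdGSF x xs xd) (gfun_expands x TK hT xd) 0).
- move=> x; apply: functional_separates => xs xd.
  apply: (eq_trans (fE _ x xs (Bspace_id R) xd)).
  exact: (weak_value_monomial (hdGSF x xs xd) (gfun_expands x TK hT xd) 1).
have [K1 K10 HK] := represents_bound hdGSF.
exists K1 => f fB; have [s -> fs] := BnormE fB; rewrite -EFinM.
have s0 : 0 <= s := le_trans (cmod_ge0 _) fs.
apply: opnorm_le; first by rewrite mulr_ge0 ?addr_ge0 ?b0_ge0.
move=> x; apply: (le_trans (HK f _ (B0 f fB) (rep f fB) x)).
by rewrite ler_wpM2r ?nrm_ge0 // ler_wpM2l // lerD2r.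
Qed.
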